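(* Let $B=(B_x)_{x\in\mathbb R^d}$ be a real-valued centered Gaussian field with almost surely continuous paths, stationary with unit variance and covariance function $C$; let $D\subset\mathbb R^d$ be compact with $\mathrm{Vol}(D)>0$. Fix $q\ge2$ and assume $\mathrm{Var}(Y_{q,t})>0$ for all $t$ large enough. If for every $r\in\{1,\dots,q-1\}$, $$\frac{t^d}{\mathrm{Var}(Y_{q,t})^2}\int_{\mathcal B_t^3}|C(x)|^r|C(y)|^r|C(z)|^{q-r}|C(x+y+z)|^{q-r}\,dx\,dy\,dz\longrightarrow 0\quad(t\to\infty),$$ then $Y_{q,t}/\sqrt{\mathrm{Var}(Y_{q,t})}$ converges in law to $N(0,1)$.
   Context: $\mathbb E[B_xB_y]=C(x-y)$, $C(0)=1$. $H_q$ is the $q$-th probabilists' Hermite polynomial, $Y_{q,t}=\int_{tD}H_q(B_x)dx$ with $tD=\{tx:x\in D\}$. $\mathrm{diam}(D)=\sup\{|x-y|:x,y\in D\}$ and $\mathcal B_t=\{u\in\mathbb R^d:|u|\le\mathrm{diam}(D)\,t\}$. *)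

(* Defs.v *)
From HB Require Import structures.
From mathcomp Require Import all_boot all_order all_algebra.
From mathcomp Require Import all_classical all_reals all_analysis.

Set Implicit Arguments.
Unset Strict Implicit.
Unset Printing Implicit Defensive.

Import Order.TTheory GRing.Theory Num.Theory.
Import numFieldNormedType.Exports.

Local Open Scope classical_set_scope.
Local Open Scope ring_scope.

Section Defs.
Variable R : realType.

Definition enorm (d : nat) (x : 'rV[R]_d) : R :=
  Num.sqrt (\sum_(i < d) x ord0 i ^+ 2).

Definition ediam (d : nat) (D : set 'rV[R]_d) : R :=
  sup [set enorm (x - y) | x in D & y in D].

Definition dilate (d : nat) (t : R) (D : set 'rV[R]_d) : set 'rV[R]_d :=
  [set t *: x | x in D].

Definition calB (d : nat) (D : set 'rV[R]_d) (t : R) : set 'rV[R]_d :=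
  [set u | enorm u <= ediam D * t].

(* Integral w.r.t. Lebesgue measure on R^d, written as the iterated
   one-dimensional Lebesgue integral (Fubini/Tonelli):
   int_{R^(n+1)} f = int_R ( int_{R^n} f(a, v) dv ) da. *)
Fixpoint lebRd (n : nat) : ('rV[R]_n -> \bar R) -> \bar R :=
  match n return ('rV[R]_n -> \bar R) -> \bar R with
  | 0 => fun f => f 0
  | n'.+1 => fun f =>
      (\int[@lebesgue_measure R]_(a in [set: R])
          lebRd (fun v : 'rV[R]_n' => f (row_mx (\row_(j < 1) a) v)))%E
  end.

Definition volRd (d : nat) (A : set 'rV[R]_d) : \bar R :=
  lebRd (fun x => (\1_A x)%:E).

(* Probabilists' Hermite polynomials: He_0 = 1, He_1 = X,
   He_(n+1) = X He_n - n He_(n-1).  herm_pair n = (He_n, He_(n+1)). *)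
Fixpoint herm_pair (n : nat) : {poly R} * {poly R} :=
  match n with
  | 0 => (1, 'X)
  | n'.+1 => let: (p, q) := herm_pair n' in (q, 'X * q - n'.+1%:R *: p)
  end.
Definition hermite (n : nat) : {poly R} := (herm_pair n).1.

Definition centered_normal (s : R) : set R -> \bar R :=
  if s == 0 then \d_(0 : R) else normal_prob 0 s.

Context {dT : measure_display} {T : measurableType dT}.

Definition centered_gaussian_field (d : nat) (P : probability T R)
    (B : 'rV[R]_d -> T -> R) : Prop :=
  (forall x, measurable_fun [set: T] (B x)) /\
  forall (n : nat) (xs : 'I_n -> 'rV[R]_d) (a : 'I_n -> R),
    exists s : R, forall A : set R, measurable A ->
      P ((fun w => \sum_(i < n) a i * B (xs i) w) @^-1` A) = centered_normal s A.

Definition Yqt (d : nat) (B : 'rV[R]_d -> T -> R) (D : set 'rV[R]_d)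
    (q : nat) (t : R) (w : T) : R :=
  fine (lebRd (fun x => (\1_(dilate t D) x * (hermite q).[B x w])%:E)).

Definition cvg_law_std_normal (P : probability T R) (Z : R -> T -> R) : Prop :=
  forall f : R -> R, continuous f -> (exists M : R, forall u, `|f u| <= M) ->
    (('E_P[f \o Z t])%E @[t --> +oo] -->
      (\int[normal_prob (0 : R) 1]_(u in [set: R]) (f u)%:E)%E).

End Defs.

(* Main.v *)
Require Import Defs.
From HB Require Import structures.
From mathcomp Require Import all_boot all_order all_algebra.
From mathcomp Require Import all_classical all_reals all_analysis.
From mathcomp Require Import measurable_realfun.
From mathcomp Require Import ring lra zify.
Import Order.TTheory GRing.Theory Num.Theory.
Import numFieldNormedType.Exports.
Set Implicit Arguments.
Unset Strict Implicit.
Unset Printing Implicit Defensive.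
Local Open Scope classical_set_scope.
Local Open Scope ring_scope.

(* Stein's method, with Gaussian integration by parts done one variable at a time.

   Write Y = \int_(tD) H_q(B_x) dx.  The residuals B_y - C(x - y) B_x are independent of B_x,
   and with the residuals frozen Y is a polynomial in u = B_x.  One-dimensional integration by
   parts for u |-> H_(q-1)(u) phi(Y(u)), integrated over x, gives E[Y phi(Y)] = E[phi'(Y) G] with
     G = q \int\int_((tD)^2) C(x - y) H_(q-1)(B_x) H_(q-1)(B_y) dx dy,   E G = Var Y = s^2.
   For a solution phi of Stein's equation phi' - u phi = f - \int f dN(0,1) this becomes
   E f(Y/s) - \int f dN(0,1) = E[phi'(Y/s) (1 - G/s^2)], so it suffices that Var(G) = o(s^4).

   By Wick's formula the covariance of two integrands of G is bounded by a sum over 1 <= r < q of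
   |C12 C34|^r (|C13 C24|^(q-r) + |C14 C23|^(q-r)), where Cij = C(x_i - x_j).  The four points form
   a cycle, so translations turn the integral over (tD)^4 into at most vol(tD) = O(t^d) times the
   integral of the hypothesis. *)

(** The Gaussian hypothesis speaks of finite linear combinations only, whereas Y depends on
    uncountably many values of the field. Orthogonality of B_x to its residuals makes joint
    characteristic functions factor; Fourier uniqueness turns this into independence of B_x from the
    sigma-algebra of all residuals, so that freezing them is Fubini for a product measure. This
    takes the place of Malliavin calculus.

    The exponent r starts at 1 because each integrand of G carries a factor C(x - y), so the Wick
    bound for four copies of H_(q-1), where r starts at 0, is multiplied by |C12 C34|. The term (C12
    C34)^q is the product of the two means and cancels in the covariance.

    The other obstacle is measurability. No regularity of C is assumed, paths are continuous only
    almost surely, and integrals over R^d are iterated one-dimensional ones. Convergence of C along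
    grids follows from that of E cos(B_x - B_y), the field is replaced by 0 on a null set, and the
    iterated integrals are identified with integrals for a genuine measure [lebV]. *)

(** * Real-valued integrals, Fubini, images and densities *)

Section RealIntegral.
Context {R : realType} d (X : measurableType d) (mu : {measure set X -> \bar R}).

Implicit Types f g : X -> R.

Definition integ (f : X -> R) := mu.-integrable [set: X] (EFin \o f).
Local Notation I f := (\int[mu]_x f x).

Lemma integ_meas f : integ f -> measurable_fun setT f.
Proof. by move=> /measurable_int /measurable_EFinP. Qed.

Lemma integ_le f g : measurable_fun setT f -> (forall x, `|f x| <= g x) ->
  integ g -> integ f.
Proof.
move=> mf fg; apply: le_integrable => //; first exact/measurable_EFinP.
move=> x _ /=; rewrite lee_fin (le_trans (fg x))//; exact: ler_norm.
Qed.

Lemma integD f g : integ f -> integ g -> integ (fun x => f x + g x).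
Proof. by move=> hf hg; have := integrableD measurableT hf hg. Qed.

Lemma integB f g : integ f -> integ g -> integ (fun x => f x - g x).
Proof. by move=> hf hg; have := integrableB measurableT hf hg. Qed.

Lemma integZl k f : integ f -> integ (fun x => k * f x).
Proof. by move=> hf; have := integrableZl measurableT k hf. Qed.

Lemma integ0 : integ (fun=> 0).
Proof. exact: integrable0. Qed.

Lemma integ_sum (J : Type) (s : seq J) (F : J -> X -> R) :
  (forall j, integ (F j)) -> integ (fun x => \sum_(j <- s) F j x).
Proof.
move=> h; elim: s => [|j s ih].
  by under eq_fun do rewrite big_nil; exact: integ0.
by under eq_fun do rewrite big_cons; exact: integD.
Qed.

Lemma integ_norm f : integ f -> integ (fun x => `|f x|).
Proof. by move=> hf; have := integrable_norm hf. Qed.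

Lemma RintZl k f : integ f -> I (fun x => k * f x) = k * I f.
Proof. by move=> h; rewrite RintegralZl. Qed.

Lemma RintD f g : integ f -> integ g -> I (fun x => f x + g x) = I f + I g.
Proof. by move=> h h'; rewrite RintegralD. Qed.

Lemma RintB f g : integ f -> integ g -> I (fun x => f x - g x) = I f - I g.
Proof. by move=> h h'; rewrite RintegralB. Qed.

Lemma Rint_sum (J : Type) (s : seq J) (F : J -> X -> R) :
  (forall j, integ (F j)) ->
  I (fun x => \sum_(j <- s) F j x) = \sum_(j <- s) I (F j).
Proof.
move=> h; elim: s => [|j s ih].
  rewrite big_nil; under eq_Rintegral do rewrite big_nil.
  by rewrite /Rintegral integral0.
rewrite big_cons -ih; under eq_Rintegral do rewrite big_cons.
by rewrite RintD //; exact: integ_sum.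
Qed.

Lemma eq_Rint f g : (forall x, f x = g x) -> I f = I g.
Proof. by move=> h; apply: eq_Rintegral => x _. Qed.

Lemma Rint_zero : I (fun=> 0) = 0.
Proof. by rewrite /Rintegral integral0. Qed.

Lemma le_Rint f g : integ f -> integ g -> (forall x, f x <= g x) -> I f <= I g.
Proof. by move=> hf hg h; apply: le_Rintegral. Qed.

Lemma norm_Rint f : integ f -> `|I f| <= I (fun x => `|f x|).
Proof. by move=> hf; apply: le_normr_Rintegral. Qed.

Lemma RintE f : integ f -> (\int[mu]_x (f x)%:E = (I f)%:E)%E.
Proof. by move=> h; rewrite fineK//; exact: integrable_fin_num. Qed.

Lemma integ_ge0P f : measurable_fun setT f -> (forall x, 0 <= f x) ->
  (\int[mu]_x (f x)%:E < +oo)%E -> integ f.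
Proof.
move=> mf f0 h; apply/integrableP; split; first exact/measurable_EFinP.
by under eq_integral do rewrite /= ger0_norm//.
Qed.

Lemma integ_lt f : integ f -> (\int[mu]_x (`|f x|)%:E < +oo)%E.
Proof. by move=> /integrableP[]. Qed.

Lemma Rint_dominated (f_ : nat -> X -> R) (f g : X -> R) :
  (forall n, measurable_fun setT (f_ n)) ->
  (forall x, f_ n x @[n --> \oo] --> f x) ->
  integ g -> (forall n x, `|f_ n x| <= g x) ->
  integ f /\ (I (f_ n) @[n --> \oo] --> I f).
Proof.
move=> mf cf ig le.
have mlim : measurable_fun setT f.
  by apply: (measurable_fun_cvg mf) => x _; exact: cf.
have mf_ n : measurable_fun setT (EFin \o f_ n) by exact/measurable_EFinP.
have ml : measurable_fun setT (EFin \o f) by exact/measurable_EFinP.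
have cvE : {ae mu, forall x, setT x -> (EFin \o f_ n) x @[n --> \oo] --> (EFin \o f) x}.
  by apply: aeW => x _; apply: cvg_EFin; [exact: nearW|exact: cf].
have leE : {ae mu, forall x n, setT x -> (`|(EFin \o f_ n) x| <= (EFin \o g) x)%E}.
  by apply: aeW => x n _; rewrite lee_fin.
have [h1 _ h3] := dominated_convergence measurableT mf_ ml cvE ig leE.
by split=> //; apply: fine_cvg; rewrite -(RintE h1); exact: h3.
Qed.

Lemma integrable_ae_eq (f g : X -> \bar R) : measurable_fun setT g ->
  mu.-integrable setT f -> ae_eq mu setT f g -> mu.-integrable setT g.
Proof.
move=> mg hf fg; apply/integrableP; split=> //.
have mf := measurable_int _ hf.
move/integrableP : hf => [_]; rewrite (ae_eq_integral (abse \o f) (abse \o g))//.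
- exact: measurableT_comp.
- exact: measurableT_comp.
- by apply: filterS fg => x h Dx; rewrite /= h.
Qed.

End RealIntegral.

Section FiniteReal.
Context {R : realType} d (X : measurableType d)
  (mu : {finite_measure set X -> \bar R}).

Lemma integ_bnd (f : X -> R) M : measurable_fun setT f ->
  (forall x, `|f x| <= M) -> integ mu f.
Proof.
move=> mf h; apply: integ_le h _ => //.
exact: finite_measure_integrable_cst.
Qed.

Lemma integ_cst (k : R) : integ mu (fun=> k).
Proof. exact: finite_measure_integrable_cst. Qed.

End FiniteReal.

Section RFubini.
Context {R : realType} d1 d2 (X : measurableType d1) (Y : measurableType d2)
  (m1 : {sigma_finite_measure set X -> \bar R})
  (m2 : {sigma_finite_measure set Y -> \bar R}).
Variable f : X * Y -> R.
Hypothesis hf : integ (m1 \x m2)%E f.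

Let F (x : X) : R := \int[m2]_y f (x, y).
Let G (y : Y) : R := \int[m1]_x f (x, y).

Lemma RFubini1 : integ m1 F /\ \int[m1]_x F x = \int[(m1 \x m2)%E]_z f z.
Proof.
have iF := integrable_fubini_F hf.
(* The inner extended integral is finite only for almost every [x]; elsewhere [F] takes the default
   value of [fine], so the two agree only almost everywhere. *)
have e : ae_eq m1 setT (EFin \o F) (fubini_F m2 (EFin \o f)).
  have := integrable_ae measurableT iF; apply: filterS => x /(_ Logic.I) h _.
  by rewrite /= /F /Rintegral fineK.
have mF : measurable_fun setT (EFin \o F).
  apply/measurable_EFinP.
  by apply: (measurableT_comp (fine_measurable measurableT)) => //;
    exact: measurable_int iF.
have iF' : integ m1 F.
  exact: integrable_ae_eq mF iF (ae_eq_sym e).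
split=> //; rewrite /Rintegral -integral12_prod_meas1//; congr fine.
by apply: ae_eq_integral => //; exact: measurable_int iF.
Qed.

Lemma RFubini2 : integ m2 G /\ \int[m2]_y G y = \int[(m1 \x m2)%E]_z f z.
Proof.
have iF : m2.-integrable setT (fubini_G m1 (EFin \o f)).
  apply/integrableP; split; first exact: (measurable_fubini_G hf).
  have mf := measurable_int _ hf.
  have := hf => /(integrable21ltyP _ _ mf); apply: le_lt_trans.
  apply: ge0_le_integral => //.
  - by apply: measurableT_comp => //; exact: (measurable_fubini_G hf).
  - by apply: (measurable_fun_fubini_tonelli_G (abse \o (EFin \o f))) => //=; exact: measurableT_comp mf.
  - move=> z _; apply: le_abse_integral => //.
    exact: (measurableT_comp mf (pair2_measurable z)).
have e : ae_eq m2 setT (EFin \o G) (fubini_G m1 (EFin \o f)).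
  have := integrable_ae measurableT iF; apply: filterS => x /(_ Logic.I) h _.
  by rewrite /= /G /Rintegral fineK.
have mF : measurable_fun setT (EFin \o G).
  apply/measurable_EFinP.
  by apply: (measurableT_comp (fine_measurable measurableT)) => //;
    exact: measurable_int iF.
have iF' : integ m2 G.
  exact: integrable_ae_eq mF iF (ae_eq_sym e).
split=> //; rewrite /Rintegral -integral21_prod_meas1//; congr fine.
by apply: ae_eq_integral => //; exact: measurable_int iF.
Qed.

Lemma RFubini : \int[m1]_x \int[m2]_y f (x, y) = \int[m2]_y \int[m1]_x f (x, y).
Proof. by rewrite (RFubini1).2 (RFubini2).2. Qed.

End RFubini.

Lemma Rint_probability_cst {R : realType} d (X : measurableType d)
  (P : probability X R) (k : R) : \int[P]_x k = k.
Proof.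
rewrite Rintegral_cst// -[RHS]mulr1; congr (_ * _).
exact: (congr1 fine (probability_setT P)).
Qed.

Section ImageMeasure.
Context {R : realType} d1 d2 (T : measurableType d1) (Y : measurableType d2).
Variables (mu : {measure set T -> \bar R}) (nu : {measure set Y -> \bar R}).
Variable X : T -> Y.
Hypothesis mX : measurable_fun setT X.
Hypothesis law : forall A, measurable A -> mu (X @^-1` A) = nu A.

Lemma ge0_integral_image (f : Y -> \bar R) : measurable_fun setT f ->
  (forall y, 0 <= f y)%E -> (\int[nu]_y f y = \int[mu]_x f (X x))%E.
Proof.
move=> mf f0; transitivity (\int[pushforward mu X]_y f y)%E.
  by apply: eq_measure_integral => A mA _; rewrite -law.
by rewrite ge0_integral_pushforward.
Qed.

Lemma integ_image (g : Y -> R) : measurable_fun setT g ->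
  integ nu g <-> integ mu (g \o X).
Proof.
move=> mg.
have mg' : measurable_fun setT (EFin \o (g \o X)).
  by apply/measurable_EFinP; exact: measurableT_comp.
have mgE : measurable_fun setT (EFin \o g) by exact/measurable_EFinP.
by split=> /integ_lt h; apply/integrableP; split => //; move: h;
  rewrite ge0_integral_image//; apply: measurableT_comp => //; exact: measurableT_comp.
Qed.

Lemma Rint_image (g : Y -> R) : integ nu g -> \int[nu]_y g y = \int[mu]_x g (X x).
Proof.
move=> ig; have mg := integ_meas ig.
congr fine; transitivity (\int[pushforward mu X]_y (g y)%:E)%E.
  by apply: eq_measure_integral => A mA _; rewrite -law.
rewrite integral_pushforward//; first exact/measurable_EFinP.
by rewrite preimage_setT; apply/integ_image.
Qed.

End ImageMeasure.

Lemma integ_prod_bnd {R : realType} d1 d2 (X : measurableType d1) (Y : measurableType d2)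
  (m1 : {finite_measure set X -> \bar R}) (m2 : {finite_measure set Y -> \bar R})
  (f : X * Y -> R) M : measurable_fun setT f -> (forall z, `|f z| <= M) ->
  integ (m1 \x m2)%E f.
Proof.
move=> mf fM; apply: (@measurable_bounded_integrable _ _ _ _ f setT) => //.
- have h := product_measure1E m1 m2 (@measurableT _ X) (@measurableT _ Y).
  rewrite setXTT in h; rewrite [ltLHS](_ : _ = (m1 setT * m2 setT)%E)//.
  apply: lte_mul_pinfty => //.
  + exact: fin_num_measure.
  + by rewrite ltey_eq fin_num_measure.
- by exists M; split; [exact: num_real|move=> x Mx z _; exact: le_trans (fM z) (ltW Mx)].
Qed.

Section Density.
Context {R : realType} d (X : measurableType d).
Variables (mu nu : {measure set X -> \bar R}) (p : X -> R).
Hypothesis mp : measurable_fun setT p.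
Hypothesis p0 : forall x, 0 <= p x.
Hypothesis nuE : forall A, measurable A -> nu A = (\int[mu]_(x in A) (p x)%:E)%E.

Import HBNNSimple.

Let density_nnsfun (h : {nnsfun X >-> R}) :
  (\int[nu]_x (h x)%:E = \int[mu]_x ((h x)%:E * (p x)%:E))%E.
Proof.
rewrite integralT_nnsfun sintegralE.
under [RHS]eq_integral.
  move=> x _; rewrite fimfunE -fsumEFin// muleC ge0_mule_fsumr; last first.
    by move=> r; rewrite EFinM nnfun_muleindic_ge0.
  over.
rewrite ge0_integral_fsum//; last 2 first.
- move=> r; apply: emeasurable_funM; first exact/measurable_EFinP.
  by apply/measurable_EFinP; apply: measurable_funM => //.
- move=> r x _; apply: mule_ge0; first by rewrite lee_fin.
  by rewrite EFinM nnfun_muleindic_ge0.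
apply: eq_fsbigr => r /[!inE] -[y _ <-].
rewrite nuE// integral_mkcond -ge0_integralZl//; last 3 first.
- apply/(measurable_restrictT _ _).1 => //; apply: measurable_funTS.
  exact/measurable_EFinP.
- by move=> x _; rewrite /patch; case: ifP => // _; rewrite lee_fin.
- by rewrite lee_fin.
apply: eq_integral => x _; rewrite /patch indicE.
by case: ifPn => [|] xA; rewrite /= ?mulr1 ?mulr0 ?mule0// muleC.
Qed.

(** Simple functions first, then monotone convergence on both sides. *)
Lemma ge0_integral_density (f : X -> \bar R) : measurable_fun setT f ->
  (forall x, 0 <= f x)%E -> (\int[nu]_x f x = \int[mu]_x (f x * (p x)%:E))%E.
Proof.
move=> mf f0; pose f_ := nnsfun_approx measurableT mf.
have cf x : (f_ n x)%:E @[n --> \oo] --> f x by exact: cvg_nnsfun_approx.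
have nd x : {homo (fun n => f_ n x) : a b / (a <= b)%N >-> a <= b}.
  by move=> a b ab; exact/lefP/nd_nnsfun_approx.
have e1 : (\int[nu]_x f x = limn (fun n => \int[nu]_x (f_ n x)%:E))%E.
  rewrite -monotone_convergence//=.
  - by apply: eq_integral => x _; apply/esym/cvg_lim => //.
  - by move=> n; apply/measurable_EFinP.
  - by move=> n x _; rewrite lee_fin.
  - by move=> x _ a b ab; rewrite lee_fin; exact: nd.
rewrite e1.
have -> : (\int[mu]_x (f x * (p x)%:E) =
    limn (fun n => \int[mu]_x ((f_ n x)%:E * (p x)%:E)))%E.
  rewrite -monotone_convergence//=.
  - apply: eq_integral => x _; apply/esym/cvg_lim => //.
    by apply: cvgeZr => //; exact: cf.
  - move=> n; apply: emeasurable_funM; exact/measurable_EFinP.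
  - by move=> n x _; rewrite mule_ge0 ?lee_fin.
  - by move=> x _ a b ab; rewrite lee_wpmul2r ?lee_fin//; exact: nd.
by congr (limn _); apply/funext => n; rewrite density_nnsfun.
Qed.

Lemma integ_density (f : X -> R) : measurable_fun setT f ->
  integ mu (fun x => f x * p x) ->
  integ nu f /\ \int[nu]_x f x = \int[mu]_x (f x * p x).
Proof.
move=> mf ifp.
have inu : integ nu f.
  apply/integrableP; split; first exact/measurable_EFinP.
  rewrite ge0_integral_density//; last first.
    by apply: measurableT_comp => //; exact/measurable_EFinP.
  have := integ_lt ifp; congr (_ < _)%E; apply: eq_integral => x _.
  by rewrite normrM (ger0_norm (p0 x)).
split=> //; rewrite /Rintegral; congr fine.
rewrite integralE [RHS]integralE; congr (_ - _)%E.
- rewrite ge0_integral_density//; last first.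
    by apply: measurable_funepos; exact/measurable_EFinP.
  apply: eq_integral => x _.
  rewrite !funeposE -!EFin_max -EFinM.
  by rewrite maxr_pMl// mul0r.
- rewrite ge0_integral_density//; last first.
    by apply: measurable_funeneg; exact/measurable_EFinP.
  apply: eq_integral => x _.
  rewrite !funenegE -!EFinN -!EFin_max -EFinM.
  by rewrite maxr_pMl// mul0r mulNr.
Qed.

End Density.

Section PolyBounded.
Context {R : realType}.
Implicit Types g h : R -> R.

(** A growth class stable under sums and products that contains polynomials and bounded functions,
    hence every polynomial times phi of a polynomial. The weight is at least 1, so exponents can be
    raised freely. *)
Definition polyb g := exists K m, forall u, `|g u| <= K * (1 + u ^+ 2) ^+ m.

Lemma polyb_cst k : polyb (fun=> k).
Proof. by exists `|k|, 0%N => u; rewrite expr0 mulr1. Qed.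

Lemma polyb_bnd g M : (forall u, `|g u| <= M) -> polyb g.
Proof. by move=> h; exists M, 0%N => u; rewrite expr0 mulr1. Qed.

Lemma polyb_id : polyb id.
Proof.
exists 1, 1%N => u; rewrite expr1 mul1r.
have h : 0 <= (`|u| - 1) ^+ 2 by exact: sqr_ge0.
have e : `|u| ^+ 2 = u ^+ 2 by rewrite real_normK ?num_real.
nra.
Qed.

Lemma polybM g h : polyb g -> polyb h -> polyb (fun u => g u * h u).
Proof.
move=> [K [m hK]] [L [n hL]]; exists (K * L), (m + n)%N => u.
by rewrite normrM exprD mulrACA ler_pM.
Qed.

Lemma polybD g h : polyb g -> polyb h -> polyb (fun u => g u + h u).
Proof.
move=> [K [m hK]] [L [n hL]]; exists (`|K| + `|L|), (m + n)%N => u.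
have u1 : 1 <= 1 + u ^+ 2 by rewrite lerDl sqr_ge0.
have le1 k : 1 <= (1 + u ^+ 2) ^+ k by rewrite exprn_ege1.
apply: (le_trans (ler_normD _ _)); rewrite mulrDl lerD//.
- apply: (le_trans (hK u)); rewrite exprD.
  apply: (@le_trans _ _ (`|K| * (1 + u ^+ 2) ^+ m)).
    by rewrite ler_wpM2r ?ler_norm// (le_trans ler01).
  by rewrite ler_wpM2l// ler_peMr// (le_trans ler01).
- apply: (le_trans (hL u)); rewrite exprD.
  apply: (@le_trans _ _ (`|L| * (1 + u ^+ 2) ^+ n)).
    by rewrite ler_wpM2r ?ler_norm// (le_trans ler01).
  by rewrite ler_wpM2l// ler_peMl// (le_trans ler01).
Qed.

Lemma polyb_eq g h : g =1 h -> polyb g -> polyb h.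
Proof. by move=> e [K [m hK]]; exists K, m => u; rewrite -e. Qed.

Lemma polyb_horner (p : {poly R}) : polyb (fun u => p.[u]).
Proof.
elim/poly_ind: p => [|p c ih].
  by apply: (polyb_eq (g := fun=> 0)); [move=> u; rewrite horner0|exact: polyb_cst].
apply: (polyb_eq (g := fun u => p.[u] * u + c)).
  by move=> u; rewrite !hornerE.
by apply: polybD (polyb_cst c); apply: polybM polyb_id.
Qed.

End PolyBounded.

(** * One-dimensional Gaussian analysis and Stein's equation *)

Section Normal.
Context {R : realType}.
Variable s : R.
Hypothesis s0 : s != 0.
Local Notation leb := (@lebesgue_measure R).
Local Notation pdf := (normal_pdf (0 : R) s).
Local Notation N := (normal_prob (0 : R) s).
Implicit Types g h : R -> R.

Let s2_gt0 : 0 < s ^+ 2. Proof. by rewrite exprn_even_gt0. Qed.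

Lemma pdfE u : pdf u = normal_peak s * expR (- u ^+ 2 / (s ^+ 2 *+ 2)).
Proof. by rewrite normal_pdfE// /normal_fun subr0. Qed.

(** Since z^m <= m! e^z, the weight (1 + u^2)^m costs at most a constant times exp(u^2 / (4 s^2)),
    which is half of the Gaussian exponent; the other half survives. *)
Lemma polyb_pdf g : polyb g -> exists2 K, 0 <= K &
  forall u, `|g u| * pdf u <= K * expR (- u ^+ 2 / (s ^+ 2 *+ 4)).
Proof.
move=> [K [m hK]].
pose M := m`!%:R * (s ^+ 2 *+ 4) ^+ m : R.
have M0 : 0 <= M by rewrite mulr_ge0// exprn_ge0// mulrn_wge0// ltW.
have key u : (1 + u ^+ 2) ^+ m <= M * expR ((1 + u ^+ 2) / (s ^+ 2 *+ 4)).
  have u0 : 0 <= (1 + u ^+ 2) / (s ^+ 2 *+ 4).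
    by rewrite divr_ge0 ?addr_ge0 ?sqr_ge0// mulrn_wge0// ltW.
  have h : ((1 + u ^+ 2) / (s ^+ 2 *+ 4)) ^+ m / m`!%:R <=
      expR ((1 + u ^+ 2) / (s ^+ 2 *+ 4)).
    case: (m) => [|n]; last by apply: le_trans (expR_ge1Dxn n u0); rewrite lerDr.
    by rewrite expr0 fact0 divr1 (le_trans _ (expR_ge1Dx _))// lerDl.
  have c0 : 0 < s ^+ 2 *+ 4 by rewrite mulrn_wgt0.
  have f0 : 0 < m`!%:R :> R by rewrite ltr0n fact_gt0.
  move: h; rewrite ler_pdivrMr// expr_div_n ler_pdivrMr ?exprn_gt0// => h.
  apply: (le_trans h); rewrite le_eqVlt; apply/orP; left; apply/eqP.
  by rewrite /M; ring.
move: M M0 key => {}M M0 key.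
exists (`|K| * M * expR (s ^+ 2 *+ 4)^-1 * normal_peak s).
  by apply: mulr_ge0 (normal_peak_ge0 _); apply: mulr_ge0 (expR_ge0 _); exact: mulr_ge0.
move=> u; rewrite pdfE.
apply: (@le_trans _ _ ((`|K| * (M * expR ((1 + u ^+ 2) / (s ^+ 2 *+ 4)))) *
   (normal_peak s * expR (- u ^+ 2 / (s ^+ 2 *+ 2))))).
  apply: ler_wpM2r; first by rewrite mulr_ge0 ?expR_ge0 ?normal_peak_ge0.
  apply: (le_trans (hK u)); apply: le_trans (ler_wpM2l (normr_ge0 K) (key u)).
  by rewrite ler_wpM2r ?ler_norm// exprn_ge0// addr_ge0 ?sqr_ge0.
have s20 : s ^+ 2 != 0 by rewrite gt_eqF.
have -> : (1 + u ^+ 2) / (s ^+ 2 *+ 4) =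
  (s ^+ 2 *+ 4)^-1 + (- u ^+ 2 / (s ^+ 2 *+ 4) - (- u ^+ 2 / (s ^+ 2 *+ 2))).
  move: (s ^+ 2) (u ^+ 2) s20 => a b a0; rewrite -!(mulr_natr a).
  Timeout 20 by field; rewrite a0.
rewrite expRD expRD expRN.
have := expR_gt0 (- u ^+ 2 / (s ^+ 2 *+ 2)) => /lt0r_neq0.
move: (expR (- u ^+ 2 / (s ^+ 2 *+ 2))) => A A0.
move: (expR _) (expR _) (normal_peak s) (`|K|) => a b c k.
rewrite le_eqVlt; apply/orP; left; apply/eqP.
Timeout 20 by field.
Qed.

Lemma integ_gauss4 : integ leb (fun u => expR (- u ^+ 2 / (s ^+ 2 *+ 4))).
Proof.
(* Up to its peak, the integrand is the normal density with standard deviation [Num.sqrt 2 * s]. *)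
have t0 : Num.sqrt 2 * s != 0 :> R.
  by rewrite mulf_neq0// gt_eqF// sqrtr_gt0.
have h := integZl (normal_peak (Num.sqrt 2 * s))^-1 (integrable_normal_pdf 0 (Num.sqrt 2 * s)).
apply: eq_integrable h => // u _ /=; congr (_%:E).
rewrite normal_pdfE// mulKf ?gt_eqF ?normal_peak_gt0//.
rewrite /normal_fun subr0 exprMn sqr_sqrtr ?ler0n; last by [].
have -> : 2 * s ^+ 2 *+ 2 = s ^+ 2 *+ 4 by ring.
by [].
Qed.

Lemma polyb_integ_pdf g : measurable_fun setT g -> polyb g ->
  integ leb (fun u => g u * pdf u).
Proof.
move=> mg /polyb_pdf[K K0 hK].
apply: (integ_le _ _ (integZl K integ_gauss4)).
- by apply: measurable_funM => //; exact: measurable_normal_pdf.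
- by move=> u; rewrite normrM (ger0_norm (normal_pdf_ge0 _ _ _)).
Qed.

Lemma normal_density g : measurable_fun setT g -> polyb g ->
  integ N g /\ \int[N]_u g u = \int[leb]_u (g u * pdf u).
Proof.
move=> mg pg; apply: integ_density => //.
- exact: measurable_normal_pdf.
- by move=> u; exact: normal_pdf_ge0.
- exact: polyb_integ_pdf.
Qed.

(** These are the boundary terms of the integration by parts; the sign [e] selects the end of the
    line. *)
Lemma pdf_cvg0 g (e : R) : polyb g -> (e == 1) || (e == -1) ->
  g (e * n%:R) * pdf (e * n%:R) @[n --> \oo] --> 0.
Proof.
move=> /polyb_pdf[K K0 hK] he.
have e2 : e ^+ 2 = 1 by case/orP : he => /eqP ->; rewrite ?sqrrN expr1n.
pose a : R := s ^+ 2 *+ 4.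
have a0 : 0 < a by rewrite mulrn_wgt0.
apply/cvgr0Pnorm_le => eps eps0; near=> n.
have n0 : (0 < n)%N by near: n; exists 1%N.
rewrite normrM (ger0_norm (normal_pdf_ge0 _ _ _)).
apply: (le_trans (hK _)); rewrite exprMn e2 mul1r mulNr expRN.
rewrite -/a.
have nn : n%:R <= n%:R ^+ 2 :> R.
  by rewrite -natrX ler_nat expnS expn1 leq_pmulr.
have h1 : n%:R / a <= expR (n%:R ^+ 2 / a).
  apply: le_trans (expR_ge1Dx _); apply: (@le_trans _ _ (n%:R ^+ 2 / a)).
    by rewrite ler_wpM2r// invr_ge0 ltW.
  by rewrite lerDr.
rewrite ler_pdivrMr ?expR_gt0//.
apply: le_trans (ler_wpM2l (ltW eps0) h1).
rewrite mulrA ler_pdivlMr// -ler_pdivrMl// mulrC.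
near: n; exact: nbhs_infty_ger.
Unshelve. all: by end_near. Qed.

End Normal.

Section NormalIBP.
Context {R : realType}.
Variable s : R.
Hypothesis s0 : s != 0.
Local Notation leb := (@lebesgue_measure R).
Local Notation pdf := (normal_pdf (0 : R) s).
Local Notation N := (normal_prob (0 : R) s).
Implicit Types g h : R -> R.

Lemma is_derive_pdf (u : R) : is_derive u 1 pdf (- u / s ^+ 2 * pdf u).
Proof.
pose c : R := - (s ^+ 2 *+ 2)^-1.
have s20 : s ^+ 2 != 0 by rewrite expf_neq0.
have dq : is_derive u 1 (fun v : R => c * v ^+ 2) (- u / s ^+ 2).
  have h := @is_deriveZ _ _ _ (fun v : R => v ^+ 2) c u 1 _ (is_deriveX 2 (is_derive_id u 1)).
  apply: is_derive_eq h _; rewrite /= /c /GRing.scale /= expr1.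
  by rewrite -(mulr_natr (s ^+ 2)); field; rewrite s0.
have de := @is_derive1_comp _ expR (fun v : R => c * v ^+ 2) u _ _ (is_derive_expR _) dq.
have h := @is_deriveZ _ _ _ _ (normal_peak s) u 1 _ de.
have -> : pdf = (fun v => normal_peak s * (expR \o (fun v : R => c * v ^+ 2)) v).
  apply/funext => v; rewrite pdfE//= /c; congr (_ * expR _).
  by rewrite mulNr mulrC mulNr.
apply: is_derive_eq h _; rewrite /GRing.scale /=; ring.
Qed.

Lemma derive_continuous g (g' : R -> R) : (forall u : R, is_derive u 1 g (g' u)) ->
  continuous g.
Proof.
by move=> dg u; apply: differentiable_continuous; apply/derivable1_diffP; case: (dg u).
Qed.

Lemma normal_ibp g (g' : R -> R) : (forall u : R, is_derive u 1 g (g' u)) ->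
  continuous g' -> polyb g -> polyb g' ->
  \int[N]_u (u * g u) = s ^+ 2 * \int[N]_u g' u.
Proof.
move=> dg cg' pg pg'.
have s20 : s ^+ 2 != 0 by rewrite expf_neq0.
have cg := derive_continuous dg.
have mg := continuous_measurable_fun cg.
have mg' := continuous_measurable_fun cg'.
have mug : measurable_fun setT (fun u : R => u * g u) by exact: measurable_funM.
have pug := polybM polyb_id pg.
have [ig' ->] := normal_density s0 mg' pg'.
have [iug ->] := normal_density s0 mug pug.
have Ig' := polyb_integ_pdf s0 mg' pg'.
have Iug := polyb_integ_pdf s0 mug pug.
(* [h] is the derivative of [g * pdf], and the claim says that its integral over the line is 0. *)
pose h u := g' u * pdf u - (s ^+ 2)^-1 * (u * g u * pdf u).
have Ih : integ leb h by apply: integB => //; exact: integZl.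
pose F u := g u * pdf u.
have dF (u : R) : is_derive u 1 F (h u).
  apply: is_derive_eq (is_deriveM (dg u) (is_derive_pdf u)) _.
  by rewrite /h /GRing.scale /=; field; rewrite s0.
have ch : continuous h.
  have cp : continuous pdf by exact: continuous_normal_pdf.
  move=> u; apply: cvgB; first by apply: cvgM; [exact: cg'|exact: cp].
  apply: cvgM; first exact: cvg_cst.
  by apply: cvgM; [apply: cvgM; [exact: cvg_id|exact: cg]|exact: cp].
have cF := derive_continuous dF.
(* The successor keeps the endpoints distinct, as the fundamental theorem of calculus requires. *)
pose h_ n : R -> R := h \_ `[- n.+1%:R, n.+1%:R].
have fn n : \int[leb]_u h_ n u = F n.+1%:R - F (- n.+1%:R).
  rewrite /h_ -Rintegral_mkcond /Rintegral (continuous_FTC2 (F := F)).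
  - by [].
  - by rewrite -subr_gt0 opprK addr_gt0.
  - by apply: continuous_subspaceT => u; exact: ch.
  - split=> [u _||].
    + by case: (dF u).
    + by apply: cvg_at_right_filter; exact: cF.
    + by apply: cvg_at_left_filter; exact: cF.
  - by move=> u _; rewrite derive1E; case: (dF u).
have [] := @Rint_dominated _ _ _ leb h_ h (fun u => `|h u|).
- move=> n; apply/(measurable_restrictT _ _).1 => //; apply: measurable_funTS.
  exact: continuous_measurable_fun.
- move=> u; apply: cvg_near_cst; near=> n; rewrite /h_ /patch mem_set//=.
  rewrite in_itv/= -ler_norml.
  have : `|u| <= n%:R by near: n; exact: nbhs_infty_ger.
  by move=> /le_trans; apply; rewrite ler_nat.
- exact: integ_norm.
- by move=> n u; rewrite /h_ /patch; case: ifP => //; rewrite normr0.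
move=> _ lim1.
have lim0 : \int[leb]_u h_ n u @[n --> \oo] --> (0 : R).
  under eq_fun do rewrite fn.
  rewrite -[0]subr0; apply: cvgB.
  + have := @pdf_cvg0 _ _ s0 g 1 pg; rewrite eqxx => /(_ isT).
    rewrite -(cvg_shiftS (fun n : nat => _)) /=.
    by under eq_fun do rewrite mul1r.
  + have := @pdf_cvg0 _ _ s0 g (-1) pg; rewrite eqxx orbT => /(_ isT).
    rewrite -(cvg_shiftS (fun n : nat => _)) /=.
    by under eq_fun do rewrite mulN1r.
have /eqP : \int[leb]_u h u = 0.
  have /= <- := cvg_lim (@Rhausdorff R) lim1.
  exact: (cvg_lim (@Rhausdorff R) lim0).
rewrite RintB//; last exact: integZl.
rewrite RintZl// subr_eq0 => /eqP ->.
by rewrite mulrA divff// mul1r.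
Unshelve. all: by end_near. Qed.

Lemma normal_moment2 : \int[N]_u (u ^+ 2) = s ^+ 2.
Proof.
have c1 : continuous (fun _ : R => 1 : R) by move=> u; exact: cvg_cst.
have := normal_ibp (fun u => is_derive_id u 1) c1 polyb_id (polyb_cst 1).
rewrite Rint_probability_cst mulr1 => <-.
by apply: eq_Rint => u; rewrite expr2.
Qed.

Lemma ode_gauss (psi : R -> R) :
  (forall t : R, is_derive t 1 psi (- (s ^+ 2 * t * psi t))) ->
  forall t, psi t = psi 0 * expR (- (s * t) ^+ 2 / 2).
Proof.
move=> dpsi t.
(* Integrating factor: [psi * E] has derivative 0. *)
pose E (t : R) := expR ((s * t) ^+ 2 / 2).
have dE (u : R) : is_derive u 1 E (s ^+ 2 * u * E u).
  pose c : R := s ^+ 2 / 2.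
  have dq : is_derive u 1 (fun v : R => c * v ^+ 2) (s ^+ 2 * u).
    have h := @is_deriveZ _ _ _ (fun v : R => v ^+ 2) c u 1 _ (is_deriveX 2 (is_derive_id u 1)).
    apply: is_derive_eq h _; rewrite /= /c /GRing.scale /= expr1.
    by field.
  have de := @is_derive1_comp _ expR (fun v : R => c * v ^+ 2) u _ _ (is_derive_expR _) dq.
  have e v : E v = expR (c * v ^+ 2) by rewrite /E /c; congr expR; field.
  rewrite (_ : E = expR \o (fun v : R => c * v ^+ 2)); last by apply/funext.
  by apply: is_derive_eq de _; rewrite /= mulrC.
have dF u : is_derive u (1 : R) (fun v => psi v * E v) 0.
  apply: is_derive_eq (is_deriveM (dpsi u) (dE u)) _.
  by rewrite /GRing.scale /=; ring.
have := is_derive_0_is_cst t 0 dF.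
rewrite /E mulr0 expr0n /= mul0r expR0 mulr1 => <-.
by rewrite -mulrA -expRD -mulrDl subrr mul0r expR0 mulr1.
Qed.

End NormalIBP.

Section NormalFourier.
Context {R : realType}.
Variable s : R.
Hypothesis s0 : s != 0.
Local Notation N := (normal_prob (0 : R) s).

Lemma continuous_sinM (t : R) : continuous (fun u : R => sin (t * u)).
Proof.
move=> u; apply: (@continuous_comp _ _ _ (fun u => t * u) sin); last exact: continuous_sin.
by apply: cvgM; [exact: cvg_cst|exact: cvg_id].
Qed.

Lemma continuous_cosM (t : R) : continuous (fun u : R => cos (t * u)).
Proof.
move=> u; apply: (@continuous_comp _ _ _ (fun u => t * u) cos); last exact: continuous_cos.
by apply: cvgM; [exact: cvg_cst|exact: cvg_id].
Qed.

Lemma norm_sin_le1 (u : R) : `|sin u| <= 1.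
Proof. by rewrite ler_norml sin_geN1 sin_le1. Qed.

Lemma norm_cos_le1 (u : R) : `|cos u| <= 1.
Proof. by rewrite ler_norml cos_geN1 cos_le1. Qed.

Lemma is_derive_linear (t u : R) : is_derive u (1 : R) (fun u : R => t * u) t.
Proof.
apply: is_derive_eq (@is_deriveZ _ _ _ id t u 1 _ (is_derive_id u 1)) _.
by rewrite /GRing.scale /= mulr1.
Qed.

Lemma is_derive_sinM (t u : R) : is_derive u (1 : R) (fun u : R => sin (t * u)) (t * cos (t * u)).
Proof.
have h := @is_derive1_comp _ sin (fun u => t * u) u _ _ (is_derive_sin _) (is_derive_linear t u).
by apply: is_derive_eq h _; rewrite mulrC.
Qed.

Lemma is_derive_cosM (t u : R) : is_derive u (1 : R) (fun u : R => cos (t * u)) (- (t * sin (t * u))).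
Proof.
have h := @is_derive1_comp _ cos (fun u => t * u) u _ _ (is_derive_cos _) (is_derive_linear t u).
by apply: is_derive_eq h _; rewrite mulNr mulrC.
Qed.

Let mcos (t : R) := continuous_measurable_fun (@continuous_cosM t).
Let msin (t : R) := continuous_measurable_fun (@continuous_sinM t).

Lemma integ_cos t : integ N (fun u => cos (t * u)).
Proof. by apply: (@integ_bnd _ _ _ _ _ 1) => [|u]; [exact: mcos|exact: norm_cos_le1]. Qed.

Lemma integ_sin t : integ N (fun u => sin (t * u)).
Proof. by apply: (@integ_bnd _ _ _ _ _ 1) => [|u]; [exact: msin|exact: norm_sin_le1]. Qed.

Lemma integ_normabs : integ N (fun u => `|u|).
Proof.
apply: integ_norm; have mid : measurable_fun setT (@id R) by [].
exact: (normal_density s0 mid polyb_id).1.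
Qed.

Lemma derive_under_N (f df : R -> R -> R) :
  (forall t, integ N (f t)) ->
  (forall t u : R, is_derive t 1 (f ^~ u) (df t u)) ->
  (forall t u, `|df t u| <= `|u|) ->
  forall t : R, is_derive t 1 (fun t => \int[N]_u f t u) (\int[N]_u df t u).
Proof.
move=> If Df bnd t.
have tt : `](t - 1), (t + 1)[%classic t by rewrite /= in_itv/= ltrBlDr ltrDl ltr01.
have pE x u : partial1of2 f x u = df x u.
  by rewrite /partial1of2 derive1E; case: (Df x u).
have d1 := @derivable_under_integral _ _ _ N f setT measurableT t (t - 1) (t + 1) tt
  (fun x _ => If x) (fun x u _ _ => ltac:(by case: (Df x u))) (fun u => `|u|)
  (fun u => normr_ge0 _) integ_normabs
  (fun x u _ _ => ltac:(by rewrite pE)).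
have d2 := @differentiation_under_integral _ _ _ N f setT measurableT t (t - 1) (t + 1) tt
  (fun x _ => If x) (fun x u _ _ => ltac:(by case: (Df x u))) (fun u => `|u|)
  (fun u => normr_ge0 _) integ_normabs
  (fun x u _ _ => ltac:(by rewrite pE)).
apply: DeriveDef; first exact: d1.
by rewrite -derive1E d2; apply: eq_Rint => u; rewrite pE.
Qed.

(** Differentiation in [t] brings down a factor u, which [normal_ibp] exchanges for s^2 t; the
    resulting linear equation is solved by [ode_gauss]. *)
Lemma normal_cos t : \int[N]_u cos (t * u) = expR (- (s * t) ^+ 2 / 2).
Proof.
pose psi t := \int[N]_u cos (t * u).
have h (x : R) : is_derive x 1 psi (- (s ^+ 2 * x * psi x)).
  have := @derive_under_N (fun t u => cos (t * u)) (fun t u => - (u * sin (t * u)))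
    integ_cos _ _ x.
  have -> : \int[N]_u - (u * sin (x * u)) = - (s ^+ 2 * x * psi x).
    have h1 := @normal_ibp _ _ s0 _ _ (is_derive_sinM x).
    under eq_Rintegral => u _ do rewrite -mulN1r.
    have ii : integ N (fun u => u * sin (x * u)).
      apply: (integ_le _ _ integ_normabs); first by apply: measurable_funM => //; exact: msin.
      by move=> u; rewrite normrM ler_piMr// norm_sin_le1.
    rewrite RintZl// mulN1r h1.
    - by rewrite RintZl ?mulrA//; exact: integ_cos.
    - move=> u; apply: cvgM; [exact: cvg_cst|exact: continuous_cosM].
    - by apply: polyb_bnd => u; exact: norm_sin_le1.
    - by apply: polybM; [exact: polyb_cst|apply: polyb_bnd => u; exact: norm_cos_le1].
  apply.
  - move=> t0 u; under eq_fun do rewrite mulrC.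
    by rewrite [t0 * u]mulrC; exact: is_derive_cosM.
  - by move=> t0 u; rewrite normrN normrM ler_piMr// norm_sin_le1.
have := ode_gauss h t; rewrite /psi => ->.
under eq_Rintegral do rewrite mul0r cos0.
by rewrite Rint_probability_cst mul1r.
Qed.

Lemma normal_sin t : \int[N]_u sin (t * u) = 0.
Proof.
pose psi t := \int[N]_u sin (t * u).
have h (x : R) : is_derive x 1 psi (- (s ^+ 2 * x * psi x)).
  have := @derive_under_N (fun t u => sin (t * u)) (fun t u => u * cos (t * u))
    integ_sin _ _ x.
  have -> : \int[N]_u (u * cos (x * u)) = - (s ^+ 2 * x * psi x).
    have h1 := @normal_ibp _ _ s0 _ _ (is_derive_cosM x).
    rewrite h1.
    - under eq_Rintegral do rewrite -mulNr.
      by rewrite RintZl ?mulrA ?mulrN ?mulNr//; exact: integ_sin.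
    - move=> u; apply: cvgN; apply: cvgM; [exact: cvg_cst|exact: continuous_sinM].
    - by apply: polyb_bnd => u; exact: norm_cos_le1.
    - apply: (polyb_eq (g := fun u => (- x) * sin (x * u))).
        by move=> u; rewrite mulNr.
      by apply: polybM; [exact: polyb_cst|apply: polyb_bnd => u; exact: norm_sin_le1].
  apply.
  - move=> t0 u; under eq_fun do rewrite mulrC.
    by rewrite [t0 * u]mulrC; exact: is_derive_sinM.
  - by move=> t0 u; rewrite normrM ler_piMr// norm_cos_le1.
have := ode_gauss h t; rewrite /psi => ->.
under eq_Rintegral do rewrite mul0r sin0.
by rewrite Rint_probability_cst mul0r.
Qed.

End NormalFourier.

Section GaussianLaw.
Context {R : realType} d (T : measurableType d) (P : probability T R).
Variables (s : R) (X : T -> R).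
Hypothesis mX : measurable_fun setT X.
Hypothesis lawX : forall A, measurable A -> P (X @^-1` A) = centered_normal s A.
Implicit Types g : R -> R.

(** A linear combination of field values may be degenerate, as the residual of a point with respect
    to itself is; then X = 0 almost surely. *)
Lemma law_dirac g : s = 0 -> measurable_fun setT g ->
  integ P (g \o X) /\ \int[P]_w g (X w) = g 0.
Proof.
move=> s0 mg.
have mgX : measurable_fun setT (g \o X) by exact: measurableT_comp.
have X0 : P (X @^-1` [set~ 0]) = 0%E.
  rewrite lawX; last exact: measurableC.
  by rewrite /centered_normal s0 eqxx diracE memNset//= => /(_ erefl).
have e : ae_eq P setT (EFin \o (g \o X)) (EFin \o cst (g 0)).
  exists (X @^-1` [set~ 0]); split => //.
    by rewrite -[X in measurable X]setTI; apply: mX => //; exact: measurableC.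
  move=> w /= /not_implyP[_ h] X0'; apply: h; by rewrite X0'.
have ic : integ P (fun=> g 0) by exact: integ_cst.
split.
  apply: (integrable_ae_eq _ ic (ae_eq_sym e)); exact/measurable_EFinP.
rewrite -[RHS](Rint_probability_cst P); congr fine.
by apply: ae_eq_integral => //; exact/measurable_EFinP.
Qed.

Lemma law_normal g : s != 0 -> measurable_fun setT g -> polyb g ->
  integ P (g \o X) /\ \int[P]_w g (X w) = \int[normal_prob (0 : R) s]_u g u.
Proof.
move=> s0 mg pg.
have [ig _] := normal_density s0 mg pg.
have e A : measurable A -> P (X @^-1` A) = normal_prob (0 : R) s A.
  by move=> mA; rewrite lawX// /centered_normal (negbTE s0).
split; first exact/(@integ_image _ _ _ _ _ P (normal_prob 0 s) _ mX e _ mg).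
by rewrite (@Rint_image _ _ _ _ _ P (normal_prob 0 s) _ mX e _ ig).
Qed.

Lemma law_polyb g : measurable_fun setT g -> polyb g -> integ P (g \o X).
Proof.
move=> mg pg; have [s0|s0] := eqVneq s 0.
  exact: (law_dirac s0 mg).1.
exact: (law_normal s0 mg pg).1.
Qed.

Lemma law_moment2 : \int[P]_w (X w ^+ 2) = s ^+ 2.
Proof.
have m2 : measurable_fun setT (fun u : R => u ^+ 2) by [].
have [s0|s0] := eqVneq s 0.
  by rewrite (law_dirac s0 m2).2 s0.
rewrite (law_normal s0 m2 _).2 ?normal_moment2//.
by apply: polybM; exact: polyb_id.
Qed.

Lemma law_cos t : \int[P]_w cos (t * X w) = expR (- (s ^+ 2 * t ^+ 2) / 2).
Proof.
have m2 : measurable_fun setT (fun u : R => cos (t * u)).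
  exact: continuous_measurable_fun (@continuous_cosM R t).
have [s0|s0] := eqVneq s 0.
  by rewrite (law_dirac s0 m2).2 s0 mulr0 cos0 expr0n /= mul0r oppr0 mul0r expR0.
rewrite (law_normal s0 m2 _).2 ?normal_cos ?exprMn//.
by apply: polyb_bnd => u; exact: norm_cos_le1.
Qed.

Lemma law_sin t : \int[P]_w sin (t * X w) = 0.
Proof.
have m2 : measurable_fun setT (fun u : R => sin (t * u)).
  exact: continuous_measurable_fun (@continuous_sinM R t).
have [s0|s0] := eqVneq s 0.
  by rewrite (law_dirac s0 m2).2 mulr0 sin0.
rewrite (law_normal s0 m2 _).2 ?normal_sin//.
by apply: polyb_bnd => u; exact: norm_sin_le1.
Qed.

End GaussianLaw.

Section Stein.
Context {R : realType}.
Local Notation leb := (@lebesgue_measure R).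
Local Notation p := (normal_pdf (0 : R) 1).
Local Notation N := (normal_prob (0 : R) 1).

Let one0 : (1 : R) != 0. Proof. exact: oner_neq0. Qed.

Lemma stdpdfE (u : R) : p u = normal_peak 1 * gauss_fun (u / Num.sqrt 2).
Proof.
rewrite pdfE// expr1n /gauss_fun expr_div_n sqr_sqrtr ?ler0n//.
by rewrite mulNr.
Qed.

Lemma stdpdfN (u : R) : p (- u) = p u.
Proof. by rewrite !pdfE// sqrrN. Qed.

Lemma stdpdf_gt0 (u : R) : 0 < p u.
Proof. by rewrite pdfE// mulr_gt0 ?expR_gt0 ?normal_peak_gt0. Qed.

Lemma is_derive_stdpdf (u : R) : is_derive u 1 p (- (u * p u)).
Proof.
apply: is_derive_eq (is_derive_pdf one0 u) _.
by rewrite expr1n divr1 mulNr.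
Qed.

Let cp : continuous p. Proof. exact: continuous_normal_pdf. Qed.

Lemma integ_stdpdf : integ leb p.
Proof. exact: integrable_normal_pdf. Qed.

Lemma Rint_stdpdf : \int[leb]_u p u = 1.
Proof. by rewrite /Rintegral integral_normal_pdf. Qed.

Lemma stdpdf_cvgy : p u @[u --> +oo] --> (0 : R).
Proof.
rewrite (_ : p = fun u => normal_peak 1 * gauss_fun (u / Num.sqrt 2)); last first.
  by apply/funext => u; exact: stdpdfE.
rewrite -[X in _ --> X](mulr0 (normal_peak 1)); apply: cvgM; first exact: cvg_cst.
apply: (@cvg_comp _ _ _ (fun u : R => u / Num.sqrt 2) gauss_fun); last exact: cvg_gauss_fun.
apply: gt0_cvgMly; last exact: cvg_id.
by rewrite invr_gt0 sqrtr_gt0.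
Qed.

(** Mills' bound: on the half-line a <= u, and u p(u) is the derivative of -p(u). *)
Lemma mills_right (a : R) : 0 < a ->
  a * \int[leb]_(u in `[a, +oo[) p u <= p a.
Proof.
move=> a0.
have e : (\int[leb]_(u in `[a, +oo[) (u * p u)%:E = (0 - - p a)%:E)%E.
  rewrite (@ge0_continuous_FTC2y _ _ (fun u => - p u) a 0).
  - by [].
  - by move=> x ax; rewrite mulr_ge0 ?(ltW (stdpdf_gt0 _))// (le_trans (ltW a0)).
  - apply: continuous_subspaceT => u.
    by apply: cvgM; [exact: cvg_id|exact: cp].
  - by rewrite -[X in _ --> X]oppr0; apply: cvgN; exact: stdpdf_cvgy.
  - move=> x _; have h := is_deriveN (is_derive_stdpdf x); by case: h.
  - by apply: cvg_at_right_filter; apply: cvgN; exact: cp.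
  - move=> x _; have h := is_deriveN (is_derive_stdpdf x).
    by rewrite derive1E; case: h => _ ->; rewrite opprK.
have mu : measurable_fun setT (fun u : R => u * p u).
  by apply: measurable_funM => //; exact: measurable_normal_pdf.
rewrite sub0r opprK in e.
have pos : (\int[leb]_(u in `[a, +oo[) (a * p u)%:E <= (p a)%:E)%E.
  rewrite -e; apply: ge0_le_integral => //.
  - by move=> x _; rewrite lee_fin mulr_ge0 ?ltW// stdpdf_gt0.
  - apply/measurable_EFinP/measurable_funTS/measurable_funM => //.
    exact: measurable_normal_pdf.
  - exact/measurable_EFinP/measurable_funTS.
  - move=> x /=; rewrite in_itv/= andbT => ax.
    by rewrite lee_fin ler_wpM2r// ltW// stdpdf_gt0.
rewrite -RintegralZl//; last exact: integrableS integ_stdpdf.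
rewrite -lee_fin fineK//; apply: integrable_fin_num => //.
apply: (integrableS _ _ (subsetT _)) => //; exact: (integZl a integ_stdpdf).
Qed.

Lemma mills_left (a : R) : 0 < a ->
  a * \int[leb]_(u in `]-oo, (- a)%R]) p u <= p a.
Proof.
move=> a0.
have e : (\int[leb]_(u in `]-oo, (- a)%R]) (p u)%:E =
          \int[leb]_(u in `[a, +oo[) (p u)%:E)%E.
  rewrite ge0_integration_by_substitutionNy.
  - by apply: eq_integral => u _; congr (_%:E); exact: stdpdfN.
  - by apply: continuous_subspaceT => u; exact: cp.
  - by move=> x _; rewrite ltW// stdpdf_gt0.
by rewrite {1}/Rintegral e; exact: mills_right.
Qed.

Variables (f : R -> R) (M : R).
Hypothesis cf : continuous f.
Hypothesis fM : forall u, `|f u| <= M.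

Let m := \int[N]_u f u.
Let k u := (f u - m) * p u.
Let Phi (x : R) := \int[leb]_(u in `]-oo, x]) k u.

Let mf : measurable_fun setT f. Proof. exact: continuous_measurable_fun. Qed.
Let pf : polyb f. Proof. exact: polyb_bnd fM. Qed.

Let mM : `|m| <= M.
Proof.
have [ig _] := normal_density one0 mf pf.
apply: (le_trans (norm_Rint ig)).
rewrite -[leRHS](Rint_probability_cst N).
by apply: le_Rint => //; [exact: integ_norm|exact: integ_cst].
Qed.

Let M0 : 0 <= M. Proof. exact: le_trans (fM 0). Qed.

Let ck : continuous k.
Proof.
move=> u; apply: cvgM; last exact: cp.
by apply: cvgB; [exact: cf|exact: cvg_cst].
Qed.

Let kb u : `|k u| <= 2 * M * p u.
Proof.
rewrite normrM (ger0_norm (ltW (stdpdf_gt0 u))) ler_wpM2r ?(ltW (stdpdf_gt0 u))//.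
by rewrite (le_trans (ler_normB _ _))// mulr_natl mulr2n lerD.
Qed.

Let ik : integ leb k.
Proof.
apply: (integ_le _ _ (integZl (2 * M) integ_stdpdf)) => //.
exact: continuous_measurable_fun.
Qed.

Let k0 : \int[leb]_u k u = 0.
Proof.
have [_ h] := normal_density one0 mf pf.
have -> : \int[leb]_u k u = \int[leb]_u (f u * p u - m * p u).
  by apply: eq_Rint => u; rewrite /k mulrBl.
rewrite RintB; first by rewrite -h RintZl ?integ_stdpdf// Rint_stdpdf mulr1 subrr.
  exact: polyb_integ_pdf.
exact: integZl integ_stdpdf.
Qed.

Let Pk (A : set R) : measurable A ->
  `|\int[leb]_(u in A) k u| <= 2 * M * \int[leb]_(u in A) p u.
Proof.
move=> mA.
have ikA : leb.-integrable A (EFin \o k) by exact: integrableS ik.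
have ipA : leb.-integrable A (EFin \o p) by exact: integrableS integ_stdpdf.
apply: le_trans; first exact: le_normr_Rintegral.
rewrite -RintegralZl//; apply: le_Rintegral => //.
- exact: integrable_norm.
- by have := @integrableZl _ _ _ leb A mA (2 * M) _ ipA.
Qed.

(** Because f - m has mean 0, the lower integral can be exchanged for the upper one; each half-line
    is thus treated with the tail that decays. *)
Let PhiC x : Phi x = - \int[leb]_(u in `]x, +oo[) k u.
Proof.
apply/eqP; rewrite -subr_eq0 opprK /Phi -Rintegral_setU//.
- have -> : `]-oo, x] `|` `]x, +oo[ = [set: R].
    apply/seteqP; split => // u _; case: (lerP u x) => h; [left|right];
      by rewrite /= in_itv/= ?andbT.
  by rewrite k0.
- by apply: (integrableS _ _ _ ik) => //; exact: measurableU.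
- apply/disj_setPS => u /= []; rewrite !in_itv/= andbT => h1 h2.
  by have := le_lt_trans h1 h2; rewrite ltxx.
Qed.

Let PhiM x : `|Phi x| <= 2 * M.
Proof.
have mA : measurable (`]-oo, x] : set R) by [].
apply: (le_trans (Pk mA)); rewrite -[leRHS]mulr1 ler_wpM2l ?mulr_ge0//.
have h1 : (N `]-oo, x] <= 1)%E by exact: probability_le1.
have h0 : (0 <= N `]-oo, x])%E by exact: measure_ge0.
have : fine (N `]-oo, x]) <= 1.
  by rewrite -lee_fin fineK// ge0_fin_numE// (le_lt_trans h1)// ltry.
exact.
Qed.

Let Phix x : `|x| * `|Phi x| <= 2 * M * p x.
Proof.
have [x0|x0|->] := ltgtP x 0; last first.
- by rewrite normr0 mul0r !mulr_ge0// ltW// stdpdf_gt0.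
- rewrite (gtr0_norm x0) PhiC normrN.
  apply: (@le_trans _ _ (2 * M * (x * \int[leb]_(u in `]x, +oo[) p u))).
    by rewrite mulrCA ler_wpM2l ?(ltW x0)//; exact: Pk.
  rewrite ler_wpM2l ?mulr_ge0// Rintegral_itv_obnd_cbnd; first exact: mills_right.
  exact: integrableS integ_stdpdf.
- rewrite (ltr0_norm x0).
  have x1 : 0 < - x by rewrite oppr_gt0.
  apply: (@le_trans _ _ (2 * M * (- x * \int[leb]_(u in `]-oo, x]) p u))).
    by rewrite mulrCA ler_wpM2l ?(ltW x1)//; exact: Pk.
  rewrite ler_wpM2l ?mulr_ge0// -[in leRHS](opprK x) stdpdfN.
  by have := mills_left x1; rewrite opprK.
Qed.

(** The solution is [Phi] divided by the density. Mills' bound gives |x phi(x)| <= 2 M, which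
    settles |x| >= 1; on [-1, 1] the density is at least p(1). The equation itself then bounds and
    makes continuous [dphi]. *)
Lemma stein_solution : exists phi dphi : R -> R,
  [/\ continuous dphi, forall x : R, is_derive x 1 phi (dphi x),
      forall x, dphi x - x * phi x = f x - m,
      exists K, forall x, `|phi x| <= K
    & exists K, forall x, `|dphi x| <= K].
Proof.
pose phi x := (p x)^-1 * Phi x.
pose dphi x := x * phi x + (f x - m).
have p0 x : p x != 0 by rewrite gt_eqF// stdpdf_gt0.
have dPhi (x : R) : is_derive x 1 Phi (k x).
  have x1 : x < x + 1 by rewrite ltrDl.
  have ik1 : leb.-integrable [set` Interval -oo%O (BRight (x + 1))] (EFin \o k).
    exact: (integrableS _ _ (subsetT _)) ik.
  have [h1 h2] := continuous_FTC1 x1 ik1 (ltNyr _) (@ck x).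
  by apply: DeriveDef; [exact: h1|rewrite -derive1E; exact: h2].
have dphiE (x : R) : is_derive x 1 phi (dphi x).
  have hV := is_deriveV (p0 x) (is_derive_stdpdf x).
  apply: is_derive_eq (is_deriveM hV (dPhi x)) _.
  rewrite /GRing.scale /= /dphi /phi /k; field; exact: p0.
have xphi x : `|x * phi x| <= 2 * M.
  rewrite /phi mulrCA normrM normfV (ger0_norm (ltW (stdpdf_gt0 x))).
  rewrite ler_pdivrMl ?stdpdf_gt0// normrM [leRHS]mulrC; exact: Phix.
exists phi, dphi; split => //.
- move=> x; apply: cvgD; last by apply: cvgB; [exact: cf|exact: cvg_cst].
  by apply: cvgM; [exact: cvg_id|exact: (derive_continuous dphiE)].
- by move=> x; rewrite /dphi addrAC subrr add0r.
- exists (2 * M + 2 * M * (p 1)^-1) => x; have [x1|x1] := lerP 1 `|x|.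
    apply: (@le_trans _ _ (2 * M)).
      by apply: le_trans (xphi x); rewrite [leRHS]normrM ler_peMl.
    by rewrite lerDl mulr_ge0// ?mulr_ge0// invr_ge0 ltW// stdpdf_gt0.
  apply: (@le_trans _ _ (2 * M * (p 1)^-1)); last by rewrite lerDr mulr_ge0.
  rewrite /phi normrM normfV (ger0_norm (ltW (stdpdf_gt0 x))) mulrC.
  rewrite ler_pM// ?invr_ge0 ?(ltW (stdpdf_gt0 x))//.
  rewrite lef_pV2 ?posrE ?stdpdf_gt0// !pdfE//.
  rewrite ler_wpM2l ?normal_peak_ge0// ler_expR ler_wpM2r ?invr_ge0 ?mulrn_wge0 ?expr1n//.
  rewrite lerN2 -[x ^+ 2]real_normK ?num_real//.
  by rewrite expr_le1// ltW.
- exists (2 * M + 2 * M) => x; rewrite /dphi.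
  apply: (le_trans (ler_normD _ _)); rewrite lerD//.
  by rewrite (le_trans (ler_normB _ _))// mulr_natl mulr2n lerD.
Qed.

End Stein.

(** * Fourier uniqueness and Gaussian integration by parts *)

Section FunctionalDynkin.
Context {R : realType} d d' (T : measurableType d) (Y : measurableType d').
Variables (mu : {measure set T -> \bar R}) (X : T -> Y) (W : T -> R).
Hypothesis mX : measurable_fun setT X.
Hypothesis iW : integ mu W.

Let mpre A : measurable A -> measurable (X @^-1` A).
Proof. by move=> mA; rewrite -[X in measurable X]setTI; exact: mX. Qed.

Let iWA A : measurable A -> mu.-integrable (X @^-1` A) (EFin \o W).
Proof. by move=> mA; apply: integrableS iW => //; exact: mpre. Qed.

(** The pi-lambda theorem for the signed set function that sends A to E[W; X in A]. It serves twice: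
    with half-open intervals for Fourier uniqueness, and with cylinders for independence. *)
Lemma integral_preimage_eq0 (G : set (set Y)) :
  @measurable _ Y = <<s G >> -> setI_closed G ->
  (\int[mu]_x (W x)%:E = 0)%E ->
  (forall A, G A -> \int[mu]_(x in X @^-1` A) (W x)%:E = 0)%E ->
  (forall A, measurable A -> \int[mu]_(x in X @^-1` A) (W x)%:E = 0)%E.
Proof.
move=> GE GI W0 GW A; rewrite GE.
apply: (@dynkin_induction _ Y G (fun A => \int[mu]_(x in X @^-1` A) (W x)%:E = 0)%E) => //.
- move=> S mS S0; rewrite preimage_setC.
  have := W0; rewrite -(setUv (X @^-1` S)) integral_setU//=.
  + by rewrite S0 add0e.
  + exact: mpre.
  + by apply: measurableC; exact: mpre.
  + by rewrite setUv; exact: measurable_int iW.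
  + exact/disj_setPCl.
- move=> F mF tF F0; rewrite preimage_bigcup integral_bigcup//.
  + by rewrite eseries0.
  + apply/trivIsetP => i j _ _ ij; rewrite -preimage_setI.
    by move/trivIsetP : tF => /(_ i j Logic.I Logic.I ij) ->; rewrite preimage_set0.
  + by move=> k; exact: mpre.
  + rewrite -preimage_bigcup; apply: iWA; exact: bigcupT_measurable.
Qed.

Lemma Rint_indic_preimage A : measurable A ->
  (\int[mu]_(x in X @^-1` A) (W x)%:E = (\int[mu]_x (W x * \1_A (X x)))%:E)%E.
Proof.
move=> mA; rewrite -RintE; last first.
  have mI : measurable_fun setT (fun x => \1_A (X x) : R).
    by apply: measurableT_comp => //; exact: measurable_indic.
  apply: (integ_le _ _ (integ_norm iW)).
    by apply: measurable_funM => //; exact: integ_meas iW.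
  by move=> x; rewrite normrM indicE ler_piMr//; case: (_ \in _); rewrite ?normr1 ?normr0.
rewrite integral_mkcond; apply: eq_integral => x _.
rewrite /patch indicE (_ : (x \in X @^-1` A) = (X x \in A)); last by [].
by case: ifPn => _; rewrite ?mulr1 ?mulr0.
Qed.

End FunctionalDynkin.

Section FourierUniqueness.
Context {R : realType} d (T : measurableType d) (P : probability T R).
Local Notation leb := (@lebesgue_measure R).
Local Notation p := (normal_pdf (0 : R) 1).
Local Notation N := (normal_prob (0 : R) 1).

Let one0 : (1 : R) != 0. Proof. exact: oner_neq0. Qed.

(** The substitution z = c (y - x) moves the Gaussian noise from the argument of [k] to a kernel
    centred at [x], the only place where [x] then occurs. *)
Lemma normal_smooth (k : R -> R) (c x : R) : 0 < c -> continuous k ->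
  (forall u, 0 <= k u) -> (forall u, k u <= 1) ->
  (\int[N]_z (k (x + z / c))%:E = \int[leb]_y (k y * (p (c * (y - x)) * c))%:E)%E.
Proof.
move=> c0 ck k0 k1.
have cG : continuous (fun z : R => k (x + z / c) * p z).
  move=> z; apply: cvgM; last exact: continuous_normal_pdf.
  apply: (@continuous_comp _ _ _ (fun z : R => x + z / c) k); last exact: ck.
  apply: cvgD; first exact: cvg_cst.
  by apply: cvgM; [exact: cvg_id|exact: cvg_cst].
have mk : measurable_fun setT (fun z : R => (k (x + z / c))%:E).
  apply/measurable_EFinP; apply: continuous_measurable_fun => z.
  apply: (@continuous_comp _ _ _ (fun z : R => x + z / c) k); last exact: ck.
  apply: cvgD; first exact: cvg_cst.
  by apply: cvgM; [exact: cvg_id|exact: cvg_cst].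
rewrite (@ge0_integral_density _ _ _ leb N p); first last.
- by move=> z; rewrite lee_fin.
- exact: mk.
- by [].
- by move=> u; exact: normal_pdf_ge0.
- exact: measurable_normal_pdf.
pose F (y : R) : R := c * (y - x).
have dF (y : R) : is_derive y 1 F c.
  have h := @is_deriveZ _ _ _ (fun y : R => y - x) c y 1 _
    (is_deriveB (is_derive_id y 1) (is_derive_cst x y 1)).
  by apply: is_derive_eq h _; rewrite /GRing.scale /= subr0 mulr1.
have F'E : (F^`())%classic = cst c.
  by apply/funext => y; rewrite derive1E; case: (dF y).
under eq_integral do rewrite -EFinM.
rewrite (@increasing_ge0_integration_by_substitutionT _ F).
- apply: eq_integral => y _; congr (_%:E); rewrite F'E.
  change (k (x + F y / c) * p (F y) * c = k y * (p (c * (y - x)) * c)).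
  rewrite (_ : x + F y / c = y); first by rewrite mulrA.
  by rewrite /F; field; rewrite gt_eqF.
- by move=> a b ab; rewrite /F ltr_pM2l// ltrD2r.
- by rewrite F'E => y; exact: cvg_cst.
- by rewrite F'E; exact: is_cvg_cst.
- by rewrite F'E; exact: is_cvg_cst.
- by move=> y; case: (dF y).
- by apply: gt0_cvgMrNy => //; exact: cvg_addrr_Ny.
- by apply: gt0_cvgMry => //; exact: cvg_addrr.
- exact: cG.
- by move=> z; rewrite mulr_ge0// normal_pdf_ge0.
Qed.

Lemma measurable_kshift (k : R -> R) (x c : R) : measurable_fun setT k ->
  measurable_fun setT (fun z : R => k (x + z / c)).
Proof.
move=> mk; apply: (@measurableT_comp _ _ _ _ _ _ k) => //.
by apply: measurable_funD => //; exact: measurable_funM.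
Qed.

Variables (X W : T -> R) (M : R).
Hypotheses (mX : measurable_fun setT X) (mW : measurable_fun setT W).
Hypothesis WM : forall w, `|W w| <= M.
Hypothesis Wcos : forall u, \int[P]_w (W w * cos (u * X w)) = 0.
Hypothesis Wsin : forall u, \int[P]_w (W w * sin (u * X w)) = 0.

Let mWk (g : R -> R) : measurable_fun setT g ->
  measurable_fun setT (fun w => W w * g (X w)).
Proof. by move=> mg; apply: measurable_funM => //; exact: measurableT_comp. Qed.

Let iWk (g : R -> R) K : measurable_fun setT g -> (forall u, `|g u| <= K) ->
  integ P (fun w => W w * g (X w)).
Proof.
move=> mg gK; apply: (@integ_bnd _ _ _ _ _ (M * K)); first exact: mWk.
by move=> w; rewrite normrM ler_pM.
Qed.

(** Up to its peak the standard density is its own characteristic function; Fubini and the addition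
    formula for the cosine then reduce the claim to [Wcos] and [Wsin]. *)
Let W_gauss (c y : R) : \int[P]_w (W w * p (c * (y - X w))) = 0.
Proof.
have e w : W w * p (c * (y - X w)) = normal_peak 1 * \int[N]_u (W w * cos (c * (y - X w) * u)).
  rewrite RintZl; last exact: integ_cos.
  rewrite normal_cos// mulrCA pdfE// mul1r; congr (_ * (_ * expR _)).
  by rewrite expr1n.
have mf : measurable_fun setT (fun z : T * R => W z.1 * cos (c * (y - X z.1) * z.2)).
  apply: measurable_funM; first exact: measurableT_comp.
  apply: (@measurableT_comp _ _ _ _ _ _ cos); first exact: (continuous_measurable_fun (@continuous_cos R)).
  apply: measurable_funM => //; apply: measurable_funM => //.
  by apply: measurable_funB => //; exact: measurableT_comp.
have If : integ (P \x N)%E (fun z : T * R => W z.1 * cos (c * (y - X z.1) * z.2)).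
  apply: (@integ_prod_bnd _ _ _ _ _ _ _ _ M) => // z.
  rewrite normrM; apply: le_trans (WM z.1).
  by rewrite ler_piMr// norm_cos_le1.
rewrite (eq_Rint _ e) RintZl; last exact: (RFubini1 If).1.
rewrite (RFubini If) /=.
under eq_Rintegral => u _.
  have -> : \int[P]_x (W x * cos (c * (y - X x) * u)) =
    \int[P]_x (cos (c * y * u) * (W x * cos ((c * u) * X x)) +
               sin (c * y * u) * (W x * sin ((c * u) * X x))).
    apply: eq_Rint => x.
    have -> : c * (y - X x) * u = c * y * u - c * u * X x by ring.
    by rewrite cosB; ring.
  have i1 : integ P (fun x => W x * cos ((c * u) * X x)).
    apply: (@iWk (fun v => cos (c * u * v)) 1); last by move=> v; exact: norm_cos_le1.
    exact: continuous_measurable_fun (@continuous_cosM R _).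
  have i2 : integ P (fun x => W x * sin ((c * u) * X x)).
    apply: (@iWk (fun v => sin (c * u * v)) 1); last by move=> v; exact: norm_sin_le1.
    exact: continuous_measurable_fun (@continuous_sinM R _).
  rewrite RintD; [|exact: integZl|exact: integZl].
  rewrite !RintZl// Wcos Wsin !mulr0 addr0.
  over.
by rewrite Rint_zero mulr0.
Qed.

Let W_smooth (k : R -> R) (c : R) : 0 < c -> continuous k ->
  (forall u, 0 <= k u) -> (forall u, k u <= 1) ->
  \int[P]_w (W w * \int[N]_z k (X w + z / c)) = 0.
Proof.
move=> c0 ck k0 k1.
have mk := continuous_measurable_fun ck.
have nk u : `|k u| <= 1 by rewrite ger0_norm.
pose f (z : T * R) := W z.1 * (k z.2 * (p (c * (z.2 - X z.1)) * c)).
have mg : measurable_fun setT (fun z : T * R => k z.2 * (p (c * (z.2 - X z.1)) * c)).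
  apply: measurable_funM; first exact: measurableT_comp.
  apply: measurable_funM => //.
  apply: (@measurableT_comp _ _ _ _ _ _ p); first exact: measurable_normal_pdf.
  apply: measurable_funM => //; apply: measurable_funB => //.
  exact: measurableT_comp.
have mf : measurable_fun setT f by apply: measurable_funM => //; exact: measurableT_comp.
have g0 w y : 0 <= k y * (p (c * (y - X w)) * c).
  by rewrite mulr_ge0// mulr_ge0 ?normal_pdf_ge0// ltW.
have smooth w := @normal_smooth k c (X w) c0 ck k0 k1.
have Ig w : integ leb (fun y => k y * (p (c * (y - X w)) * c)).
  apply: integ_ge0P.
  - by apply: (measurableT_comp mg (pair1_measurable w)).
  - by move=> y; exact: g0.
  - rewrite -smooth RintE ?ltry//; apply: (@integ_bnd _ _ _ _ _ 1) => //.
    exact: measurable_kshift.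
have Ik w : integ N (fun z => k (X w + z / c)).
  by apply: (@integ_bnd _ _ _ _ _ 1) => //; exact: measurable_kshift.
have smoothR w : \int[N]_z k (X w + z / c) = \int[leb]_y (k y * (p (c * (y - X w)) * c)).
  by rewrite /Rintegral smooth.
have le1 w : \int[N]_z k (X w + z / c) <= 1.
  by rewrite -[leRHS](Rint_probability_cst N); apply: le_Rint => //; exact: integ_cst.
(* Lebesgue measure is infinite, so integrability on the product comes from Tonelli: [k <= 1] makes
   the integral of each kernel section at most 1. *)
have If : integ (P \x leb)%E f.
  apply/integrable12ltyP; first exact/measurable_EFinP.
  apply: (@le_lt_trans _ _ (\int[P]_w (M%:E)))%E; last by rewrite integral_cst//= probability_setT mule1 ltry.
  apply: ge0_le_integral => //.
  - by move=> w _; exact: integral_ge0.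
  - apply: (@measurable_fun_fubini_tonelli_F _ _ _ _ _ leb (abse \o (EFin \o f))) => //=.
    by apply: measurableT_comp => //; exact/measurable_EFinP.
  - move=> w _; under eq_integral do rewrite /f /= normrM (ger0_norm (g0 _ _)).
    rewrite (RintE (integZl `|W w| (Ig w))) RintZl// -smoothR lee_fin.
    rewrite -[leRHS]mulr1 ler_pM//.
    by apply: Rintegral_ge0.
have := RFubini If; rewrite /f /=.
under eq_Rintegral => w _ do rewrite RintZl// -smoothR.
move=> ->; under eq_Rintegral => y _.
  have -> : \int[P]_x (W x * (k y * (p (c * (y - X x)) * c))) =
      \int[P]_x ((k y * c) * (W x * p (c * (y - X x)))).
    by apply: eq_Rint => w; ring.
  rewrite RintZl; last first.
    apply: (@iWk (fun v => p (c * (y - v))) (normal_peak 1)); last first.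
      by move=> u; rewrite ger0_norm ?normal_pdf_ge0// normal_pdf_ub.
    apply: (@measurableT_comp _ _ _ _ _ _ p); first exact: measurable_normal_pdf.
    by apply: measurable_funM => //; exact: measurable_funB.
  rewrite W_gauss mulr0.
  over.
by rewrite Rint_zero.
Qed.

Let W_cont (k : R -> R) : continuous k ->
  (forall u, 0 <= k u) -> (forall u, k u <= 1) -> \int[P]_w (W w * k (X w)) = 0.
Proof.
move=> ck k0 k1.
have nk u : `|k u| <= 1 by rewrite ger0_norm.
have mk := continuous_measurable_fun ck.
pose h n w := W w * \int[N]_z k (X w + z / n.+1%:R).
have cin n x : integ N (fun z : R => k (x + z / n.+1%:R)).
  by apply: (@integ_bnd _ _ _ _ _ 1) => //; exact: measurable_kshift.
have [] := @Rint_dominated _ _ _ P h (fun w => W w * k (X w)) (fun=> M * 1).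
- move=> n; apply: measurable_funM => //.
  have mf : measurable_fun setT (fun z : T * R => k (X z.1 + z.2 / n.+1%:R)).
    apply: measurableT_comp => //; apply: measurable_funD.
      exact: measurableT_comp.
    exact: measurable_funM.
  have If : integ (P \x N)%E (fun z : T * R => k (X z.1 + z.2 / n.+1%:R)).
    by apply: (@integ_prod_bnd _ _ _ _ _ _ _ _ 1).
  exact: integ_meas (RFubini1 If).1.
- move=> w; apply: cvgM; first exact: cvg_cst.
  have [] := @Rint_dominated _ _ _ N (fun n z => k (X w + z / n.+1%:R)) (fun=> k (X w)) (fun=> 1).
  + by move=> n; exact: measurable_kshift.
  + move=> z; apply: continuous_cvg; first exact: ck.
    rewrite -[X in _ --> X]addr0; apply: cvgD; first exact: cvg_cst.
    rewrite -[X in _ --> X](mulr0 z); apply: cvgM; first exact: cvg_cst.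
    exact: cvg_harmonic.
  + exact: integ_cst.
  + by move=> n z.
  + by rewrite Rint_probability_cst.
- exact: integ_cst.
- move=> n w; rewrite normrM ler_pM//.
  apply: (le_trans (norm_Rint (cin n (X w)))).
  rewrite -[leRHS](Rint_probability_cst N); apply: le_Rint => //.
    exact: integ_norm.
  exact: integ_cst.
move=> _.
under eq_fun do rewrite W_smooth//.
by move=> /(cvg_lim (@Rhausdorff R)) <-; exact: lim_cst.
Qed.

Let W_ray (b : R) : \int[P]_w (W w * \1_(`]-oo, b]) (X w)) = 0.
Proof.
(* For n > 0, a ramp equal to 1 up to b and to 0 from b + 1/n on. *)
pose k n (u : R) : R := Num.max 0 (Num.min 1 (1 - n%:R * (u - b))).
have ck n : continuous (k n).
  move=> u; apply: (@continuous_max _ _ (fun _ => 0) (fun v => Num.min 1 (1 - n%:R * (v - b))) u).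
    exact: cvg_cst.
  apply: (@continuous_min _ _ (fun _ => 1) (fun v => 1 - n%:R * (v - b)) u).
    exact: cvg_cst.
  apply: cvgB; first exact: cvg_cst.
  apply: cvgM; first exact: cvg_cst.
  by apply: cvgB; [exact: cvg_id|exact: cvg_cst].
have k0 n u : 0 <= k n u by rewrite le_max lexx.
have k1 n u : k n u <= 1 by rewrite ge_max ler01/= ge_min lexx.
have [] := @Rint_dominated _ _ _ P (fun n w => W w * k n (X w))
  (fun w => W w * \1_(`]-oo, b]) (X w)) (fun=> M * 1).
- by move=> n; apply: mWk; exact: continuous_measurable_fun.
- move=> w; apply: cvgM; first exact: cvg_cst.
  rewrite indicE; case: (lerP (X w) b) => h.
    rewrite mem_set/=; last by rewrite in_itv.
    rewrite (_ : (fun n => k n (X w)) = cst 1); first exact: cvg_cst.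
    apply/funext => n; rewrite /k /=; have : n%:R * (X w - b) <= 0.
      by rewrite mulr_ge0_le0// subr_le0.
    move=> h'; rewrite min_l ?max_r//; lra.
  rewrite memNset/=; last by rewrite in_itv/=; apply/negP; rewrite -ltNge.
  apply: cvg_near_cst; near=> n; rewrite /k.
  have : (X w - b)^-1 <= n%:R by near: n; exact: nbhs_infty_ger.
  have h' : 0 < X w - b by rewrite subr_gt0.
  rewrite -(ler_pM2r h') mulVf ?gt_eqF// => h2.
  by rewrite min_r ?max_l//; lra.
- exact: integ_cst.
- by move=> n w; rewrite normrM ler_pM// ger0_norm.
move=> _; under eq_fun do rewrite W_cont//.
by move=> /(cvg_lim (@Rhausdorff R)) <-; exact: lim_cst.
Unshelve. all: by end_near. Qed.

(* E[W k(X)] = 0 for bounded continuous k follows by letting Gaussian mollifiers, which are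
   mixtures of characters, concentrate; then k approximates half-lines. *)
Lemma fourier_unique (A : set R) : measurable A -> \int[P]_w (W w * \1_A (X w)) = 0.
Proof.
move=> mA.
have iW : integ P W by exact: integ_bnd WM.
suff : (\int[P]_(w in X @^-1` A) (W w)%:E = 0)%E.
  by rewrite Rint_indic_preimage// => -[].
have ray b : (\int[P]_(w in X @^-1` `]-oo, b]) (W w)%:E = 0)%E.
  by rewrite Rint_indic_preimage// W_ray.
have mI b : measurable_fun setT (fun w => \1_(`]-oo, b] : set R) (X w) : R).
  by apply: measurableT_comp => //; exact: measurable_indic.
apply: (@integral_preimage_eq0 _ _ _ _ _ _ X W mX iW (@ocitv R)) => //.
- exact: ocitvI.
- have := Wcos 0; under eq_Rintegral do rewrite mul0r cos0 mulr1.
  by rewrite (RintE iW) => ->.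
- move=> _ [[a b] _ <-] /=; have [ab|ba] := leP a b; last first.
    by rewrite set_itv_ge ?preimage_set0 ?integral_set0// -leNgt bnd_simp ltW.
  rewrite Rint_indic_preimage//.
  have -> : \int[P]_w (W w * \1_(`]a, b]) (X w)) =
     \int[P]_w (W w * \1_(`]-oo, b]) (X w) - W w * \1_(`]-oo, a]) (X w)).
    apply: eq_Rint => w; rewrite -mulrBr !indicE; congr (_ * _).
    rewrite !mem_setE !in_itv/=.
    have := ab; case: (lerP (X w) a) => h1; case: (lerP (X w) b) => h2 ab';
      rewrite ?subr0 ?subrr//.
    by have := lt_le_trans h2 (le_trans h1 ab'); rewrite ltxx.
  rewrite RintB ?W_ray ?subrr//.
  - by apply: (@iWk (\1_(`]-oo, b])) 1) => // u; rewrite indicE; case: (_ \in _); rewrite ?normr1 ?normr0.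
  - by apply: (@iWk (\1_(`]-oo, a])) 1) => // u; rewrite indicE; case: (_ \in _); rewrite ?normr1 ?normr0.
Qed.

End FourierUniqueness.

Lemma indic_norm_le1 {R : realType} {T : Type} (A : set T) (x : T) :
  `|\1_A x : R| <= 1.
Proof. by rewrite indicE; case: (_ \in _); rewrite ?normr1 ?normr0. Qed.

(** Induction on the number of variables. The weight times a character of the first [n] variables is
    a weight for the one-variable theorem: product-to-sum formulas turn the products into characters
    of n + 1 variables, at the frequencies u and -u. The indicator so obtained is absorbed into the
    weight before the induction hypothesis is used. *)
Lemma fourier_unique_multi {R : realType} d (T : measurableType d) (P : probability T R)
    n (Z : nat -> T -> R) : (forall j, measurable_fun setT (Z j)) ->
  forall (W : T -> R) M, measurable_fun setT W -> (forall w, `|W w| <= M) ->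
  (forall v : nat -> R, \int[P]_w (W w * cos (\sum_(j < n) v j * Z j w)) = 0) ->
  (forall v : nat -> R, \int[P]_w (W w * sin (\sum_(j < n) v j * Z j w)) = 0) ->
  forall A : nat -> set R, (forall j, measurable (A j)) ->
  \int[P]_w (W w * \prod_(j < n) \1_(A j) (Z j w)) = 0.
Proof.
move=> mZ; elim: n => [|n ih] W M mW WM Wc Ws A mA.
  have := Wc (fun=> 0); under eq_Rintegral do rewrite big_ord0 cos0.
  by under [in X in _ -> X]eq_Rintegral do rewrite big_ord0.
have mS (v : nat -> R) : measurable_fun setT ((fun w => \sum_(j < n) v j * Z j w) : T -> R).
  by apply: measurable_sum => j; exact: measurable_funM.
have mcos : measurable_fun setT (@cos R).
  exact: (continuous_measurable_fun (@continuous_cos R)).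
have msin : measurable_fun setT (@sin R).
  exact: (continuous_measurable_fun (@continuous_sin R)).
have mWc (v : nat -> R) : measurable_fun setT (fun w => W w * cos (\sum_(j < n) v j * Z j w)).
  apply: measurable_funM => //; apply: (@measurableT_comp _ _ _ _ _ _ cos); first exact: mcos.
  exact: mS.
have mWs (v : nat -> R) : measurable_fun setT (fun w => W w * sin (\sum_(j < n) v j * Z j w)).
  apply: measurable_funM => //; apply: (@measurableT_comp _ _ _ _ _ _ sin); first exact: msin.
  exact: mS.
have bM (x y : R) : `|x| <= M -> `|y| <= 1 -> `|x * y| <= M.
  move=> hx hy; rewrite normrM -[leRHS]mulr1.
  by rewrite ler_pM.
have split_sum (v : nat -> R) u w : \sum_(j < n.+1) (fun j => if j == n then u else v j) j * Z j w
    = \sum_(j < n) v j * Z j w + u * Z n w.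
  rewrite big_ord_recr /= eqxx; congr (_ + _); apply: eq_bigr => j _.
  by rewrite ltn_eqF.
have Wc' (v : nat -> R) u : \int[P]_w (W w * cos (\sum_(j < n) v j * Z j w + u * Z n w)) = 0.
  by rewrite -[RHS](Wc (fun j => if j == n then u else v j)); apply: eq_Rint => w; rewrite split_sum.
have Ws' (v : nat -> R) u : \int[P]_w (W w * sin (\sum_(j < n) v j * Z j w + u * Z n w)) = 0.
  by rewrite -[RHS](Ws (fun j => if j == n then u else v j)); apply: eq_Rint => w; rewrite split_sum.
have ic (v : nat -> R) u : integ P (fun w => W w * cos (\sum_(j < n) v j * Z j w + u * Z n w)).
  apply: (@integ_bnd _ _ _ _ _ M); last by move=> w; rewrite bM// norm_cos_le1.
  apply: measurable_funM => //; apply: (@measurableT_comp _ _ _ _ _ _ cos) => //.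
  by apply: measurable_funD => //; exact: measurable_funM.
have iss (v : nat -> R) u : integ P (fun w => W w * sin (\sum_(j < n) v j * Z j w + u * Z n w)).
  apply: (@integ_bnd _ _ _ _ _ M); last by move=> w; rewrite bM// norm_sin_le1.
  apply: measurable_funM => //; apply: (@measurableT_comp _ _ _ _ _ _ sin) => //.
  by apply: measurable_funD => //; exact: measurable_funM.
have half (F G : T -> R) (a b : R) : integ P F -> integ P G ->
    \int[P]_w F w = 0 -> \int[P]_w G w = 0 ->
    \int[P]_w (a * F w + b * G w) = 0.
  move=> iF iG F0 G0; rewrite RintD; [|exact: integZl|exact: integZl].
  by rewrite !RintZl// F0 G0 !mulr0 addr0.
have key1 (v : nat -> R) : \int[P]_w ((W w * cos (\sum_(j < n) v j * Z j w)) * \1_(A n) (Z n w)) = 0.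
  apply: (@fourier_unique _ _ _ _ _ _ M) => //.
  - by move=> w; rewrite bM// norm_cos_le1.
  - move=> u; apply: etrans (half _ _ 2^-1 2^-1 (ic v u) (ic v (- u)) (Wc' v u) (Wc' v (- u))).
    by apply: eq_Rint => w; rewrite (mulNr u) cosB cosD; field.
  - move=> u; apply: etrans (half _ _ 2^-1 (- 2^-1) (iss v u) (iss v (- u)) (Ws' v u) (Ws' v (- u))).
    by apply: eq_Rint => w; rewrite (mulNr u) sinB sinD; field.
have key2 (v : nat -> R) : \int[P]_w ((W w * sin (\sum_(j < n) v j * Z j w)) * \1_(A n) (Z n w)) = 0.
  apply: (@fourier_unique _ _ _ _ _ _ M) => //.
  - by move=> w; rewrite bM// norm_sin_le1.
  - move=> u; apply: etrans (half _ _ 2^-1 2^-1 (iss v u) (iss v (- u)) (Ws' v u) (Ws' v (- u))).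
    by apply: eq_Rint => w; rewrite (mulNr u) sinB sinD; field.
  - move=> u; apply: etrans (half _ _ (- 2^-1) 2^-1 (ic v u) (ic v (- u)) (Wc' v u) (Wc' v (- u))).
    by apply: eq_Rint => w; rewrite (mulNr u) cosB cosD; field.
have mI : measurable_fun setT (fun w => \1_(A n) (Z n w) : R).
  by apply: measurableT_comp => //; exact: measurable_indic.
have := ih (fun w => W w * \1_(A n) (Z n w)) M _ _ _ _ A mA.
have -> : \int[P]_w (W w * \1_(A n) (Z n w) * \prod_(j < n) \1_(A j) (Z j w)) =
   \int[P]_w (W w * \prod_(j < n.+1) \1_(A j) (Z j w)).
  by apply: eq_Rint => w; rewrite big_ord_recr /= -mulrA [X in _ * X]mulrC.
apply.
- exact: measurable_funM.
- by move=> w; rewrite bM// indic_norm_le1.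
- by move=> v; rewrite -[RHS](key1 v); apply: eq_Rint => w; rewrite mulrAC.
- by move=> v; rewrite -[RHS](key2 v); apply: eq_Rint => w; rewrite mulrAC.
Qed.

(** * From factored characteristic functions to independence and integration by parts *)

Section Independence.
Context {R : realType} d (T : measurableType d) (P : probability T R).
Local Notation N := (normal_prob (0 : R) 1).
Variables (I : Type) (U : T -> R) (Z : I -> T -> R).
Hypothesis mU : measurable_fun setT U.
Hypothesis mZ : forall i, measurable_fun setT (Z i).
Hypothesis lawU : forall A, measurable A -> P (U @^-1` A) = N A.
Hypothesis jcos : forall (u : R) n (i : nat -> I) (v : nat -> R),
  \int[P]_w cos (u * U w + \sum_(j < n) v j * Z (i j) w) =
  expR (- u ^+ 2 / 2) * \int[P]_w cos (\sum_(j < n) v j * Z (i j) w).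
Hypothesis jsin : forall (u : R) n (i : nat -> I) (v : nat -> R),
  \int[P]_w sin (u * U w + \sum_(j < n) v j * Z (i j) w) =
  expR (- u ^+ 2 / 2) * \int[P]_w sin (\sum_(j < n) v j * Z (i j) w).

Let mcos : measurable_fun setT (@cos R).
Proof. exact: (continuous_measurable_fun (@continuous_cos R)). Qed.
Let msin : measurable_fun setT (@sin R).
Proof. exact: (continuous_measurable_fun (@continuous_sin R)). Qed.

Let icos (F : T -> R) : measurable_fun setT F -> integ P (fun w => cos (F w)).
Proof.
move=> mF; apply: (@integ_bnd _ _ _ _ _ 1); last by move=> w; exact: norm_cos_le1.
by apply: (@measurableT_comp _ _ _ _ _ _ cos).
Qed.

Let isin (F : T -> R) : measurable_fun setT F -> integ P (fun w => sin (F w)).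
Proof.
move=> mF; apply: (@integ_bnd _ _ _ _ _ 1); last by move=> w; exact: norm_sin_le1.
by apply: (@measurableT_comp _ _ _ _ _ _ sin).
Qed.

Let V n (i : nat -> I) (v : nat -> R) (w : T) : R := \sum_(j < n) v j * Z (i j) w.

Let mV n i v : measurable_fun setT (V n i v).
Proof. by apply: measurable_sum => j; exact: measurable_funM. Qed.

Let mUV u n i v : measurable_fun setT (fun w => u * U w + V n i v w).
Proof. by apply: measurable_funD => //; exact: measurable_funM. Qed.

Let comb (F G : T -> R) (a b : R) : integ P F -> integ P G ->
  \int[P]_w (a * F w + b * G w) = a * \int[P]_w F w + b * \int[P]_w G w.
Proof.
by move=> iF iG; rewrite RintD; [rewrite !RintZl|exact: integZl|exact: integZl].
Qed.

Let e2N (u : R) : expR (- (- u) ^+ 2 / 2) = expR (- u ^+ 2 / 2).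
Proof. by rewrite sqrrN. Qed.

Let flipN (a b c : R) : - a * b + c = c - a * b. Proof. by ring. Qed.
Let flipP (a b c : R) : a * b + c = c + a * b. Proof. by ring. Qed.

(** The factorization at u and at -u, added or subtracted, yields the four mixed trigonometric
    moments; those odd in u vanish. *)
Let CC u n i v : \int[P]_w (cos (V n i v w) * cos (u * U w)) =
  expR (- u ^+ 2 / 2) * \int[P]_w cos (V n i v w).
Proof.
transitivity (\int[P]_w (2^-1 * cos (u * U w + V n i v w) + 2^-1 * cos (- u * U w + V n i v w))).
  by apply: eq_Rint => w; rewrite flipN flipP cosD cosB; field.
rewrite comb; [|exact: icos|exact: icos].
by rewrite !jcos e2N -/(V _ _ _); field.
Qed.

Let SC u n i v : \int[P]_w (sin (V n i v w) * cos (u * U w)) =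
  expR (- u ^+ 2 / 2) * \int[P]_w sin (V n i v w).
Proof.
transitivity (\int[P]_w (2^-1 * sin (u * U w + V n i v w) + 2^-1 * sin (- u * U w + V n i v w))).
  by apply: eq_Rint => w; rewrite flipN flipP sinD sinB; field.
rewrite comb; [|exact: isin|exact: isin].
by rewrite !jsin e2N -/(V _ _ _); field.
Qed.

Let CS u n i v : \int[P]_w (cos (V n i v w) * sin (u * U w)) = 0.
Proof.
transitivity (\int[P]_w (2^-1 * sin (u * U w + V n i v w) + (- 2^-1) * sin (- u * U w + V n i v w))).
  by apply: eq_Rint => w; rewrite flipN flipP sinD sinB; field.
rewrite comb; [|exact: isin|exact: isin].
by rewrite !jsin e2N -/(V _ _ _); field.
Qed.

Let SS u n i v : \int[P]_w (sin (V n i v w) * sin (u * U w)) = 0.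
Proof.
transitivity (\int[P]_w ((- 2^-1) * cos (u * U w + V n i v w) + 2^-1 * cos (- u * U w + V n i v w))).
  by apply: eq_Rint => w; rewrite flipN flipP cosD cosB; field.
rewrite comb; [|exact: icos|exact: icos].
by rewrite !jcos e2N -/(V _ _ _); field.
Qed.

Let Ucos u : \int[P]_w cos (u * U w) = expR (- u ^+ 2 / 2).
Proof.
have h := @Rint_image _ _ _ _ _ P N U mU lawU (fun x => cos (u * x)) (integ_cos _ u).
by rewrite -h normal_cos ?oner_neq0// mul1r.
Qed.

Let Usin u : \int[P]_w sin (u * U w) = 0.
Proof.
have h := @Rint_image _ _ _ _ _ P N U mU lawU (fun x => sin (u * x)) (integ_sin _ u).
by rewrite -h normal_sin ?oner_neq0.
Qed.

Let mI (A : set R) : measurable A -> measurable_fun setT (fun w => \1_A (U w) : R).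
Proof. by move=> mA; apply: measurableT_comp => //; exact: measurable_indic. Qed.

Let iI (A : set R) : measurable A -> integ P (fun w => \1_A (U w) : R).
Proof.
by move=> mA; apply: (@integ_bnd _ _ _ _ _ 1); [exact: mI|move=> w; exact: indic_norm_le1].
Qed.

Let bM (x y : R) : `|x| <= 1 -> `|y| <= 1 -> `|x * y| <= 1.
Proof. by move=> hx hy; rewrite normrM mulr_ile1. Qed.

(** Fourier uniqueness is applied to the variable U with weight Psi - E Psi. The result is then read
    with the centred indicator of U as the weight, which is the form needed for a second Fourier
    argument, in the variables Z. *)
Let decouple (Psi : T -> R) (A : set R) : measurable_fun setT Psi ->
  (forall w, `|Psi w| <= 1) ->
  (forall u, \int[P]_w (Psi w * cos (u * U w)) = expR (- u ^+ 2 / 2) * \int[P]_w Psi w) ->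
  (forall u, \int[P]_w (Psi w * sin (u * U w)) = 0) -> measurable A ->
  \int[P]_w ((\1_A (U w) - \int[P]_w' \1_A (U w')) * Psi w) = 0.
Proof.
move=> mP P1 Pc Ps mA; pose c : R := \int[P]_w' \1_A (U w'); rewrite -/c; pose e := \int[P]_w Psi w.
have iP : integ P Psi by exact: integ_bnd P1.
have iPM (g : T -> R) : measurable_fun setT g -> (forall w, `|g w| <= 1) ->
    integ P (fun w => Psi w * g w).
  move=> mg g1; apply: (@integ_bnd _ _ _ _ _ 1); first exact: measurable_funM.
  by move=> w; exact: bM.
have mUu u : measurable_fun setT (fun w => u * U w) by exact: measurable_funM.
have mcu u : measurable_fun setT (fun w => cos (u * U w)).
  by apply: (@measurableT_comp _ _ _ _ _ _ cos).
have msu u : measurable_fun setT (fun w => sin (u * U w)).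
  by apply: (@measurableT_comp _ _ _ _ _ _ sin).
have key : \int[P]_w ((Psi w - e) * \1_A (U w)) = 0.
  apply: (@fourier_unique _ _ _ _ _ _ (1 + `|e|)) => //.
  - exact: measurable_funB.
  - by move=> w; rewrite (le_trans (ler_normB _ _))// lerD.
  - move=> u; transitivity (\int[P]_w (1 * (Psi w * cos (u * U w)) + (- e) * cos (u * U w))).
      by apply: eq_Rint => w; ring.
    rewrite comb; [|apply: iPM => // w; exact: norm_cos_le1|exact: icos].
    by rewrite Pc Ucos -/e; ring.
  - move=> u; transitivity (\int[P]_w (1 * (Psi w * sin (u * U w)) + (- e) * sin (u * U w))).
      by apply: eq_Rint => w; ring.
    rewrite comb; [|apply: iPM => // w; exact: norm_sin_le1|exact: isin].
    by rewrite Ps Usin -/e; ring.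
have iPA : integ P (fun w => Psi w * \1_A (U w)).
  by apply: iPM; [exact: mI|move=> w; exact: indic_norm_le1].
have e1 : \int[P]_w (Psi w * \1_A (U w)) = e * c.
  have : \int[P]_w (1 * (Psi w * \1_A (U w)) + (- e) * \1_A (U w)) = 0.
    by rewrite -[RHS]key; apply: eq_Rint => w; ring.
  rewrite comb; [|exact: iPA|exact: iI].
  rewrite mul1r mulNr -/c => /eqP; rewrite subr_eq0 => /eqP h. exact: h.
transitivity (\int[P]_w (1 * (Psi w * \1_A (U w)) + (- c) * Psi w)).
  by apply: eq_Rint => w; ring.
by rewrite comb// e1 -/e; ring.
Qed.

Definition cylinder : set (set T) := [set B | exists n (i : nat -> I) (A : nat -> set R),
  (forall j, measurable (A j)) /\ B = [set w | forall j, (j < n)%N -> A j (Z (i j) w)]].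

Let cyl_indic n (i : nat -> I) (A : nat -> set R) (w : T) :
  \1_([set w | forall j, (j < n)%N -> A j (Z (i j) w)]) w =
  \prod_(j < n) \1_(A j) (Z (i j) w) :> R.
Proof.
rewrite indicE; have [h|h] := pselect (forall j, (j < n)%N -> A j (Z (i j) w)).
  rewrite mem_set// big1// => j _; rewrite indicE mem_set//; exact: h.
rewrite memNset//; move/existsNP : h => [j /not_implyP[jn Aj]].
by rewrite (bigD1 (Ordinal jn))//= indicE memNset// mul0r.
Qed.

Lemma indep_cylinder (A : set R) (B : set T) : measurable A -> cylinder B ->
  \int[P]_w ((\1_A (U w) - \int[P]_w' \1_A (U w')) * \1_B w) = 0.
Proof.
move=> mA [n [i [F [mF ->]]]].
under eq_Rintegral do rewrite cyl_indic.
have hV (v : nat -> R) (w : T) : \sum_(j < n) v j * Z (i j) w = V n i v w by [].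
apply: (@fourier_unique_multi _ _ _ _ _ (fun j => Z (i j)) _ _ (1 + `|\int[P]_w' \1_A (U w')|)) => //.
- by apply: measurable_funB => //; exact: mI.
- by move=> w; rewrite (le_trans (ler_normB _ _))// lerD// indic_norm_le1.
- move=> v; apply: decouple => //.
  + apply: (@measurableT_comp _ _ _ _ _ _ cos); first exact: mcos. exact: (mV n i v).
  + by move=> w; exact: norm_cos_le1.
  + by move=> u; exact: CC.
  + by move=> u; exact: CS.
- move=> v; apply: decouple => //.
  + apply: (@measurableT_comp _ _ _ _ _ _ sin); first exact: msin. exact: (mV n i v).
  + by move=> w; exact: norm_sin_le1.
  + by move=> u; exact: SC.
  + by move=> u; exact: SS.
Qed.

Lemma cylinder_setI : setI_closed cylinder.
Proof.
move=> _ _ [n [i [A [mA ->]]]] [m [k [B [mB ->]]]].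
exists (n + m)%N, (fun j => if (j < n)%N then i j else k (j - n)%N),
  (fun j => if (j < n)%N then A j else B (j - n)%N); split.
  by move=> j; case: ifP.
apply/seteqP; split => w /=.
- move=> [h1 h2] j jnm; case: ltnP => jn; first exact: h1.
  by apply: h2; rewrite ltn_subLR.
- move=> h; split => j jn.
    by have := h j (leq_trans jn (leq_addr _ _)); rewrite jn.
  have := h (n + j)%N; rewrite ltn_add2l => /(_ jn).
  by rewrite ltnNge leq_addr /= addKn.
Qed.

Lemma cylinder_measurable B : cylinder B -> measurable B.
Proof.
move=> [n [i [A [mA ->]]]].
rewrite [X in measurable X](_ : _ =
    \bigcap_j (if (j < n)%N then Z (i j) @^-1` A j else setT)).
  apply: bigcapT_measurable => j; case: ifP => // _.
  by rewrite -[X in measurable X]setTI; exact: mZ.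
apply/seteqP; split => w /= h j; first by move=> _; case: ifP => // jn; exact: h.
by move=> jn; have := h j Logic.I; rewrite jn.
Qed.

Local Notation S := (g_sigma_algebraType cylinder).

(** The identity, viewed as a map to the same set with the smaller sigma-algebra generated by the
    family Z. A function measurable on [S] is one that depends on Z alone. *)
Definition toS (w : T) : S := w.

Lemma measurable_toS : measurable_fun setT toS.
Proof.
apply: (@measurability _ _ T S setT toS cylinder) => // _ [B cB <-].
rewrite setTI; exact: cylinder_measurable.
Qed.

Lemma measurable_ZS (i : I) : measurable_fun [set: S] (fun w : S => Z i w).
Proof.
move=> _ A mA; rewrite setTI; apply: sub_sigma_algebra.
exists 1%N, (fun=> i), (fun=> A); split => //.
by apply/seteqP; split => w /=; [move=> h j _|move=> /(_ 0%N isT)].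
Qed.

HB.instance Definition _ := isMeasurableFun.Build _ _ T S toS measurable_toS.

Definition PS : probability S R := distribution P toS.

Lemma indepS (A : set R) (B : set S) : measurable A -> measurable B ->
  P (U @^-1` A `&` B) = (N A * P B)%E.
Proof.
move=> mA mB; pose c := \int[P]_w' \1_A (U w').
have mBT : measurable (B : set T).
  by rewrite -[X in measurable X]setTI; exact: measurable_toS.
have mUA : measurable (U @^-1` A) by rewrite -[X in measurable X]setTI; exact: mU.
have iW : integ P (fun w => \1_A (U w) - c).
  by apply: integB; [exact: iI|exact: integ_cst].
have c1 : P (U @^-1` A) = c%:E.
  rewrite /c -RintE; last exact: iI.
  transitivity (\int[P]_w (\1_(U @^-1` A) w)%:E)%E => //.
  by rewrite integral_indic// setIT.
have key : (\int[P]_(w in toS @^-1` B) (\1_A (U w) - c)%:E = 0)%E.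
  apply: (@integral_preimage_eq0 _ _ _ T S P toS _ measurable_toS iW cylinder) => //.
  - exact: cylinder_setI.
  - rewrite (RintE iW) RintB; [|exact: iI|exact: integ_cst].
    by rewrite Rint_probability_cst subrr.
  - move=> D cD; have mD : measurable (D : set S) by exact: sub_sigma_algebra.
    by rewrite (Rint_indic_preimage measurable_toS iW mD) indep_cylinder.
rewrite -lawU// c1.
have iB : integ P (\1_B : T -> R).
  by apply: (@integ_bnd _ _ _ _ _ 1) => // w; exact: indic_norm_le1.
have PB : P B = (\int[P]_w \1_(B : set T) w)%:E.
  by rewrite -RintE// integral_indic// setIT.
have iAB : integ P (fun w => \1_A (U w) * \1_(B : set T) w).
  apply: (@integ_bnd _ _ _ _ _ 1); last by move=> w; apply: bM; exact: indic_norm_le1.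
  by apply: measurable_funM => //; exact: mI.
have -> : P (U @^-1` A `&` B) = (\int[P]_w (\1_A (U w) * \1_(B : set T) w))%:E.
  rewrite -RintE//; transitivity (\int[P]_w (\1_(U @^-1` A `&` (B : set T)) w)%:E)%E.
    by rewrite integral_indic ?setIT//; exact: measurableI.
  by apply: eq_integral => w _; rewrite indicI.
rewrite PB -EFinM; congr (_%:E).
move: key; rewrite (Rint_indic_preimage measurable_toS iW mB) => -[].
have -> : \int[P]_w ((\1_A (U w) - c) * \1_B (toS w)) =
  \int[P]_w (1 * (\1_A (U w) * \1_(B : set T) w) + (- c) * \1_(B : set T) w).
  by apply: eq_Rint => w; rewrite /toS; ring.
by rewrite comb// mul1r mulNr => /eqP; rewrite subr_eq0 => /eqP.
Qed.

Local Notation RS := (measurableTypeR R * S)%type.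

Definition UtoS (w : T) : RS := (U w, w).

Lemma measurable_UtoS : measurable_fun setT UtoS.
Proof. by apply: measurable_fun_pair => //; exact: measurable_toS. Qed.

(** Independence of U and Z, expressed as a product law for the pair of U and the sample point
    reduced to its Z-information. *)
Lemma law_UtoS (E : set RS) : measurable E ->
  P (UtoS @^-1` E) = (N \x PS)%E E.
Proof.
move=> mE; apply/esym.
pose f : {mfun T >-> RS} := HB.pack UtoS
  (isMeasurableFun.Build _ _ T RS UtoS measurable_UtoS).
have h := @product_measure_unique _ _ _ _ _ N PS (distribution P f).
apply: h => // A B mA mB.
by rewrite -[RHS]indepS.
Qed.

(** Under the product law the second coordinate can be held fixed while the first runs over N(0,1),
    so [normal_ibp] applies for each [w]. The joint measurability hypotheses, stated on [RS], are
    what says that [h] depends on [w] only through Z. *)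
Lemma gaussian_ibp (h h' : R -> T -> R) :
  measurable_fun [set: RS] (fun z => h z.1 z.2) ->
  measurable_fun [set: RS] (fun z => h' z.1 z.2) ->
  (forall w (u : R), is_derive u 1 (h ^~ w) (h' u w)) ->
  (forall w, continuous (h' ^~ w)) ->
  (forall w, polyb (h ^~ w)) -> (forall w, polyb (h' ^~ w)) ->
  integ P (fun w => U w * h (U w) w) -> integ P (fun w => h' (U w) w) ->
  \int[P]_w (U w * h (U w) w) = \int[P]_w h' (U w) w.
Proof.
move=> mh mh' dh ch' ph ph' i1 i2.
pose g (z : RS) := z.1 * h z.1 z.2.
pose g' (z : RS) := h' z.1 z.2.
have mg : measurable_fun setT g by exact: measurable_funM.
have ig : integ (N \x PS)%E g.
  by apply/(@integ_image _ _ _ _ _ P (N \x PS)%E _ measurable_UtoS law_UtoS g mg).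
have ig' : integ (N \x PS)%E g'.
  by apply/(@integ_image _ _ _ _ _ P (N \x PS)%E _ measurable_UtoS law_UtoS g' mh').
have <- := @Rint_image _ _ _ _ _ P (N \x PS)%E _ measurable_UtoS law_UtoS g ig.
have <- := @Rint_image _ _ _ _ _ P (N \x PS)%E _ measurable_UtoS law_UtoS g' ig'.
rewrite -(RFubini2 ig).2 -(RFubini2 ig').2; apply: eq_Rint => w.
have := @normal_ibp _ _ (oner_neq0 R) (h ^~ w) (h' ^~ w) (dh w) (@ch' w) (ph w) (ph' w).
by rewrite expr1n mul1r.
Qed.

End Independence.

(** * Lebesgue measure on row vectors *)

Definition measure_rV_display : measure_display.
Proof. exact: default_measure_display. Qed.

Section MeasurableRow.
Context {R : realType} (n : nat).
Let coords : 'I_n -> 'rV[R]_n -> R := fun i x => x ord0 i.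
Let rV_set0 : g_sigma_preimage coords set0. Proof. exact: sigma_algebra0. Qed.
Let rV_setC A : g_sigma_preimage coords A -> g_sigma_preimage coords (~` A).
Proof. exact: sigma_algebraC. Qed.
Let rV_bigcup (F : (set 'rV[R]_n)^nat) : (forall i, g_sigma_preimage coords (F i)) ->
  g_sigma_preimage coords (\bigcup_i (F i)).
Proof. exact: sigma_algebra_bigcup. Qed.

HB.instance Definition _ := @isMeasurable.Build measure_rV_display
  'rV[R]_n (g_sigma_preimage coords) rV_set0 rV_setC rV_bigcup.

Lemma measurable_coord (i : 'I_n) : measurable_fun [set: 'rV[R]_n] (fun x => x ord0 i).
Proof.
move=> _ Y mY; rewrite setTI; apply: sub_sigma_algebra => /=.
rewrite -bigcup_seq/=; exists i => /=; first by rewrite mem_index_enum.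
by exists Y => //; rewrite setTI.
Qed.

Lemma measurable_fun_rV d (T : measurableType d) (f : T -> 'rV[R]_n) :
  (forall i, measurable_fun setT (fun w => f w ord0 i)) -> measurable_fun setT f.
Proof.
move=> mf _ A mA; rewrite setTI.
suff : g_sigma_preimage (fun i => coords i \o f) `<=` (@measurable _ T).
  by rewrite g_sigma_preimage_comp; apply; exists A => //; rewrite setTI.
apply: smallest_sub; first exact: sigma_algebra_measurable.
rewrite -bigcup_seq => B [i _ [C mC <-]]; exact: mf.
Qed.

End MeasurableRow.

Section RowCons.
Context {R : realType} (n : nat).

Definition rcons_rV (z : measurableTypeR R * 'rV[R]_n) : 'rV[R]_n.+1 :=
  row_mx (\row_(j < 1) (z.1 : R)) z.2.

Lemma rcons_rV0 z : rcons_rV z ord0 ord0 = z.1.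
Proof.
rewrite /rcons_rV mxE; case: splitP => [j _|k]; first by rewrite mxE.
by [].
Qed.

Lemma rcons_rVS z j : rcons_rV z ord0 (lift ord0 j) = z.2 ord0 j.
Proof.
rewrite /rcons_rV mxE; case: splitP => [k /=|k /= e].
  by rewrite ord1.
congr (z.2 _ _); apply/val_inj; apply/esym.
exact: (@addnI 1 j k e).
Qed.

Definition runcons_rV (x : 'rV[R]_n.+1) : measurableTypeR R * 'rV[R]_n :=
  (x ord0 ord0, \row_j x ord0 (lift ord0 j)).

Lemma rcons_rVK : cancel rcons_rV runcons_rV.
Proof.
move=> [a v]; rewrite /runcons_rV rcons_rV0; congr pair.
by apply/rowP => j; rewrite mxE rcons_rVS.
Qed.

Lemma measurable_rcons_rV : measurable_fun setT rcons_rV.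
Proof.
apply: measurable_fun_rV => j; case: (unliftP ord0 j) => [k ->|->].
  under eq_fun do rewrite rcons_rVS.
  apply: (@measurableT_comp _ _ _ _ _ _ (fun v : 'rV[R]_n => v ord0 k)) => //.
  exact: measurable_coord.
by under eq_fun do rewrite rcons_rV0; exact: measurable_fst.
Qed.

Lemma measurable_runcons_rV : measurable_fun setT runcons_rV.
Proof.
apply: measurable_fun_pair; first exact: measurable_coord.
by apply: measurable_fun_rV => j; under eq_fun do rewrite mxE; exact: measurable_coord.
Qed.

Variable m : {sigma_finite_measure set 'rV[R]_n -> \bar R}.

Definition cons_measure : set 'rV[R]_n.+1 -> \bar R :=
  pushforward (@lebesgue_measure R \x m)%E rcons_rV.

Let cm0 : cons_measure set0 = 0%E.
Proof. by rewrite /cons_measure /pushforward preimage_set0 measure0. Qed.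
Let cm_ge0 A : (0 <= cons_measure A)%E.
Proof. by rewrite /cons_measure /pushforward measure_ge0. Qed.
Let cm_sigma : semi_sigma_additive cons_measure.
Proof.
move=> F mF tF mUF; rewrite /cons_measure /pushforward preimage_bigcup.
apply: measure_semi_sigma_additive.
- by move=> k; rewrite -[X in measurable X]setTI; exact: measurable_rcons_rV.
- apply/trivIsetP => /= i j _ _ ij; rewrite -preimage_setI.
  by move/trivIsetP : tF => /(_ _ _ _ _ ij) ->//; rewrite preimage_set0.
- by rewrite -preimage_bigcup -[X in measurable X]setTI; exact: measurable_rcons_rV.
Qed.

HB.instance Definition _ := isMeasure.Build _ _ _ cons_measure cm0 cm_ge0 cm_sigma.

Let cm_sfinite : sigma_finite setT cons_measure.
Proof.
have /sigma_finiteP[F [TF ndF Foo]] := sigma_finiteT (@lebesgue_measure R).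
have /sigma_finiteP[G [TG ndG Goo]] := sigma_finiteT m.
exists (fun i => runcons_rV @^-1` (F i `*` G i)).
  rewrite -preimage_bigcup (_ : \bigcup_i _ = setT) ?preimage_setT//.
  rewrite -setXTT TF TG predeqE => -[x y]; split.
    by move=> [n' _ []/= ? ?]; split; exists n'.
  move=> [/= [n' _ Fnx] [k _ Gky]]; exists (maxn n' k) => //; split.
  - by move: x Fnx; exact/subsetPset/ndF/leq_maxl.
  - by move: y Gky; exact/subsetPset/ndG/leq_maxr.
move=> i; have [mF Fi] := Foo i; have [mG Gi] := Goo i; split.
  rewrite -[X in measurable X]setTI; apply: measurable_runcons_rV => //.
  exact: measurableX.
rewrite /cons_measure /pushforward.
have -> : rcons_rV @^-1` (runcons_rV @^-1` (F i `*` G i)) = F i `*` G i.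
  by apply/seteqP; split => z; rewrite /preimage /mkset rcons_rVK.
by rewrite product_measure1E// lte_mul_pinfty// ge0_fin_numE.
Qed.

HB.instance Definition _ := Measure_isSigmaFinite.Build _ _ _ cons_measure cm_sfinite.

End RowCons.

Section LebesgueRow.
Context {R : realType}.

(** The measure behind the iterated integral [lebRd]: it splits off coordinates in the same order,
    and gives access to Fubini, densities and translations. *)
Fixpoint lebV (n : nat) : {sigma_finite_measure set 'rV[R]_n -> \bar R} :=
  match n with
  | 0 => \d_(0 : 'rV[R]_0)
  | n'.+1 => cons_measure (lebV n')
  end.

Lemma lebVS_E n A : lebV n.+1 A = (@lebesgue_measure R \x lebV n)%E (@rcons_rV R n @^-1` A).
Proof. by []. Qed.

Lemma ge0_integral_lebVS n (f : 'rV[R]_n.+1 -> \bar R) : measurable_fun setT f ->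
  (forall x, 0 <= f x)%E ->
  (\int[lebV n.+1]_x f x = \int[@lebesgue_measure R]_a \int[lebV n]_v f (rcons_rV (a, v)))%E.
Proof.
move=> mf f0.
rewrite (@ge0_integral_image _ _ _ _ _ (@lebesgue_measure R \x lebV n)%E
  (lebV n.+1) _ (@measurable_rcons_rV R n))//.
have mfc : measurable_fun setT (f \o @rcons_rV R n).
  by apply: measurableT_comp => //; exact: measurable_rcons_rV.
by rewrite (fubini_tonelli1 _ mfc)// => z; exact: f0.
Qed.

Lemma ge0_lebRdE n (f : 'rV[R]_n -> \bar R) : measurable_fun setT f ->
  (forall x, 0 <= f x)%E -> lebRd f = (\int[lebV n]_x f x)%E.
Proof.
elim: n f => [|n ih] f mf f0 /=.
  by rewrite integral_dirac// diracT mul1e.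
rewrite ge0_integral_lebVS//; apply: eq_integral => a _.
rewrite -ih//.
exact: (measurableT_comp (measurableT_comp mf (@measurable_rcons_rV R n)) (pair1_measurable a)).
Qed.

Definition box n (N : R) : set 'rV[R]_n := [set x | forall i, `|x ord0 i| <= N].

Arguments box : clear implicits.

Lemma measurable_box n N : measurable (box n N).
Proof.
rewrite [X in measurable X](_ : _ = \bigcap_(i in [set: 'I_n]) ((fun x : 'rV[R]_n => x ord0 i) @^-1` `[- N, N])).
  apply: fin_bigcap_measurable => // i _.
  by rewrite -[X in measurable X]setTI; exact: measurable_coord.
apply/seteqP; split => x /=.
  by move=> h i _ /=; rewrite in_itv/= -ler_norml.
move=> h i; have h' : x ord0 i \in `[- N, N] by exact: (h i Logic.I).
by rewrite ler_norml !(itvP h').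
Qed.

Lemma lebV_box n N : 0 <= N -> lebV n (box n N) = ((2 * N) ^+ n)%:E.
Proof.
move=> N0; elim: n => [|n ih].
  by rewrite /= diracE mem_set// => -[].
rewrite lebVS_E (_ : _ @^-1` _ = `[- N, N]%classic `*` box n N).
  rewrite product_measure1E//; last exact: measurable_box.
  have hl : @lebesgue_measure R `[- N, N] = (2 * N)%:E.
    rewrite lebesgue_measure_itv/= lte_fin.
    have [NN|NN] := ltP (- N) N; first by rewrite -EFinB; congr (_%:E); ring.
    have N00 : N = 0 by apply/eqP; rewrite eq_le N0 andbT; lra.
    by rewrite N00 mulr0.
  by rewrite ih exprS EFinM; congr (_ * _)%E; exact: hl.
apply/seteqP; split => -[a v] /=.
  move=> h; split; first by rewrite in_itv/= -ler_norml; have := h ord0; rewrite rcons_rV0.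
  by move=> i /=; have := h (lift ord0 i); rewrite rcons_rVS.
move=> [/= + h2] i; rewrite in_itv/= -ler_norml => h1.
case: (unliftP ord0 i) => [k ->|->]; first by rewrite rcons_rVS.
by rewrite rcons_rV0.
Qed.

(** Y integrates a function of varying sign, so Tonelli is not enough. Domination by a multiple of
    the indicator of a box passes to sections, which lets the induction use Fubini. *)
Lemma lebRd_bndE n (f : 'rV[R]_n -> R) (M N : R) : measurable_fun setT f ->
  0 <= N -> (forall x, `|f x| <= M * \1_(box n N) x) ->
  integ (lebV n) f /\ lebRd (EFin \o f) = (\int[lebV n]_x (f x)%:E)%E.
Proof.
move=> mf N0 fM; have int k (g : 'rV[R]_k -> R) : measurable_fun setT g ->
    (forall x, `|g x| <= M * \1_(box k N) x) -> integ (lebV k) g.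
  move=> mg gM; apply: (integ_le mg gM); apply: integZl.
  apply/integrableP; split; first by apply/measurable_EFinP; apply: measurable_indic; exact: measurable_box.
  under eq_integral do rewrite /= ger0_norm//.
  rewrite integral_indic//; last exact: measurable_box.
  by rewrite setIT; have := ltry ((2 * N) ^+ k); rewrite -(lebV_box k N0).
split; first exact: int.
elim: n f mf fM => [|n ih] f mf fM.
  rewrite /= integral_dirac ?diracT ?mul1e//; exact/measurable_EFinP.
have fcM a v : `|f (rcons_rV (a, v))| <= M * \1_(box n N) v.
  apply: (le_trans (fM _)); rewrite !indicE.
  have M0 : 0 <= M.
    have := fM 0; rewrite indicE mem_set ?mulr1; last by move=> i; rewrite mxE normr0.
    exact: le_trans.
  rewrite ler_wpM2l//; have [h|h] := pselect (box n N v).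
    by rewrite (mem_set h); case: (_ \in _).
  rewrite !memNset// => h'; apply: h => i.
  by have := h' (lift ord0 i); rewrite rcons_rVS.
have mc : measurable_fun setT (f \o @rcons_rV R n).
  by apply: measurableT_comp => //; exact: measurable_rcons_rV.
transitivity (\int[@lebesgue_measure R]_a \int[lebV n]_v (f (rcons_rV (a, v)))%:E)%E.
  apply: eq_integral => a _; rewrite -[RHS]ih//.
  exact: (measurableT_comp mc (pair1_measurable a)).
have If := int _ f mf fM.
have If' : integ (@lebesgue_measure R \x lebV n)%E (f \o @rcons_rV R n).
  by apply/(@integ_image _ _ _ _ _ (@lebesgue_measure R \x lebV n)%E
    (lebV n.+1) _ (@measurable_rcons_rV R n)).
have -> : (\int[lebV n.+1]_x (f x)%:E =
    \int[(@lebesgue_measure R \x lebV n)%E]_z (f (rcons_rV z))%:E)%E.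
  rewrite (RintE If) (RintE If') (@Rint_image _ _ _ _ _ (@lebesgue_measure R \x lebV n)%E
    (lebV n.+1) _ (@measurable_rcons_rV R n))//.
by rewrite -(integral12_prod_meas1 If').
Qed.

End LebesgueRow.
Arguments box {R} n N.

(** * Translation invariance *)

Section Translation.
Context {R : realType}.
Local Notation leb := (@lebesgue_measure R).

Lemma lebesgue_measure_shift (c : R) (A : set R) : measurable A ->
  leb ((fun a : R => a + c) @^-1` A) = leb A.
Proof.
move=> mA; have mc : measurable_fun setT ((fun a => a + c) : measurableTypeR R -> measurableTypeR R).
  exact: measurable_funD.
have h := @lebesgue_measure_unique R (pushforward leb ((fun a => a + c) : measurableTypeR R -> measurableTypeR R)).
rewrite [RHS]h//= => _ [[a b]] _ <-; rewrite /pushforward.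
rewrite (_ : _ @^-1` _ = `]a - c, b - c]%classic).
  rewrite !lebesgue_measure_itv/= !lte_fin ltrD2r.
  by case: ifP => // _; rewrite -!EFinB opprB addrA subrK.
by apply/seteqP; split => x; rewrite /preimage /mkset/= !in_itv/= ltrBlDr lerBrDr.
Qed.

Lemma ge0_integral_shift (c : R) (f : measurableTypeR R -> \bar R) : measurable_fun setT f ->
  (forall a, 0 <= f a)%E -> (\int[leb]_a f (a + c)%R = \int[leb]_a f a)%E.
Proof.
move=> mf f0; have mc : measurable_fun setT ((fun a => a + c) : measurableTypeR R -> measurableTypeR R).
  exact: measurable_funD.
by rewrite (@ge0_integral_image _ _ _ _ _ leb leb _ mc (@lebesgue_measure_shift c) f).
Qed.

Lemma measurable_addrV n (c : 'rV[R]_n) : measurable_fun setT (fun x : 'rV[R]_n => x + c).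
Proof.
apply: measurable_fun_rV => i; under eq_fun do rewrite mxE.
by apply: measurable_funD => //; exact: measurable_coord.
Qed.

Lemma ge0_integral_shiftV n (c : 'rV[R]_n) (f : 'rV[R]_n -> \bar R) : measurable_fun setT f ->
  (forall x, 0 <= f x)%E -> (\int[lebV n]_x f (x + c)%R = \int[lebV n]_x f x)%E.
Proof.
elim: n c f => [|n ih] c f mf f0.
  by apply: eq_integral => x _; congr f; apply/rowP => -[].
have mfc : measurable_fun setT (fun x : 'rV[R]_n.+1 => f (x + c)).
  by apply: (measurableT_comp mf); exact: measurable_addrV.
rewrite (ge0_integral_lebVS mf f0) (ge0_integral_lebVS mfc (fun=> f0 _)).
pose c' : 'rV[R]_n := \row_j c ord0 (lift ord0 j).
have cE a v : rcons_rV (a, v) + c = rcons_rV (a + c ord0 ord0, v + c').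
  apply/rowP => j; rewrite mxE; case: (unliftP ord0 j) => [k ->|->].
    by rewrite !rcons_rVS !mxE.
  by rewrite !rcons_rV0.
have mr : measurable_fun setT (f \o @rcons_rV R n).
  by apply: measurableT_comp => //; exact: measurable_rcons_rV.
transitivity (\int[leb]_a \int[lebV n]_v f (rcons_rV ((a + c ord0 ord0)%R, v)))%E.
  apply: eq_integral => a _; under eq_integral do rewrite cE.
  rewrite (ih c' (fun v => f (rcons_rV ((a + c ord0 ord0)%R, v))))//.
  exact: (measurableT_comp mr (pair1_measurable (a + c ord0 ord0 : measurableTypeR R))).
rewrite (@ge0_integral_shift (c ord0 ord0) (fun a => \int[lebV n]_v f (rcons_rV (a, v))))%E//.
- exact: (@measurable_fun_fubini_tonelli_F _ _ (measurableTypeR R) 'rV[R]_n R (lebV n) _ mr (fun z => f0 _)).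
- by move=> a; exact: integral_ge0.
Qed.

End Translation.

(** * Measurability of Caratheodory functions, open sets and compact sets *)

Section Caratheodory.
Context {R : realType} (n : nat).

(* Rounding to the grid of mesh 1/(k+1) replaces a point by a countable index, so that a function
   of (x, w) continuous in x is a limit of jointly measurable ones. *)
Definition grid_code (k : nat) (x : 'rV[R]_n) : {ffun 'I_n -> int} :=
  [ffun i => Num.floor (k.+1%:R * x ord0 i)].

Definition grid_point (k : nat) (z : {ffun 'I_n -> int}) : 'rV[R]_n :=
  \row_i ((z i)%:~R / k.+1%:R).

Lemma grid_close k (x : 'rV[R]_n) (i : 'I_n) : `|x ord0 i - grid_point k (grid_code k x) ord0 i| <= k.+1%:R^-1.
Proof.
rewrite !mxE ffunE; have /andP[h1 h2] := floor_itv (k.+1%:R * x ord0 i).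
rewrite intrD in h2.
have k0 : 0 < k.+1%:R :> R by [].
have -> : x ord0 i - (Num.floor (k.+1%:R * x ord0 i))%:~R / k.+1%:R =
  (k.+1%:R * x ord0 i - (Num.floor (k.+1%:R * x ord0 i))%:~R) / k.+1%:R.
  by rewrite mulrBl mulrAC divff ?mul1r ?pnatr_eq0.
rewrite ger0_norm ?divr_ge0 ?subr_ge0//.
by rewrite -[leRHS]mul1r ler_pM2r ?invr_gt0// lerBlDl ltW.
Qed.

Lemma grid_cvg x : grid_point k (grid_code k x) @[k --> \oo] --> x.
Proof.
apply/cvg_ballP => e e0; near=> k; split => // i j; rewrite [i]ord1.
rewrite /ball /= (le_lt_trans (grid_close k x j))//.
by near: k; apply: near_infty_natSinv_lt (PosNum e0).
Unshelve. all: by end_near. Qed.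

Lemma measurable_grid_code k z : measurable [set x | grid_code k x = z].
Proof.
rewrite [X in measurable X](_ : _ = \bigcap_(i in [set: 'I_n])
    ((fun x : 'rV[R]_n => k.+1%:R * x ord0 i) @^-1` `[(z i)%:~R, (z i + 1)%:~R[)).
  apply: fin_bigcap_measurable => // i _.
  rewrite -[X in measurable X]setTI.
  suff : measurable_fun setT (fun x : 'rV[R]_n => k.+1%:R * x ord0 i) by exact.
  by apply: measurable_funM => //; exact: measurable_coord.
apply/seteqP; split => x.
  move=> /= <- i _; rewrite /preimage /mkset in_itv/= ffunE; exact: floor_itv.
move=> h; apply/ffunP => i; rewrite ffunE; apply: floor_def.
by have := h i Logic.I; rewrite /preimage /mkset in_itv.
Qed.

Lemma measurable_fun_grid d (T : measurableType d) k (g : {ffun 'I_n -> int} -> T -> R) :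
  (forall z, measurable_fun setT (g z)) ->
  measurable_fun [set: 'rV[R]_n * T] (fun p => g (grid_code k p.1) p.2).
Proof.
move=> mg _ A mA; rewrite setTI.
rewrite [X in measurable X](_ : _ = \bigcup_m
   (if unpickle m is Some z then [set x | grid_code k x = z] `*` (g z @^-1` A) else set0)).
  apply: bigcupT_measurable => m; case: unpickle => [z|//].
  apply: measurableX; first exact: measurable_grid_code.
  by rewrite -[X in measurable X]setTI; exact: mg.
apply/seteqP; split => [[x w] /= h|[x w] [m _]].
  by exists (pickle (grid_code k x)) => //; rewrite pickleK.
by case: unpickle => // z [/= <-].
Qed.

(** Convergence along the grid approximations is the form in which the regularity of the covariance
    and of the residuals is obtained ([cov_grid_cvg], [resid_grid_cvg]). *)
Lemma measurable_caratheodory_grid d (T : measurableType d) (f : 'rV[R]_n -> T -> R) :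
  (forall x w, f (grid_point k (grid_code k x)) w @[k --> \oo] --> f x w) ->
  (forall x, measurable_fun setT (f x)) ->
  measurable_fun [set: 'rV[R]_n * T] (fun p => f p.1 p.2).
Proof.
move=> cf mf.
apply: (@measurable_fun_cvg _ _ _ _ (fun k p => f (grid_point k (grid_code k p.1)) p.2)).
  move=> k; apply: (@measurable_fun_grid _ T k (fun z => f (grid_point k z))) => z.
  exact: mf.
by move=> [x w] _; exact: cf.
Qed.

Lemma grid_cvg_comp (f : 'rV[R]_n -> R) x : continuous f ->
  f (grid_point k (grid_code k x)) @[k --> \oo] --> f x.
Proof.
move=> cf; exact: (@cvg_comp _ _ _ (fun k => grid_point k (grid_code k x)) f _ _ _ (@grid_cvg x) (cf x)).
Qed.

Lemma measurable_caratheodory d (T : measurableType d) (f : 'rV[R]_n -> T -> R) :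
  (forall w, continuous (f ^~ w)) -> (forall x, measurable_fun setT (f x)) ->
  measurable_fun [set: 'rV[R]_n * T] (fun p => f p.1 p.2).
Proof.
move=> cf mf; apply: measurable_caratheodory_grid => // x w.
exact: (@grid_cvg_comp (f ^~ w)).
Qed.

Lemma continuous_measurable_rV (f : 'rV[R]_n -> R) : continuous f -> measurable_fun setT f.
Proof.
move=> cf; have h := @measurable_caratheodory _ 'rV[R]_n (fun x _ => f x) (fun _ => cf) (fun _ => measurable_cst _).
have : measurable_fun setT ((fun p : 'rV[R]_n * 'rV[R]_n => f p.1) \o (fun x => (x, x))).
  by apply: measurableT_comp => //; exact: measurable_fun_pair.
by [].
Qed.

(** Needed because the sigma-algebra is generated by coordinates. [Q k z] says that the closed cube
    of half-side 1/(k+1) about the grid point [z] lies in U; the cells with this property are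
    countably many and exhaust U. *)
Lemma open_measurable_rV (U : set 'rV[R]_n) : open U -> measurable U.
Proof.
move=> oU.
pose Q k (z : {ffun 'I_n -> int}) : Prop :=
  forall y : 'rV[R]_n, (forall i, `|y ord0 i - grid_point k z ord0 i| <= k.+1%:R^-1) -> U y.
rewrite [X in measurable X](_ : _ = \bigcup_k [set x | Q k (grid_code k x)]).
  apply: bigcupT_measurable => k.
  rewrite [X in measurable X](_ : _ = \bigcup_m (if unpickle m is Some z then
     [set x | grid_code k x = z] `&` [set _ | Q k z] else set0)).
    apply: bigcupT_measurable => m; case: unpickle => [z|//].
    have [q|q] := pselect (Q k z).
      rewrite (_ : [set _ | Q k z] = setT) ?setIT; first exact: measurable_grid_code.
      by apply/seteqP; split.
    rewrite (_ : [set _ | Q k z] = set0) ?setI0//.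
    by apply/seteqP; split.
  apply/seteqP; split => [x /= h|x [m _]].
    by exists (pickle (grid_code k x)) => //; rewrite pickleK.
  by case: unpickle => // z [/= <-].
apply/seteqP; split => [x Ux|x [k _ Qx]].
  have /nbhs_ballP[e /= e0 eU] : nbhs x U by exact: open_nbhs_nbhs.
  have [k hk] : exists k, k.+1%:R^-1 < e / 2.
    have e2 : 0 < e / 2 by rewrite divr_gt0.
    have [N _ h] := near_infty_natSinv_lt (PosNum e2).
    by exists N; exact: (h N (leqnn N)).
  exists k => // y hy; apply: eU; split => // i j; rewrite [i]ord1 /ball /=.
  have h1 := grid_close k x j; have h2 := hy j.
  rewrite -(subrK (grid_point k (grid_code k x) ord0 j) (x ord0 j)) -addrA.
  rewrite (le_lt_trans (ler_normD _ _))// [e]splitr ltrD//.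
    exact: le_lt_trans h1 hk.
  rewrite distrC; exact: le_lt_trans h2 hk.
by apply: Qx => i; exact: grid_close.
Qed.

Lemma compact_measurable_rV (K : set 'rV[R]_n) : compact K -> measurable K.
Proof.
move=> cK; rewrite -[K]setCK; apply: measurableC; apply: open_measurable_rV.
by rewrite openC; apply: compact_closed => //; exact: norm_hausdorff.
Qed.

Lemma compact_box (K : set 'rV[R]_n) : compact K -> exists2 N : R, 0 <= N & K `<=` box n N.
Proof.
move=> /compact_bounded[M [_ hM]]; exists (`|M| + 1); first by rewrite addr_ge0.
move=> x Kx i; apply: le_trans (hM (`|M| + 1) _ x Kx); last first.
  by rewrite (le_lt_trans (ler_norm M))// ltrDl.
rewrite [leRHS]/Num.norm /= mx_normrE; exact: (@le_bigmax _ _ _ 0 (fun ij : 'I_1 * 'I_n => `|x ij.1 ij.2|) (ord0, i)).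
Qed.

End Caratheodory.

(** * Gaussian fields *)

Section GaussianField.
Context {R : realType} d (T : measurableType d) (P : probability T R) (n : nat).
Variables (B : 'rV[R]_n -> T -> R) (C : 'rV[R]_n -> R).
Hypothesis gB : centered_gaussian_field P B.
Hypothesis CB : forall x y, \int[P]_w (B x w * B y w) = C (x - y).
Hypothesis C0 : C 0 = 1.
Local Notation N := (normal_prob (0 : R) 1).

Lemma field_measurable x : measurable_fun setT (B x).
Proof. exact: gB.1. Qed.

Definition linc (s : seq (R * 'rV[R]_n)) (w : T) : R := \sum_(p <- s) p.1 * B p.2 w.

Lemma measurable_linc s : measurable_fun setT (linc s).
Proof.
by apply: measurable_sum => p; apply: measurable_funM => //; exact: field_measurable.
Qed.

Lemma law_linc s : exists t : R, forall A, measurable A ->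
  P (linc s @^-1` A) = centered_normal t A.
Proof.
have [t h] := gB.2 (size s) (fun i => (tnth (in_tuple s) i).2) (fun i => (tnth (in_tuple s) i).1).
exists t => A mA; rewrite -h//; congr (P (_ @^-1` A)).
by apply/funext => w; rewrite /linc big_tnth.
Qed.

Lemma linc_polyb (g : R -> R) s : measurable_fun setT g -> polyb g -> integ P (g \o linc s).
Proof.
move=> mg pg; have [t h] := law_linc s.
exact: (law_polyb (measurable_linc s) h).
Qed.

(** The unspecified parameter of the law is eliminated in favour of the second moment, through which
    covariances enter. *)
Lemma linc_cos s : \int[P]_w cos (linc s w) = expR (- (\int[P]_w linc s w ^+ 2) / 2).
Proof.
have [t h] := law_linc s.
have := law_cos (measurable_linc s) h 1.
rewrite (law_moment2 (measurable_linc s) h) expr1n mulr1 => <-.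
by apply: eq_Rint => w; rewrite mul1r.
Qed.

Lemma linc_sin s : \int[P]_w sin (linc s w) = 0.
Proof.
have [t h] := law_linc s.
have := law_sin (measurable_linc s) h 1 => <-.
by apply: eq_Rint => w; rewrite mul1r.
Qed.

Lemma linc1 (a : R) x w : linc [:: (a, x)] w = a * B x w.
Proof. by rewrite /linc big_seq1. Qed.

Lemma linc_sqr_integ s : integ P (fun w => linc s w ^+ 2).
Proof.
apply: (@linc_polyb (fun u => u ^+ 2)) => //.
by apply: polybM; exact: polyb_id.
Qed.

Lemma linc_mul_integ s t : integ P (fun w => linc s w * linc t w).
Proof.
apply: (integ_le _ _ (integD (linc_sqr_integ s) (linc_sqr_integ t))).
  by apply: measurable_funM; exact: measurable_linc.
move=> w; rewrite ler_norml.
by have := sqr_ge0 (linc s w + linc t w); have := sqr_ge0 (linc s w - linc t w);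
  have := sqr_ge0 (linc s w); have := sqr_ge0 (linc t w); rewrite sqrrB sqrrD; lra.
Qed.

Lemma fieldE x w : B x w = linc [:: (1, x)] w.
Proof. by rewrite linc1 mul1r. Qed.

Lemma field_mul_integ x y : integ P (fun w => B x w * B y w).
Proof.
have := linc_mul_integ [:: (1, x)] [:: (1, y)].
by congr (integ _ _); apply/funext => w; rewrite -!fieldE.
Qed.

Lemma field_law x A : measurable A -> P (B x @^-1` A) = N A.
Proof.
move=> mA; have [s h] := law_linc [:: (1, x)].
have s2 : s ^+ 2 = 1.
  rewrite -(law_moment2 (measurable_linc _) h).
  transitivity (\int[P]_w (B x w * B x w)); last by rewrite CB subrr.
  by apply: eq_Rint => w; rewrite -fieldE expr2.
have -> : B x = linc [:: (1, x)] by apply/funext => w; rewrite -fieldE.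
rewrite h//.
have s0 : s != 0 by apply/eqP => s0; move: s2; rewrite s0 expr0n/= => /eqP; rewrite eq_sym oner_eq0.
(* [s] may be -1, but the density involves it only through its square. *)
rewrite /centered_normal (negbTE s0) /normal_prob.
apply: eq_integral => u _; rewrite !normal_pdfE ?oner_neq0//.
by rewrite /normal_peak /normal_fun s2 expr1n.
Qed.

Lemma field_polyb (g : R -> R) x : measurable_fun setT g -> polyb g ->
  integ P (g \o B x) /\ \int[P]_w g (B x w) = \int[N]_u g u.
Proof.
move=> mg pg; have [ig _] := normal_density (oner_neq0 R) mg pg.
have law := @field_law x.
split; first exact/(@integ_image _ _ _ _ _ P N _ (@field_measurable x) law _ mg).
by rewrite (@Rint_image _ _ _ _ _ P N _ (@field_measurable x) law _ ig).
Qed.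

Lemma cov_sym x : C (- x) = C x.
Proof.
have -> : C x = C (x - 0) by rewrite subr0.
have -> : C (- x) = C (0 - x) by rewrite sub0r.
by rewrite -!CB; apply: eq_Rint => w; rewrite mulrC.
Qed.

Lemma field_var x : \int[P]_w (B x w * B x w) = 1.
Proof. by rewrite CB subrr. Qed.

Lemma cov_le1 x : `|C x| <= 1.
Proof.
have -> : C x = C (x - 0) by rewrite subr0.
rewrite -CB (le_trans (norm_Rint (field_mul_integ _ _)))//.
have -> : (1 : R) = \int[P]_w (2^-1 * (B x w * B x w) + 2^-1 * (B 0 w * B 0 w)).
  rewrite RintD; [|apply: integZl; exact: field_mul_integ|apply: integZl; exact: field_mul_integ].
  rewrite !RintZl; [|exact: field_mul_integ|exact: field_mul_integ].
  by rewrite !field_var; field.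
apply: le_Rint.
- apply: integ_norm; exact: field_mul_integ.
- by apply: integD; apply: integZl; exact: field_mul_integ.
- move=> w; rewrite ler_norml.
  by have := sqr_ge0 (B x w + B 0 w); have := sqr_ge0 (B x w - B 0 w);
    rewrite sqrrB sqrrD !expr2; lra.
Qed.

Hypothesis cB : forall w, continuous (fun x => B x w).

(* E cos(B_x - B_y) recovers C(x - y); with path continuity this gives the regularity of C. *)
Lemma cov_cos x y : \int[P]_w cos (B x w - B y w) = expR (C (x - y) - 1).
Proof.
transitivity (\int[P]_w cos (linc [:: (1, x); (-1, y)] w)).
  by apply: eq_Rint => w; rewrite /linc big_cons big_seq1 /= mul1r mulN1r.
rewrite linc_cos; congr expR.
have -> : \int[P]_w linc [:: (1, x); (-1, y)] w ^+ 2 =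
    \int[P]_w ((B x w * B x w + B y w * B y w) + (-2) * (B x w * B y w)).
  by apply: eq_Rint => w; rewrite /linc big_cons big_seq1 /=; ring.
rewrite RintD; [|by apply: integD; exact: field_mul_integ|by apply: integZl; exact: field_mul_integ].
rewrite RintD; [|exact: field_mul_integ|exact: field_mul_integ].
rewrite RintZl; last exact: field_mul_integ.
by rewrite !field_var CB; field.
Qed.

(** Since the cosine is bounded, dominated convergence applies to it without any control of the
    field along the sequence; a logarithm then undoes [cov_cos]. *)
Lemma cov_grid_cvg x y :
  C (x - grid_point k (grid_code k y)) @[k --> \oo] --> C (x - y).
Proof.
pose yk k : 'rV[R]_n := grid_point k (grid_code k y).
have mcos : measurable_fun setT (@cos R).
  exact: (continuous_measurable_fun (@continuous_cos R)).
have [] := @Rint_dominated _ _ _ P (fun k w => cos (B x w - B (yk k) w))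
   (fun w => cos (B x w - B y w)) (fun=> 1).
- move=> k; apply: (@measurableT_comp _ _ _ _ _ _ cos) => //.
  by apply: measurable_funB; exact: field_measurable.
- move=> w.
  have h : B x w - B (yk k) w @[k --> \oo] --> B x w - B y w.
    apply: cvgB; first exact: cvg_cst.
    exact: (@grid_cvg_comp _ _ (fun x => B x w)).
  by apply: continuous_cvg; [exact: continuous_cos|exact: h].
- exact: integ_cst.
- by move=> k w; exact: norm_cos_le1.
move=> _; under eq_fun do rewrite cov_cos.
rewrite cov_cos => h.
have lnc : ln (expR (C (x - yk k) - 1)) @[k --> \oo] --> ln (expR (C (x - y) - 1)).
  by apply: continuous_cvg; [apply: continuous_ln; exact: expR_gt0|exact: h].
have -> : (fun k => C (x - grid_point k (grid_code k y))) =
    (fun k => ln (expR (C (x - yk k) - 1)) + 1).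
  by apply/funext => k; rewrite expRK subrK.
have -> : C (x - y) = ln (expR (C (x - y) - 1)) + 1 by rewrite expRK subrK.
by apply: cvgD => //; exact: cvg_cst.
Qed.

Definition resid (x y : 'rV[R]_n) (w : T) : R := B y w - C (x - y) * B x w.

Lemma measurable_resid x y : measurable_fun setT (resid x y).
Proof.
apply: measurable_funB; first exact: field_measurable.
by apply: measurable_funM => //; exact: field_measurable.
Qed.

Lemma field_resid x y w : B y w = C (x - y) * B x w + resid x y w.
Proof. by rewrite /resid addrC subrK. Qed.

Lemma resid_grid_cvg x y w :
  resid x (grid_point k (grid_code k y)) w @[k --> \oo] --> resid x y w.
Proof.
apply: cvgB; first exact: (@grid_cvg_comp _ _ (fun x => B x w)).
by apply: cvgM; [exact: cov_grid_cvg|exact: cvg_cst].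
Qed.

Lemma field_resid_orth x y : \int[P]_w (B x w * resid x y w) = 0.
Proof.
transitivity (\int[P]_w (B x w * B y w - C (x - y) * (B x w * B x w))).
  by apply: eq_Rint => w; rewrite /resid; ring.
rewrite RintB; [|exact: field_mul_integ|by apply: integZl; exact: field_mul_integ].
by rewrite RintZl ?field_var ?CB ?mulr1 ?subrr//; exact: field_mul_integ.
Qed.

Section Decoupling.
Variables (x : 'rV[R]_n) (u : R) (m : nat) (i : nat -> 'rV[R]_n) (v : nat -> R).
Let V w := \sum_(j < m) v j * resid x (i j) w.
(** Each residual contributes two weighted field values, which exhibits V as a combination covered
    by the Gaussian hypothesis. *)
Let sV := flatten [seq [:: (v j, i j); (- (v j * C (x - i j)), x)] | j <- iota 0 m].

Let VE w : V w = linc sV w.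
Proof.
rewrite /V /linc /sV big_flatten /= big_map -(big_mkord xpredT (fun j => v j * resid x (i j) w)).
rewrite /index_iota subn0; apply: eq_bigr => j _.
by rewrite big_cons big_seq1 /resid /=; ring.
Qed.

Let UV0 : \int[P]_w (B x w * V w) = 0.
Proof.
have -> : \int[P]_w (B x w * V w) = \int[P]_w \sum_(j < m) (v j * (B x w * resid x (i j) w)).
  by apply: eq_Rint => w; rewrite /V mulr_sumr; apply: eq_bigr => j _; ring.
have ir y : integ P (fun w => B x w * resid x y w).
  have := integB (field_mul_integ x y) (integZl (C (x - y)) (field_mul_integ x x)).
  by congr (integ _ _); apply/funext => w; rewrite /resid; ring.
rewrite Rint_sum; last by move=> j; exact: integZl.
by rewrite big1// => j _; rewrite RintZl// field_resid_orth mulr0.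
Qed.

Let UVE w : u * B x w + V w = linc ((u, x) :: sV) w.
Proof. by rewrite VE /linc big_cons. Qed.

Let var_UV : \int[P]_w linc ((u, x) :: sV) w ^+ 2 = u ^+ 2 + \int[P]_w linc sV w ^+ 2.
Proof.
have iUV : integ P (fun w => B x w * V w).
  have := linc_mul_integ [:: (1, x)] sV.
  by congr (integ _ _); apply/funext => w; rewrite -fieldE -VE.
transitivity (\int[P]_w ((u ^+ 2 * (B x w * B x w) + linc sV w ^+ 2) + (2 * u) * (B x w * V w))).
  by apply: eq_Rint => w; rewrite -UVE VE; ring.
have i1 : integ P (fun w => u ^+ 2 * (B x w * B x w)) by apply: integZl; exact: field_mul_integ.
have i2 := linc_sqr_integ sV.
rewrite RintD; [|exact: integD|exact: integZl].
rewrite (RintZl _ iUV) UV0 mulr0 addr0 RintD// RintZl ?field_var ?mulr1//.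
exact: field_mul_integ.
Qed.

(** B_x is orthogonal to every residual, so the variances of the two summands add, and by [linc_cos]
    the characteristic function of a combination is determined by its variance. *)
Lemma decoupled_cos : \int[P]_w cos (u * B x w + \sum_(j < m) v j * resid x (i j) w) =
  expR (- u ^+ 2 / 2) * \int[P]_w cos (\sum_(j < m) v j * resid x (i j) w).
Proof.
under eq_Rint do rewrite -/(V _) UVE.
under [in RHS]eq_Rint do rewrite -/(V _) VE.
by rewrite !linc_cos var_UV -expRD opprD mulrDl.
Qed.

Lemma decoupled_sin : \int[P]_w sin (u * B x w + \sum_(j < m) v j * resid x (i j) w) =
  expR (- u ^+ 2 / 2) * \int[P]_w sin (\sum_(j < m) v j * resid x (i j) w).
Proof.
under eq_Rint do rewrite -/(V _) UVE.
under [in RHS]eq_Rint do rewrite -/(V _) VE.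
by rewrite !linc_sin mulr0.
Qed.

End Decoupling.

Definition field_ibp x := @gaussian_ibp _ _ _ P _ (B x) (resid x)
  (@field_measurable x) (@measurable_resid x) (@field_law x)
  (@decoupled_cos x) (@decoupled_sin x).

End GaussianField.

(** * Moments of Hermite polynomials of the field *)

Section HermitePolynomials.
Context {R : realType}.
Local Notation He := (@hermite R).

Lemma hermite_pair n : (herm_pair R n).2 = He n.+1.
Proof. by rewrite /hermite /=; case: (herm_pair R n). Qed.

Lemma hermiteSS n : He n.+2 = 'X * He n.+1 - n.+1%:R *: He n.
Proof. by rewrite -hermite_pair -hermite_pair /hermite /=; case: (herm_pair R n). Qed.

Lemma hermite0 : He 0 = 1. Proof. by []. Qed.
Lemma hermite1 : He 1 = 'X. Proof. by []. Qed.

Lemma hermiteS n : He n.+1 = 'X * He n - n%:R *: He n.-1.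
Proof.
case: n => [|n]; last exact: hermiteSS.
by rewrite hermite1 hermite0 mulr1 scale0r subr0.
Qed.

Lemma deriv_hermite n : (He n)^`() = n%:R *: He n.-1.
Proof.
(* The recursion has depth two, so two consecutive degrees are carried along. *)
suff : (He n)^`() = n%:R *: He n.-1 /\ (He n.+1)^`() = n.+1%:R *: He n by case.
elim: n => [|n [ih1 ih2]].
  by rewrite hermite0 hermite1 scale0r derivX derivC scale1r.
split; first exact: ih2.
rewrite (hermiteSS n) derivB derivM derivX mul1r derivZ ih1 ih2.
rewrite -scalerAr -addrA -scalerBr -hermiteS -{1}[He n.+1]scale1r -scalerDl.
by rewrite -[1]/(1%:R) -natrD.
Qed.

Lemma horner_hermite0 (u : R) : (He 0).[u] = 1.
Proof. by rewrite -[He 0]/(1%:P) hornerC. Qed.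

Lemma hermite_horner n (u : R) : (He n.+1).[u] = u * (He n).[u] - n%:R * (He n.-1).[u].
Proof. by rewrite hermiteS !hornerE. Qed.

End HermitePolynomials.

Section AllMoments.
Context {R : realType} d (T : measurableType d) (P : probability T R).

(** Stable under products, so that every product of polynomials in field values is integrable. *)
Definition allmom (F : T -> R) :=
  measurable_fun setT F /\ forall m, integ P (fun w => `|F w| ^+ m).

Lemma allmom_integ F : allmom F -> integ P F.
Proof.
move=> [mF iF]; apply: (integ_le mF _ (iF 1)) => w.
by rewrite expr1.
Qed.

Lemma allmomM F G : allmom F -> allmom G -> allmom (fun w => F w * G w).
Proof.
move=> [mF iF] [mG iG]; split; first exact: measurable_funM.
move=> m; apply: (integ_le _ _ (integD (iF (m * 2)%N) (iG (m * 2)%N))).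
  by apply: measurable_funX; apply: measurableT_comp => //; exact: measurable_funM.
move=> w; rewrite normrX normr_id normrM exprMn !exprM.
have := sqr_ge0 (`|F w| ^+ m - `|G w| ^+ m).
have := sqr_ge0 (`|F w| ^+ m); have := sqr_ge0 (`|G w| ^+ m).
by rewrite sqrrB; lra.
Qed.

End AllMoments.

Lemma polyb_normX {R : realType} (g : R -> R) m : polyb g -> polyb (fun u => `|g u| ^+ m).
Proof.
move=> [K [k hK]]; elim: m => [|m ih].
  by apply: (polyb_eq (g := fun=> 1)); [move=> u; rewrite expr0|exact: polyb_cst].
apply: (polyb_eq (g := fun u => `|g u| * `|g u| ^+ m)).
  by move=> u; rewrite exprS.
by apply: polybM ih; exists K, k => u; rewrite normr_id.
Qed.

Section FieldMoments.
Context {R : realType} d (T : measurableType d) (P : probability T R) (n : nat).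
Variables (B : 'rV[R]_n -> T -> R) (C : 'rV[R]_n -> R).
Hypothesis gB : centered_gaussian_field P B.
Hypothesis CB : forall x y, \int[P]_w (B x w * B y w) = C (x - y).
Hypothesis C0 : C 0 = 1.
Local Notation He := (@hermite R).

Lemma allmom_field (p : {poly R}) x : allmom P (fun w => p.[B x w]).
Proof.
have mp : measurable_fun setT (horner p) by exact: measurable_poly.
split.
  apply: (@measurableT_comp _ _ _ _ _ _ (horner p)) => //.
  exact: (field_measurable gB).
move=> m; apply: (field_polyb gB CB C0 x (g := fun u => `|p.[u]| ^+ m) _ _).1.
- by apply: measurable_funX; exact: measurableT_comp.
- by apply: polyb_normX; exact: polyb_horner.
Qed.

Lemma allmom_fieldX x : allmom P (B x).
Proof.
have := allmom_field 'X x.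
by congr (allmom _ _); apply/funext => w; rewrite hornerX.
Qed.

Local Notation RS x := (measurableTypeR R * g_sigma_algebraType (cylinder (resid B C x)))%type.

Lemma measurable_shifted (g : R -> R) x y : measurable_fun setT g ->
  measurable_fun [set: RS x] (fun z => g (C (x - y) * (z.1 : R) + resid B C x y z.2)).
Proof.
move=> mg; apply: (@measurableT_comp _ _ _ _ _ _ g) => //.
apply: measurable_funD; first by apply: measurable_funM => //; exact: measurable_fst.
have h := @measurable_ZS _ _ _ _ (resid B C x) y.

exact: (measurableT_comp h (@measurable_snd _ _ (measurableTypeR R) _)).
Qed.

Lemma is_derive_shifted (p : {poly R}) (c r u : R) :
  is_derive u (1 : R) (fun u : R => p.[c * u + r]) (c * p^`().[c * u + r]).
Proof.
have dl : is_derive u (1 : R) (fun u : R => c * u + r) c.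
  have h := is_deriveD (is_derive_linear c u) (is_derive_cst r u 1).
  by apply: is_derive_eq h _; rewrite addr0.
have h := @is_derive1_comp _ (horner p) (fun u => c * u + r) u _ _ (is_derive_poly p _) dl.
by apply: is_derive_eq h _; rewrite mulrC.
Qed.

Lemma polyb_shifted (p : {poly R}) (c r : R) : polyb (fun u : R => p.[c * u + r]).
Proof.
apply: (polyb_eq (g := fun u => (p \Po (c%:P * 'X + r%:P)).[u])); last exact: polyb_horner.
by move=> u; rewrite horner_comp !hornerE.
Qed.

Lemma continuous_shifted (p : {poly R}) (c r : R) : continuous (fun u : R => p.[c * u + r]).
Proof.
exact: derive_continuous (fun u => is_derive_shifted p c r u).
Qed.

Section FourIBP.
Variables (x y2 y3 y4 : 'rV[R]_n) (p0 p2 p3 p4 : {poly R}).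
Let c2 := C (x - y2). Let c3 := C (x - y3). Let c4 := C (x - y4).
Let prod4 (q0 q2 q3 q4 : {poly R}) w :=
  q0.[B x w] * (q2.[B y2 w] * (q3.[B y3 w] * q4.[B y4 w])).

Let allmom4 q0 q2 q3 q4 : allmom P (prod4 q0 q2 q3 q4).
Proof. by do 3?[apply: allmomM]; exact: allmom_field. Qed.

(** With u = B_x, the other three arguments are C(x - y) u plus a residual, so the product rule
    gives one term per factor, weighted by the covariance with B_x. *)
Lemma four_ibp : \int[P]_w (B x w * prod4 p0 p2 p3 p4 w) =
  \int[P]_w prod4 p0^`() p2 p3 p4 w + c2 * \int[P]_w prod4 p0 p2^`() p3 p4 w +
  c3 * \int[P]_w prod4 p0 p2 p3^`() p4 w + c4 * \int[P]_w prod4 p0 p2 p3 p4^`() w.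
Proof.
pose s y (q : {poly R}) (u : R) w := q.[C (x - y) * u + resid B C x y w].
pose h (q0 q2 q3 q4 : {poly R}) u w := q0.[u] * (s y2 q2 u w * (s y3 q3 u w * s y4 q4 u w)).
pose h' u w := h p0^`() p2 p3 p4 u w + c2 * h p0 p2^`() p3 p4 u w +
  c3 * h p0 p2 p3^`() p4 u w + c4 * h p0 p2 p3 p4^`() u w.
have hE q0 q2 q3 q4 w : h q0 q2 q3 q4 (B x w) w = prod4 q0 q2 q3 q4 w.
  by rewrite /h /s /prod4 -!field_resid.
have h'E w : h' (B x w) w = prod4 p0^`() p2 p3 p4 w + c2 * prod4 p0 p2^`() p3 p4 w +
    c3 * prod4 p0 p2 p3^`() p4 w + c4 * prod4 p0 p2 p3 p4^`() w.
  by rewrite /h' !hE.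
have mp (p : {poly R}) : measurable_fun setT (horner p) by exact: measurable_poly.
have mh q0 q2 q3 q4 : measurable_fun [set: RS x] (fun z => h q0 q2 q3 q4 z.1 z.2).
  apply: measurable_funM.
    by apply: (@measurableT_comp _ _ _ _ _ _ (horner q0)) => //; exact: measurable_fst.
  apply: measurable_funM; first exact: (@measurable_shifted (horner q2) x y2 (mp q2)).
  by apply: measurable_funM; [exact: (@measurable_shifted (horner q3) x y3 (mp q3))|
    exact: (@measurable_shifted (horner q4) x y4 (mp q4))].
have ph q0 q2 q3 q4 w : polyb (h q0 q2 q3 q4 ^~ w).
  apply: polybM; first exact: polyb_horner.
  by apply: polybM; [exact: polyb_shifted|apply: polybM; exact: polyb_shifted].
have ch q0 q2 q3 q4 w : continuous (h q0 q2 q3 q4 ^~ w).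
  move=> u; apply: cvgM; first exact: continuous_horner.
  apply: cvgM; first exact: continuous_shifted.
  by apply: cvgM; exact: continuous_shifted.
have i4 q0 q2 q3 q4 : integ P (prod4 q0 q2 q3 q4) by exact: allmom_integ.
have mK c q0 q2 q3 q4 : measurable_fun [set: RS x] (fun z => c * h q0 q2 q3 q4 z.1 z.2).
  by apply: measurable_funM.
have ih' : integ P (fun w => h' (B x w) w).
  rewrite (_ : (fun w => _) = (fun w => prod4 p0^`() p2 p3 p4 w + c2 * prod4 p0 p2^`() p3 p4 w +
    c3 * prod4 p0 p2 p3^`() p4 w + c4 * prod4 p0 p2 p3 p4^`() w)).
    by apply: integD (integZl _ _) => //; apply: integD (integZl _ _) => //; apply: integD (integZl _ _).
  by apply/funext => w; rewrite h'E.
have := @field_ibp _ _ _ _ _ _ _ gB CB C0 x (h p0 p2 p3 p4) h'.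
have -> : \int[P]_w (B x w * h p0 p2 p3 p4 (B x w) w) = \int[P]_w (B x w * prod4 p0 p2 p3 p4 w).
  by apply: eq_Rint => w; rewrite hE.
have -> : \int[P]_w h' (B x w) w = \int[P]_w (prod4 p0^`() p2 p3 p4 w + c2 * prod4 p0 p2^`() p3 p4 w +
    c3 * prod4 p0 p2 p3^`() p4 w + c4 * prod4 p0 p2 p3 p4^`() w).
  by apply: eq_Rint => w; rewrite h'E.
move=> ibp; apply: etrans; first apply: ibp.
- exact: mh.
- by apply: measurable_funD => //; apply: measurable_funD => //; apply: measurable_funD.
- move=> w u.
  have d0 := is_derive_poly p0 u.
  have d2 := is_derive_shifted p2 c2 (resid B C x y2 w) u.
  have d3 := is_derive_shifted p3 c3 (resid B C x y3 w) u.
  have d4 := is_derive_shifted p4 c4 (resid B C x y4 w) u.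
  apply: is_derive_eq (is_deriveM d0 (is_deriveM d2 (is_deriveM d3 d4))) _.
  have fM (f g : R -> R) v : (f * g) v = f v * g v by [].
  by rewrite /GRing.scale /h' /h /s /c2 /c3 /c4 /= !fM; ring.
- move=> w u; rewrite /h'.
  by do 3![apply: cvgD; [|by apply: cvgM; [exact: cvg_cst|exact: ch]]]; exact: ch.
- by move=> w; exact: ph.
- move=> w; do 3![apply: polybD; [|by apply: polybM; [exact: polyb_cst|exact: ph]]]; exact: ph.
- have := allmom_integ (allmomM (allmom_fieldX x) (allmom4 p0 p2 p3 p4)).
  by congr (integ _ _); apply/funext => w; rewrite hE.
- exact: ih'.
- rewrite RintD; [|apply: integD; [apply: integD|]|]; [|exact: i4|exact: integZl|exact: integZl|exact: integZl].
  rewrite RintD; [|apply: integD|]; [|exact: i4|exact: integZl|exact: integZl].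
  rewrite RintD; [|exact: i4|exact: integZl].
  by rewrite !RintZl.
Qed.

End FourIBP.
End FieldMoments.

(** * Multigraph expansions of four-point moments *)

Section WickPolynomials.
Context {R : realType}.

(* Linear span of the monomials whose exponents are the edge multiplicities of a multigraph
   on {1, 2, 3, 4} with degrees n1, ..., n4. *)
Inductive wick (n1 n2 n3 n4 : nat) : (R -> R -> R -> R -> R -> R -> R) -> Prop :=
| wick0 : wick n1 n2 n3 n4 (fun _ _ _ _ _ _ => 0)
| wick_mono a12 a13 a14 a23 a24 a34 :
    (a12 + a13 + a14)%N = n1 -> (a12 + a23 + a24)%N = n2 ->
    (a13 + a23 + a34)%N = n3 -> (a14 + a24 + a34)%N = n4 ->
    wick n1 n2 n3 n4 (fun c12 c13 c14 c23 c24 c34 =>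
      c12 ^+ a12 * c13 ^+ a13 * c14 ^+ a14 * c23 ^+ a23 * c24 ^+ a24 * c34 ^+ a34)
| wickD F G : wick n1 n2 n3 n4 F -> wick n1 n2 n3 n4 G ->
    wick n1 n2 n3 n4 (fun c12 c13 c14 c23 c24 c34 =>
      F c12 c13 c14 c23 c24 c34 + G c12 c13 c14 c23 c24 c34)
| wickZ (k : R) F : wick n1 n2 n3 n4 F ->
    wick n1 n2 n3 n4 (fun c12 c13 c14 c23 c24 c34 => k * F c12 c13 c14 c23 c24 c34).

Lemma wick_eq n1 n2 n3 n4 F G : wick n1 n2 n3 n4 F ->
  (forall c12 c13 c14 c23 c24 c34, F c12 c13 c14 c23 c24 c34 = G c12 c13 c14 c23 c24 c34) ->
  wick n1 n2 n3 n4 G.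
Proof.
move=> h e; suff <- : F = G by [].
by do 6 (apply/funext => ?).
Qed.

Lemma wickM n1 n2 n3 n4 b12 b13 b14 b23 b24 b34 F : wick n1 n2 n3 n4 F ->
  wick (b12 + b13 + b14 + n1) (b12 + b23 + b24 + n2) (b13 + b23 + b34 + n3)
    (b14 + b24 + b34 + n4) (fun c12 c13 c14 c23 c24 c34 =>
      c12 ^+ b12 * c13 ^+ b13 * c14 ^+ b14 * c23 ^+ b23 * c24 ^+ b24 * c34 ^+ b34 *
      F c12 c13 c14 c23 c24 c34).
Proof.
elim=> [|a12 a13 a14 a23 a24 a34 h1 h2 h3 h4|G H _ ihG _ ihH|k G _ ih].
- by apply: wick_eq (wick0 _ _ _ _) _ => *; rewrite mulr0.
- apply: wick_eq (@wick_mono _ _ _ _ (b12 + a12) (b13 + a13) (b14 + a14) (b23 + a23)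
    (b24 + a24) (b34 + a34) _ _ _ _) _; [lia|lia|lia|lia|].
  by move=> *; rewrite !exprD; ring.
- by apply: wick_eq (wickD ihG ihH) _ => *; rewrite mulrDr.
- by apply: wick_eq (wickZ k ih) _ => *; rewrite mulrCA.
Qed.

(** Replace both bases by the larger one. *)
Lemma exprM_le (a b : R) s u k : 0 <= a <= 1 -> 0 <= b <= 1 -> (s + u)%N = k ->
  a ^+ s * b ^+ u <= a ^+ k + b ^+ k.
Proof.
move=> /andP[a0 a1] /andP[b0 b1] <-; rewrite !exprD.
have [ab|ba] := leP a b.
- rewrite (le_trans (y := b ^+ s * b ^+ u)) ?lerDr ?mulr_ge0 ?exprn_ge0//.
  by rewrite ler_wpM2r ?exprn_ge0// lerXn2r ?nnegrE.
- rewrite (le_trans (y := a ^+ s * a ^+ u)) ?lerDl ?mulr_ge0 ?exprn_ge0//.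
  by rewrite ler_wpM2l ?exprn_ge0// lerXn2r ?nnegrE// ltW.
Qed.

(** In a multigraph on four vertices, all of degree p, opposite edges have equal multiplicity, so a
    monomial is (c12 c34)^i (c13 c24)^j (c14 c23)^l with i + j + l = p. Evaluation at c12 = c34 = 1
    and 0 elsewhere keeps exactly the monomials with i = p. The others have i < p, and [exprM_le]
    separates their last two factors. *)
Lemma wick_bound p F : wick p p p p F -> exists2 K, 0 <= K &
  forall c12 c13 c14 c23 c24 c34, `|c12| <= 1 -> `|c13| <= 1 -> `|c14| <= 1 ->
    `|c23| <= 1 -> `|c24| <= 1 -> `|c34| <= 1 ->
    `|F c12 c13 c14 c23 c24 c34 - F 1 0 0 0 0 1 * (c12 * c34) ^+ p| <=
    K * \sum_(r < p) `|c12 * c34| ^+ r * (`|c13 * c24| ^+ (p - r) + `|c14 * c23| ^+ (p - r)).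
Proof.
elim=> [|a12 a13 a14 a23 a24 a34 h1 h2 h3 h4|G H _ [K K0 hK] _ [L L0 hL]|k G _ [K K0 hK]].
- by exists 0 => // *; rewrite !mul0r subrr normr0.
- have [e34 [e24 e23]] : a34 = a12 /\ a24 = a13 /\ a23 = a14 by lia.
  exists 1 => // c12 c13 c14 c23 c24 c34 k12 k13 k14 k23 k24 k34.
  rewrite e34 e24 e23 mul1r.
  have S0 : 0 <= \sum_(r < p)
      `|c12 * c34| ^+ r * (`|c13 * c24| ^+ (p - r) + `|c14 * c23| ^+ (p - r)).
    by apply: sumr_ge0 => r _; rewrite mulr_ge0 ?addr_ge0 ?exprn_ge0.
  have [ap|ap] := eqVneq a12 p.
    have [-> ->] : a13 = 0%N /\ a14 = 0%N by lia.
    by rewrite ap !expr0 !expr1n exprMn !mulr1 mul1r subrr normr0.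
  have lt : (a12 < p)%N by lia.
  have z : (0 : R) ^+ a13 * 0 ^+ a14 = 0.
    rewrite !expr0n; case: eqP => [e|_]; last by rewrite mul0r.
    by case: eqP => [e'|_]; [exfalso; lia|rewrite mulr0].
  rewrite (_ : _ - _ = (c12 * c34) ^+ a12 * ((c13 * c24) ^+ a13 * (c14 * c23) ^+ a14)); last first.
    by rewrite -[1 ^+ a12 * 0 ^+ a13 * 0 ^+ a14]mulrA z mulr0 !mul0r subr0 !exprMn; ring.
  rewrite normrM [`|_ ^+ a13 * _|]normrM !normrX.
  rewrite (bigD1 (Ordinal lt))//= -[X in X <= _]addr0 lerD//; last first.
    by apply: sumr_ge0 => r _; rewrite mulr_ge0 ?addr_ge0 ?exprn_ge0.
  rewrite ler_wpM2l ?exprn_ge0// exprM_le//.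
  + by rewrite normr_ge0 normrM mulr_ile1.
  + by rewrite normr_ge0 normrM mulr_ile1.
  + lia.
- exists (K + L) => [|c12 c13 c14 c23 c24 c34 k12 k13 k14 k23 k24 k34]; first exact: addr_ge0.
  rewrite [X in _ <= X]mulrDl; apply: (le_trans _ (lerD (hK _ _ _ _ _ _ k12 k13 k14 k23 k24 k34)
    (hL _ _ _ _ _ _ k12 k13 k14 k23 k24 k34))).
  by apply: (le_trans _ (ler_normD _ _)); rewrite le_eqVlt; apply/orP; left; apply/eqP;
    congr (`| _ |); ring.
- exists (`|k| * K) => [|c12 c13 c14 c23 c24 c34 k12 k13 k14 k23 k24 k34]; first exact: mulr_ge0.
  rewrite -[_ * K * _]mulrA -mulrA -mulrBr normrM ler_wpM2l//.
  exact: hK.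
Qed.

End WickPolynomials.

Section HermiteMoments.
Context {R : realType} d (T : measurableType d) (P : probability T R) (n : nat).
Variables (B : 'rV[R]_n -> T -> R) (C : 'rV[R]_n -> R).
Hypothesis gB : centered_gaussian_field P B.
Hypothesis CB : forall x y, \int[P]_w (B x w * B y w) = C (x - y).
Hypothesis C0 : C 0 = 1.
Local Notation He := (@hermite R).

Definition mom n1 n2 n3 n4 x1 x2 x3 x4 : R := \int[P]_w ((He n1).[B x1 w] *
  ((He n2).[B x2 w] * ((He n3).[B x3 w] * (He n4).[B x4 w]))).

(** The term of [four_ibp] that differentiates the first polynomial cancels against the second term
    of the Hermite recursion: no edge joins a vertex to itself. *)
Lemma mom_rec n1 n2 n3 n4 x1 x2 x3 x4 : mom n1.+1 n2 n3 n4 x1 x2 x3 x4 =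
  n2%:R * (C (x1 - x2) * mom n1 n2.-1 n3 n4 x1 x2 x3 x4) +
  n3%:R * (C (x1 - x3) * mom n1 n2 n3.-1 n4 x1 x2 x3 x4) +
  n4%:R * (C (x1 - x4) * mom n1 n2 n3 n4.-1 x1 x2 x3 x4).
Proof.
have am p0 p1 p2 p3 : allmom P (fun w => p0.[B x1 w] * (p1.[B x2 w] * (p2.[B x3 w] * p3.[B x4 w]))).
  by do 3?[apply: allmomM]; exact: (allmom_field gB CB C0).
have i4 p0 p1 p2 p3 := allmom_integ (am p0 p1 p2 p3).
have ibp := four_ibp gB CB C0 x1 x2 x3 x4 (He n1) (He n2) (He n3) (He n4).
have intZ k p0 p1 p2 p3 q0 q1 q2 q3 :
  (forall w, p0.[B x1 w] * (p1.[B x2 w] * (p2.[B x3 w] * p3.[B x4 w])) =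
   k * (q0.[B x1 w] * (q1.[B x2 w] * (q2.[B x3 w] * q3.[B x4 w])))) ->
  \int[P]_w (p0.[B x1 w] * (p1.[B x2 w] * (p2.[B x3 w] * p3.[B x4 w]))) =
  k * \int[P]_w (q0.[B x1 w] * (q1.[B x2 w] * (q2.[B x3 w] * q3.[B x4 w]))).
  by move=> e; rewrite -RintZl//; exact: eq_Rint.
transitivity (\int[P]_w (B x1 w * ((He n1).[B x1 w] * ((He n2).[B x2 w] *
    ((He n3).[B x3 w] * (He n4).[B x4 w]))) - n1%:R * ((He n1.-1).[B x1 w] *
  ((He n2).[B x2 w] * ((He n3).[B x3 w] * (He n4).[B x4 w]))))).
  by apply: eq_Rint => w; rewrite hermite_horner; ring.
rewrite RintB; [|exact: (allmom_integ (allmomM (allmom_fieldX gB CB C0 x1) (am _ _ _ _)))|exact: integZl].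
rewrite ibp RintZl// !deriv_hermite.
rewrite (intZ n1%:R (n1%:R *: He n1.-1) (He n2) (He n3) (He n4) (He n1.-1) (He n2) (He n3) (He n4)); last first.
  by move=> w; rewrite hornerZ; ring.
rewrite (intZ n2%:R (He n1) (n2%:R *: He n2.-1) (He n3) (He n4) (He n1) (He n2.-1) (He n3) (He n4)); last first.
  by move=> w; rewrite hornerZ; ring.
rewrite (intZ n3%:R (He n1) (He n2) (n3%:R *: He n3.-1) (He n4) (He n1) (He n2) (He n3.-1) (He n4)); last first.
  by move=> w; rewrite hornerZ; ring.
rewrite (intZ n4%:R (He n1) (He n2) (He n3) (n4%:R *: He n4.-1) (He n1) (He n2) (He n3) (He n4.-1)); last first.
  by move=> w; rewrite hornerZ; ring.
by rewrite /mom; ring.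
Qed.

Lemma mom_swap12 n1 n2 n3 n4 x1 x2 x3 x4 :
  mom n1 n2 n3 n4 x1 x2 x3 x4 = mom n2 n1 n3 n4 x2 x1 x3 x4.
Proof. by apply: eq_Rint => w; ring. Qed.

Lemma mom_swap13 n1 n2 n3 n4 x1 x2 x3 x4 :
  mom n1 n2 n3 n4 x1 x2 x3 x4 = mom n3 n2 n1 n4 x3 x2 x1 x4.
Proof. by apply: eq_Rint => w; ring. Qed.

Lemma mom_swap14 n1 n2 n3 n4 x1 x2 x3 x4 :
  mom n1 n2 n3 n4 x1 x2 x3 x4 = mom n4 n2 n3 n1 x4 x2 x3 x1.
Proof. by apply: eq_Rint => w; ring. Qed.

Lemma mom_rec2 n2 n3 n4 x1 x2 x3 x4 : mom 0 n2.+1 n3 n4 x1 x2 x3 x4 =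
  n3%:R * (C (x2 - x3) * mom 0 n2 n3.-1 n4 x1 x2 x3 x4) +
  n4%:R * (C (x2 - x4) * mom 0 n2 n3 n4.-1 x1 x2 x3 x4).
Proof.
by rewrite mom_swap12 mom_rec mul0r add0r -![mom n2 0 _ _ _ _ _ _]mom_swap12.
Qed.

Lemma mom_rec3 n3 n4 x1 x2 x3 x4 : mom 0 0 n3.+1 n4 x1 x2 x3 x4 =
  n4%:R * (C (x3 - x4) * mom 0 0 n3 n4.-1 x1 x2 x3 x4).
Proof.
by rewrite mom_swap13 mom_rec !mul0r !add0r -![mom n3 0 0 _ _ _ _ _]mom_swap13.
Qed.

Lemma mom_rec4 n4 x1 x2 x3 x4 : mom 0 0 0 n4.+1 x1 x2 x3 x4 = 0.
Proof. by rewrite mom_swap14 mom_rec !mul0r !add0r. Qed.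

Lemma mom0 x1 x2 x3 x4 : mom 0 0 0 0 x1 x2 x3 x4 = 1.
Proof.
rewrite -(Rint_probability_cst P 1); apply: eq_Rint => w.
by rewrite !horner_hermite0 ?mulr1.
Qed.

Definition wick_repr n1 n2 n3 n4 (Phi : 'rV[R]_n -> 'rV[R]_n -> 'rV[R]_n -> 'rV[R]_n -> R) (v : R) :=
  exists F, [/\ wick n1 n2 n3 n4 F, forall x1 x2 x3 x4, Phi x1 x2 x3 x4 =
    F (C (x1 - x2)) (C (x1 - x3)) (C (x1 - x4)) (C (x2 - x3)) (C (x2 - x4)) (C (x3 - x4)) &
  F 1 0 0 0 0 1 = v].

Lemma wick_repr0 n1 n2 n3 n4 : wick_repr n1 n2 n3 n4 (fun _ _ _ _ => 0) 0.
Proof. by exists (fun _ _ _ _ _ _ => 0); split => //; exact: wick0. Qed.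

Lemma wick_reprD n1 n2 n3 n4 Phi Psi v w : wick_repr n1 n2 n3 n4 Phi v ->
  wick_repr n1 n2 n3 n4 Psi w ->
  wick_repr n1 n2 n3 n4 (fun x1 x2 x3 x4 => Phi x1 x2 x3 x4 + Psi x1 x2 x3 x4) (v + w).
Proof.
move=> [F [wF eF <-]] [G [wG eG <-]]; eexists; split; [exact: wickD wF wG| |by []].
by move=> *; rewrite eF eG.
Qed.

Lemma wick_repr_eq n1 n2 n3 n4 Phi Psi v w : wick_repr n1 n2 n3 n4 Phi v ->
  (forall x1 x2 x3 x4, Psi x1 x2 x3 x4 = Phi x1 x2 x3 x4) -> w = v ->
  wick_repr n1 n2 n3 n4 Psi w.
Proof.
by move=> [F [wF eF vF]] e ->; exists F; split => // *; rewrite e.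
Qed.

Lemma wick_reprM b12 b13 b14 b23 b24 b34 k n1 n2 n3 n4 Phi v : wick_repr n1 n2 n3 n4 Phi v ->
  wick_repr (b12 + b13 + b14 + n1) (b12 + b23 + b24 + n2) (b13 + b23 + b34 + n3)
    (b14 + b24 + b34 + n4) (fun x1 x2 x3 x4 => k *
      (C (x1 - x2) ^+ b12 * C (x1 - x3) ^+ b13 * C (x1 - x4) ^+ b14 * C (x2 - x3) ^+ b23 *
       C (x2 - x4) ^+ b24 * C (x3 - x4) ^+ b34 * Phi x1 x2 x3 x4))
    (k * (1 ^+ b12 * 0 ^+ b13 * 0 ^+ b14 * 0 ^+ b23 * 0 ^+ b24 * 1 ^+ b34 * v)).
Proof.
move=> [F [wF eF <-]].
have wF' := wickZ k (wickM b12 b13 b14 b23 b24 b34 wF).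
by eexists; split; [exact: wF'|move=> *; rewrite eF|].
Qed.

Let simpC := (expr0, expr1, mul1r, mulr1, mul0r, mulr0).

(* The value at c12 = c34 = 1 is what identifies the coefficient of c12^n1 c34^n3. *)
Lemma mom_wick n1 n2 n3 n4 : wick_repr n1 n2 n3 n4 (mom n1 n2 n3 n4)
  (((n1 == n2) && (n3 == n4))%:R * (n1`! * n3`!)%:R).
Proof.
elim: n1 n2 n3 n4 => [|n1 ih1] n2 n3 n4; last first.
  have t2 : wick_repr n1.+1 n2 n3 n4
      (fun x1 x2 x3 x4 => n2%:R * (C (x1 - x2) * mom n1 n2.-1 n3 n4 x1 x2 x3 x4))
      (((n1.+1 == n2) && (n3 == n4))%:R * (n1.+1`! * n3`!)%:R).
    case: n2 => [|n2]; first by apply: wick_repr_eq (wick_repr0 _ _ _ _) _ _ => *; rewrite mul0r.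
    (* The numerals count the added edges, in the order 12, 13, 14, 23, 24, 34. Only an edge 12 or
       34 leaves a nonzero value at the evaluation point; the other terms contribute 0. *)
    apply: wick_repr_eq (wick_reprM 1 0 0 0 0 0 n2.+1%:R (ih1 n2 n3 n4)) _ _.
      by move=> *; rewrite !simpC.
    rewrite !simpC eqSS; case: eqP => [->|_]/=; last by rewrite !simpC.
    by rewrite mulrCA; congr (_ * _); rewrite -natrM factS mulnA.
  have t3 : wick_repr n1.+1 n2 n3 n4
      (fun x1 x2 x3 x4 => n3%:R * (C (x1 - x3) * mom n1 n2 n3.-1 n4 x1 x2 x3 x4)) 0.
    case: n3 {t2} => [|n3]; first by apply: wick_repr_eq (wick_repr0 _ _ _ _) _ _ => *; rewrite ?mul0r.
    by apply: wick_repr_eq (wick_reprM 0 1 0 0 0 0 n3.+1%:R (ih1 n2 n3 n4)) _ _ => *; rewrite !simpC.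
  have t4 : wick_repr n1.+1 n2 n3 n4
      (fun x1 x2 x3 x4 => n4%:R * (C (x1 - x4) * mom n1 n2 n3 n4.-1 x1 x2 x3 x4)) 0.
    case: n4 {t2 t3} => [|n4]; first by apply: wick_repr_eq (wick_repr0 _ _ _ _) _ _ => *; rewrite ?mul0r.
    by apply: wick_repr_eq (wick_reprM 0 0 1 0 0 0 n4.+1%:R (ih1 n2 n3 n4)) _ _ => *; rewrite !simpC.
  apply: wick_repr_eq (wick_reprD (wick_reprD t2 t3) t4) _ _; last by rewrite !addr0.
  by move=> *; rewrite mom_rec.
elim: n2 n3 n4 => [|n2 ih2] n3 n4; last first.
  have t3 : wick_repr 0 n2.+1 n3 n4
      (fun x1 x2 x3 x4 => n3%:R * (C (x2 - x3) * mom 0 n2 n3.-1 n4 x1 x2 x3 x4)) 0.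
    case: n3 => [|n3]; first by apply: wick_repr_eq (wick_repr0 _ _ _ _) _ _ => *; rewrite ?mul0r.
    by apply: wick_repr_eq (wick_reprM 0 0 0 1 0 0 n3.+1%:R (ih2 n3 n4)) _ _ => *; rewrite !simpC.
  have t4 : wick_repr 0 n2.+1 n3 n4
      (fun x1 x2 x3 x4 => n4%:R * (C (x2 - x4) * mom 0 n2 n3 n4.-1 x1 x2 x3 x4)) 0.
    case: n4 {t3} => [|n4]; first by apply: wick_repr_eq (wick_repr0 _ _ _ _) _ _ => *; rewrite ?mul0r.
    by apply: wick_repr_eq (wick_reprM 0 0 0 0 1 0 n4.+1%:R (ih2 n3 n4)) _ _ => *; rewrite !simpC.
  apply: wick_repr_eq (wick_reprD t3 t4) _ _; last by rewrite addr0 mul0r.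
  by move=> *; rewrite mom_rec2.
elim: n3 n4 => [|n3 ih3] [|n4].
- exists (fun c12 c13 c14 c23 c24 c34 =>
    c12 ^+ 0 * c13 ^+ 0 * c14 ^+ 0 * c23 ^+ 0 * c24 ^+ 0 * c34 ^+ 0); split.
  + exact: wick_mono.
  + by move=> *; rewrite mom0 !simpC.
  + by rewrite !simpC.
- apply: wick_repr_eq (wick_repr0 _ _ _ _) _ _; last by rewrite mul0r.
  by move=> *; rewrite mom_rec4.
- apply: wick_repr_eq (wick_repr0 _ _ _ _) _ _; last by rewrite mul0r.
  by move=> *; rewrite mom_rec3 mul0r.
- apply: wick_repr_eq (wick_reprM 0 0 0 0 0 1 n4.+1%:R (ih3 n4)) _ _.
    by move=> *; rewrite mom_rec3 !simpC.
  rewrite !simpC eqSS /= !fact0 !mul1n; case: eqP => [->|_]/=; last by rewrite !simpC.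
  by rewrite mulrCA; congr (_ * _); rewrite -natrM factS.
Qed.

Lemma mom_diag k x y : mom k k 0 0 x y x x = k`!%:R * C (x - y) ^+ k.
Proof.
elim: k => [|k ih]; first by rewrite mom0 expr0 mulr1.
by rewrite mom_rec /= ih !mul0r !addr0 factS natrM exprS; ring.
Qed.

(** The two-point function is a four-point function in which two vertices have degree 0. *)
Lemma hermite_cov k x y : \int[P]_w ((He k).[B x w] * (He k).[B y w]) = k`!%:R * C (x - y) ^+ k.
Proof.
by rewrite -mom_diag; apply: eq_Rint => w; rewrite !horner_hermite0 ?mulr1.
Qed.

Lemma hermite_mean k x : \int[P]_w (He k.+1).[B x w] = 0.
Proof.
transitivity (mom k.+1 0 0 0 x x x x); last by rewrite mom_rec !mul0r !addr0.
by apply: eq_Rint => w; rewrite !horner_hermite0 ?mulr1.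
Qed.

Lemma mom_bound p : exists2 K, 0 <= K & forall x1 x2 x3 x4,
  `|mom p p p p x1 x2 x3 x4 - p`!%:R ^+ 2 * (C (x1 - x2) * C (x3 - x4)) ^+ p| <=
  K * \sum_(r < p) `|C (x1 - x2) * C (x3 - x4)| ^+ r *
    (`|C (x1 - x3) * C (x2 - x4)| ^+ (p - r) + `|C (x1 - x4) * C (x2 - x3)| ^+ (p - r)).
Proof.
have [F [wF eF vF]] := mom_wick p p p p; have [K K0 hK] := wick_bound wF.
exists K => // x1 x2 x3 x4; have := hK _ _ _ _ _ _ (cov_le1 gB CB C0 _)
  (cov_le1 gB CB C0 _) (cov_le1 gB CB C0 _) (cov_le1 gB CB C0 _) (cov_le1 gB CB C0 _)
  (cov_le1 gB CB C0 _).
by move=> /(_ (x1 - x2) (x1 - x3) (x1 - x4) (x2 - x3) (x2 - x4) (x3 - x4));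
  rewrite -eF vF !eqxx /= mul1r natrM -expr2.
Qed.

End HermiteMoments.

(** * Integrals of families of square-integrable variables *)

Section MeasurableRint.
Context {R : realType} d1 d2 (X : measurableType d1) (Y : measurableType d2).
Variable m2 : {sigma_finite_measure set Y -> \bar R}.

(** The positive and negative parts are integrated separately by Tonelli, and [fine] maps non-finite
    values to 0. *)
Lemma measurable_Rint (f : X * Y -> R) : measurable_fun setT f ->
  measurable_fun setT (fun x => \int[m2]_y f (x, y)).
Proof.
move=> mf; have mf' : measurable_fun setT (EFin \o f) by exact/measurable_EFinP.
have mp := measurable_fun_fubini_tonelli_F (m2 := m2) (EFin \o f)^\+%E (measurable_funepos mf')
  (@funepos_ge0 _ _ (EFin \o f)).
have mn := measurable_fun_fubini_tonelli_F (m2 := m2) (EFin \o f)^\-%E (measurable_funeneg mf')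
  (@funeneg_ge0 _ _ (EFin \o f)).
have h : measurable_fun setT (fun x => \int[m2]_y (f (x, y))%:E)%E.
  rewrite (_ : (fun x => _) = (fun x => fubini_F m2 (EFin \o f)^\+ x - fubini_F m2 (EFin \o f)^\- x)%E); first exact: emeasurable_funB.
  by apply/funext => x; rewrite integralE /fubini_F; congr (_ - _)%E; apply: eq_integral => y _; rewrite ?funeposE ?funenegE.
by have := measurableT_comp (fine_measurable measurableT) h.
Qed.

End MeasurableRint.

Section L2Families.
Context {R : realType} d (T : measurableType d) (P : probability T R).
Context dV (V : measurableType dV) (nu : {finite_measure set V -> \bar R}).

Definition L2bnd (M : R) (W : T -> R) :=
  [/\ measurable_fun setT W, integ P (fun w => W w ^+ 2) & \int[P]_w W w ^+ 2 <= M].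

(** Families whose pathwise integral commutes with expectations ([L2fam_mean]) and is again in L2
    ([L2fam_int]), so that integrations can be nested. The last condition is required for every [w],
    so that each pathwise integral is that of an integrable function. *)
Definition L2fam (M : R) (F : V -> T -> R) :=
  [/\ measurable_fun [set: V * T] (fun z => F z.1 z.2),
   forall x, L2bnd M (F x) & forall w, integ nu (fun x => F x w ^+ 2)].

Let m := \int[nu]_x (1 : R).

Let m_ge0 : 0 <= m.
Proof. by apply: Rintegral_ge0. Qed.

Lemma integ_sqr dX (X : measurableType dX) (mu : {finite_measure set X -> \bar R}) (f : X -> R) :
  measurable_fun setT f -> integ mu (fun x => f x ^+ 2) -> integ mu f.
Proof.
move=> mf f2; apply: (integ_le mf _ (integD (integ_cst mu 1) f2)) => x.
by have := sqr_ge0 (f x - 1); have := sqr_ge0 (f x + 1); have := sqr_ge0 (f x);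
  rewrite ler_norml sqrrB sqrrD expr1n; lra.
Qed.

Lemma integ_mul dX (X : measurableType dX) (mu : {finite_measure set X -> \bar R}) (f g : X -> R) :
  measurable_fun setT f -> measurable_fun setT g ->
  integ mu (fun x => f x ^+ 2) -> integ mu (fun x => g x ^+ 2) ->
  integ mu (fun x => f x * g x).
Proof.
move=> mf mg f2 g2; apply: (integ_le (measurable_funM mf mg) _ (integD f2 g2)) => x.
by have := sqr_ge0 (f x - g x); have := sqr_ge0 (f x + g x); have := sqr_ge0 (f x);
  have := sqr_ge0 (g x); rewrite /= ler_norml sqrrB sqrrD; lra.
Qed.

(** The integral of (f - a)^2 is nonnegative for every a; the mean of f is the optimal choice. *)
Lemma Rint_jensen (f : V -> R) : measurable_fun setT f -> integ nu (fun x => f x ^+ 2) ->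
  (\int[nu]_x f x) ^+ 2 <= m * \int[nu]_x f x ^+ 2.
Proof.
move=> mf f2; have f1 := integ_sqr mf f2.
have key a : 0 <= \int[nu]_x f x ^+ 2 - 2 * a * \int[nu]_x f x + a ^+ 2 * m.
  rewrite -RintZl// -RintB//; last exact: integZl.
  rewrite -RintZl; last exact: integ_cst.
  rewrite -RintD; [|by apply: integB => //; exact: integZl|by apply: integZl; exact: integ_cst].
  apply: Rintegral_ge0 => x _; have := sqr_ge0 (f x - a).
  by rewrite sqrrB; lra.
set i := \int[nu]_x f x in key *; set i2 := \int[nu]_x _ in key *.
have i2_ge0 : 0 <= i2 by apply: Rintegral_ge0 => x _; exact: sqr_ge0.
(* For total mass 0 there is no mean; if the integral of f were not 0, the value of a chosen here
   would make the quadratic expression negative. *)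
have [m0|m0] := eqVneq m 0.
  rewrite m0 mul0r; have [->|i0] := eqVneq i 0; first by rewrite expr0n.
  have := key ((i2 + 1) / i); rewrite m0 mulr0 addr0 -mulrA divfK//; lra.
have := key (i / m).
have -> : i2 - 2 * (i / m) * i + (i / m) ^+ 2 * m = (m * i2 - i ^+ 2) / m by field.
by rewrite pmulr_lge0 ?subr_ge0// invr_gt0 lt_neqAle eq_sym m0.
Qed.

Lemma integ_prod_sections (f : V * T -> R) M : measurable_fun setT f ->
  (forall x, integ P (fun w => f (x, w))) ->
  (forall x, \int[P]_w `|f (x, w)| <= M) -> integ (nu \x P)%E f.
Proof.
move=> mf iP hM; apply/(@integrable12ltyP _ _ _ _ _ nu P (EFin \o f)).
  exact/measurable_EFinP.
apply: le_lt_trans (_ : (\int[nu]_x M%:E < +oo)%E).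
  apply: ge0_le_integral => //.
  - by move=> x _; apply: integral_ge0 => w _; exact: abse_ge0.
  - apply: (measurable_fun_fubini_tonelli_F (m2 := P) (abse \o (EFin \o f))) => //=.
    by apply: measurableT_comp => //; exact/measurable_EFinP.
  - move=> x _; have := RintE (integ_norm (iP x)).
    by under eq_integral do rewrite -abse_EFin; move=> ->; rewrite lee_fin.
rewrite integral_cst//; apply: lte_mul_pinfty => //.
  by rewrite lee_fin; apply: le_trans (hM point); apply: Rintegral_ge0.
by rewrite ltey_eq fin_num_measure.
Qed.

Section OneFamily.
Variables (M : R) (F : V -> T -> R).
Hypothesis hF : L2fam M F.

Let mF1 x : measurable_fun setT (F x). Proof. by case: hF => _ /(_ x)[]. Qed.

Let mF2 w : measurable_fun setT (F ^~ w).
Proof. by case: hF => mF _ _; exact: (measurableT_comp mF (pair2_measurable w)). Qed.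

Let mF21 : measurable_fun [set: V * T] (fun z => F z.1 z.2). Proof. by case: hF. Qed.

Lemma L2fam_mean W K : L2bnd K W ->
  [/\ integ nu (fun x => \int[P]_w (F x w * W w)), integ P (fun w => (\int[nu]_x F x w) * W w) &
   \int[P]_w ((\int[nu]_x F x w) * W w) = \int[nu]_x \int[P]_w (F x w * W w)].
Proof.
move=> [mW W2 WK]; case: hF => _ hx hw.
pose f (z : V * T) := F z.1 z.2 * W z.2.
have mf : measurable_fun setT f.
  by apply: measurable_funM => //; exact: (measurableT_comp mW).
have if1 x : integ P (fun w => F x w * W w).
  by case: (hx x) => m1 i1 _; exact: integ_mul.
have iprod : integ (nu \x P)%E f.
  apply: (integ_prod_sections (M := M + K) mf if1) => x.
  case: (hx x) => m1 i1 h1.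
  apply: (le_trans (y := \int[P]_w (F x w ^+ 2 + W w ^+ 2))); last by rewrite RintD// lerD.
  apply: le_Rint; [exact: (integ_norm (if1 x))|exact: integD|move=> w].
  by have := sqr_ge0 (F x w - W w); have := sqr_ge0 (F x w + W w); have := sqr_ge0 (F x w);
    have := sqr_ge0 (W w); rewrite /f /= ler_norml sqrrB sqrrD; lra.
have [r1 e1] := RFubini1 iprod; have [r2 e2] := RFubini2 iprod.
have e w : \int[nu]_x f (x, w) = (\int[nu]_x F x w) * W w.
  rewrite mulrC -RintZl; last by apply: integ_sqr.
  by apply: eq_Rint => x; rewrite mulrC.
split; first exact: r1.
- by move: r2; congr (integ _ _); apply/funext => w; rewrite -e.
- by rewrite -(eq_Rint _ e) e2 -e1.
Qed.

Lemma L2fam_int : L2bnd (m * (m * M)) (fun w => \int[nu]_x F x w).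
Proof.
case: hF => _ hx hw.
pose f (z : V * T) := F z.1 z.2 ^+ 2.
have mf : measurable_fun setT f by exact: measurable_funX.
have iprod : integ (nu \x P)%E f.
  apply: (integ_prod_sections (M := M) mf) => x; case: (hx x) => // m1 i1 h1.
  by apply: le_trans h1; rewrite le_eqVlt; apply/orP; left; apply/eqP; apply: eq_Rint => w;
    rewrite ger0_norm ?sqr_ge0.
have [r1 e1] := RFubini1 iprod; have [r2 e2] := RFubini2 iprod.
have mI : measurable_fun setT (fun w => \int[nu]_x F x w).
  apply: (measurable_Rint nu (f := fun z : T * V => F z.2 z.1)).
  exact: (measurableT_comp mF21 (@measurable_swap _ _ _ _)).
have le w : (\int[nu]_x F x w) ^+ 2 <= m * \int[nu]_x f (x, w) by exact: Rint_jensen.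
have i2 : integ P (fun w => (\int[nu]_x F x w) ^+ 2).
  apply: (integ_le _ _ (integZl m r2)); first exact: measurable_funX.
  by move=> w; rewrite ger0_norm ?sqr_ge0.
split => //; apply: le_trans (le_Rint i2 (integZl m r2) le) _.
rewrite RintZl// ler_wpM2l// e2 -e1.
apply: (le_trans (y := \int[nu]_x M)).
  by apply: le_Rint => // [|x]; [exact: integ_cst|case: (hx x)].
by rewrite mulrC -RintZl ?mulr1//; exact: integ_cst.
Qed.

End OneFamily.

End L2Families.

(** * Integration by parts for the Hermite integral *)

Section TaylorShift.
Context {R : realType}.
Variables (p : {poly R}) (c r : R).

(** Separates u from the pair c, r. With c = C(x - y) and r a residual, integration over y produces
    a polynomial in u whose coefficients depend on the residuals only. *)
Lemma horner_shiftE (u : R) :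
  p.[c * u + r] = \sum_(i < size p) c ^+ i * p^`N(i).[r] * 'X^i.[u].
Proof.
rewrite addrC nderiv_taylor; last exact: mulrC.
by apply: eq_bigr => i _; rewrite hornerXn exprMn; ring.
Qed.

Lemma horner_deriv_shiftE (u : R) :
  c * p^`().[c * u + r] = \sum_(i < size p) c ^+ i * p^`N(i).[r] * ('X^i)^`().[u].
Proof.
pose Q : {poly R} := \sum_(i < size p) (c ^+ i * p^`N(i).[r]) *: 'X^i.
have QE : (fun v : R => p.[c * v + r]) = horner Q.
  apply/funext => v; rewrite horner_shiftE horner_sum.
  by apply: eq_bigr => i _; rewrite hornerZ.
have h1 := is_derive_shifted p c r u; rewrite QE in h1.
have h2 := is_derive_poly Q u.
rewrite -(@derive_val _ _ _ _ _ _ _ h1) (@derive_val _ _ _ _ _ _ _ h2).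
rewrite /Q raddf_sum horner_sum; apply: eq_bigr => i _.
by rewrite /= derivZ hornerZ.
Qed.

End TaylorShift.

Section Chaos.
Context {R : realType} d (T : measurableType d) (P : probability T R) (n : nat).
Variables (B : 'rV[R]_n -> T -> R) (C : 'rV[R]_n -> R).
Hypothesis gB : centered_gaussian_field P B.
Hypothesis CB : forall x y, \int[P]_w (B x w * B y w) = C (x - y).
Hypothesis C0 : C 0 = 1.
Hypothesis cB : forall w, continuous (fun x => B x w).
Variable nu : {finite_measure set 'rV[R]_n -> \bar R}.
Hypothesis inu : forall g : 'rV[R]_n -> R, continuous g -> integ nu g.
Local Notation He := (@hermite R).
Local Notation V := ('rV[R]_n).
Local Notation N := (normal_prob (0 : R) 1).

Lemma measurable_cov : measurable_fun setT C.
Proof.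
have h : measurable_fun [set: V * V] (fun p => (fun y _ => C (0 - y)) p.1 p.2).
  apply: (@measurable_caratheodory_grid _ _ _ _ (fun y _ => C (0 - y))) => // x _.
  exact: (cov_grid_cvg gB CB C0 cB).
have -> : C = (fun p : V * V => C (0 - p.1)) \o (fun x => (x, x)).
  by apply/funext => x; rewrite /= sub0r (cov_sym CB).
by apply: measurableT_comp => //; exact: measurable_fun_pair.
Qed.

Lemma measurable_subV dX (X : measurableType dX) (f g : X -> V) : measurable_fun setT f ->
  measurable_fun setT g -> measurable_fun setT (fun z => f z - g z).
Proof.
move=> mf mg; apply: measurable_fun_rV => i; under eq_fun do rewrite !mxE.
by apply: measurable_funB; [apply: (measurableT_comp (measurable_coord i) mf)|
  apply: (measurableT_comp (measurable_coord i) mg)].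
Qed.

Lemma measurable_covB dX (X : measurableType dX) (f g : X -> V) : measurable_fun setT f ->
  measurable_fun setT g -> measurable_fun setT (fun z => C (f z - g z)).
Proof. by move=> mf mg; apply: (measurableT_comp measurable_cov); exact: measurable_subV. Qed.

Lemma measurable_field_joint dX (X : measurableType dX) (f : X -> V) (g : X -> T) :
  measurable_fun setT f -> measurable_fun setT g -> measurable_fun setT (fun z => B (f z) (g z)).
Proof.
move=> mf mg.
have h := measurable_caratheodory cB (fun x => @field_measurable _ _ _ _ _ _ gB x).
exact: (measurableT_comp h (measurable_fun_pair mf mg)).
Qed.

Lemma measurable_poly_field dX (X : measurableType dX) (p : {poly R}) (f : X -> V) (g : X -> T) :
  measurable_fun setT f -> measurable_fun setT g ->
  measurable_fun setT (fun z => p.[B (f z) (g z)]).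
Proof.
move=> mf mg; have mp : measurable_fun setT (horner p) by exact: measurable_poly.
exact: (measurableT_comp mp (measurable_field_joint mf mg)).
Qed.

Lemma continuous_field (g : R -> R) w : continuous g -> continuous (fun x => g (B x w)).
Proof. by move=> cg x; apply: (continuous_comp (cB (x := x)) (cg _)). Qed.

Lemma integ_bnd_field (f : V -> R) (g : R -> R) w : measurable_fun setT f -> continuous g ->
  (forall x, `|f x| <= g (B x w)) -> integ nu f.
Proof.
move=> mf cg h; apply: (integ_le mf h (inu _)).
exact: continuous_field.
Qed.

Lemma integ_poly_field (p : {poly R}) w : integ nu (fun x => p.[B x w]).
Proof. by apply: inu; apply: (continuous_field (g := horner p)); exact: continuous_horner. Qed.

Lemma L2fam_poly (p : {poly R}) : L2fam P nu (\int[N]_u p.[u] ^+ 2) (fun x w => p.[B x w]).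
Proof.
split.
- exact: measurable_poly_field.
- move=> x; have mp : measurable_fun setT (horner p) by exact: measurable_poly.
  have pp : polyb (fun u => p.[u] ^+ 2) by apply: polybM; exact: polyb_horner.
  have [i e] := field_polyb gB CB C0 x (measurable_funX 2 mp) pp.
  by split; [exact: (measurableT_comp mp (field_measurable gB x))|exact: i|by rewrite e].
- move=> w; have := integ_poly_field (p ^+ 2) w.
  by congr (integ _ _); apply/funext => x; rewrite horner_exp.
Qed.

Section PairFamily.
Variables (k : nat) (s : R).

(* [pairG] is the variable G of the header divided by q, for k = q - 1 and s = 0; the choice
   s = k! centres it. *)
Definition pairA x y w : R := C (x - y) * ((He k).[B x w] * (He k).[B y w]) - s * C (x - y) ^+ k.+1.
Definition pairg x w : R := \int[nu]_y pairA x y w.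
Definition pairG w : R := \int[nu]_x pairg x w.

Lemma measurable_pairA dX (X : measurableType dX) (f g : X -> V) (h : X -> T) :
  measurable_fun setT f -> measurable_fun setT g -> measurable_fun setT h ->
  measurable_fun setT (fun z => pairA (f z) (g z) (h z)).
Proof.
move=> mf mg mh; apply: measurable_funB.
  apply: measurable_funM; first exact: measurable_covB.
  by apply: measurable_funM; exact: measurable_poly_field.
by apply: measurable_funM => //; apply: measurable_funX; exact: measurable_covB.
Qed.

Lemma cov_pow_le1 x m : `|C x ^+ m| <= 1.
Proof. by rewrite normrX exprn_ile1// (cov_le1 gB CB C0). Qed.

Lemma pairA_le x y w : `|pairA x y w| <= `|(He k).[B x w]| * `|(He k).[B y w]| + `|s|.
Proof.
rewrite (le_trans (ler_normB _ _))// !normrM lerD//.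
  by rewrite ler_piMl ?mulr_ge0// (cov_le1 gB CB C0).
by rewrite ler_piMr// cov_pow_le1.
Qed.

(** From (ab + s)^2 <= 2 a^2 b^2 + 2 s^2 <= 2 a^4 + 2 b^4 + 2 s^2, with equal fourth moments at the
    two points; the bound is thus uniform in them. *)
Definition pairM : R := 4 * \int[N]_u (He k).[u] ^+ 4 + 2 * s ^+ 2.

Lemma integ_poly4 x : integ P (fun w => (He k).[B x w] ^+ 4) /\
  \int[P]_w (He k).[B x w] ^+ 4 = \int[N]_u (He k).[u] ^+ 4.
Proof.
have mp : measurable_fun setT (horner (He k)) by exact: measurable_poly.
apply: (field_polyb gB CB C0 x (g := fun u => (He k).[u] ^+ 4)).
  exact: measurable_funX.
by do 3![apply: polybM; first exact: polyb_horner]; exact: polyb_horner.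
Qed.

Lemma pairA_L2 x y : L2bnd P pairM (pairA x y).
Proof.
have mA : measurable_fun setT (pairA x y) by exact: measurable_pairA.
have [ix ex] := integ_poly4 x; have [iy ey] := integ_poly4 y.
pose g w : R := 2 * (He k).[B x w] ^+ 4 + 2 * (He k).[B y w] ^+ 4 + 2 * s ^+ 2.
have ig0 : integ P (fun w => 2 * (He k).[B x w] ^+ 4 + 2 * (He k).[B y w] ^+ 4).
  by apply: integD; exact: integZl.
have ig : integ P g by apply: integD => //; exact: integ_cst.
have le w : pairA x y w ^+ 2 <= g w.
  have := pairA_le x y w; rewrite /g.
  set a := (He k).[B x w]; set b := (He k).[B y w]; set t := pairA x y w => h.
  have h2 : t ^+ 2 <= (`|a| * `|b| + `|s|) ^+ 2.
    by rewrite -[t ^+ 2]real_normK ?num_real// lerXn2r ?nnegrE// addr_ge0// mulr_ge0.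
  have e m (z : R) : `|z| ^+ (m * 2) = z ^+ (m * 2).
    by rewrite mulnC !exprM real_normK ?num_real.
  have -> : a ^+ 4 = `|a| ^+ 4 by rewrite (e 2%N).
  have -> : b ^+ 4 = `|b| ^+ 4 by rewrite (e 2%N).
  have -> : s ^+ 2 = `|s| ^+ 2 by rewrite (e 1%N).
  apply: (le_trans h2).
  have := sqr_ge0 (`|a| * `|b| - `|s|); have := sqr_ge0 (`|a| ^+ 2 - `|b| ^+ 2).
  have := sqr_ge0 (`|a| ^+ 2); have := sqr_ge0 (`|b| ^+ 2).
  nra.
have i2 : integ P (fun w => pairA x y w ^+ 2).
  by apply: (integ_le _ _ ig) => [|w]; [exact: measurable_funX|rewrite ger0_norm ?sqr_ge0].
split => //; apply: le_trans (le_Rint i2 ig le) _.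
rewrite RintD//; last exact: integ_cst.
rewrite RintD; [|exact: integZl|exact: integZl].
by rewrite (RintZl 2 ix) (RintZl 2 iy) ex ey Rint_probability_cst /pairM; lra.
Qed.

Lemma integ_pairA x w : integ nu (fun y => pairA x y w).
Proof.
apply: (@integ_bnd_field _ (fun u => `|(He k).[B x w]| * `|(He k).[u]| + `|s|) w).
- by apply: measurable_pairA => //; exact: measurable_cst.
- move=> u; apply: cvgD; last exact: cvg_cst.
  apply: cvgM; first exact: cvg_cst.
  by apply: cvg_norm; exact: continuous_horner.
- by move=> y; exact: pairA_le.
Qed.

Lemma L2fam_pairA x : L2fam P nu pairM (pairA x).
Proof.
split.
- by apply: measurable_pairA => //; exact: measurable_cst.
- by move=> y; exact: pairA_L2.
- move=> w.
  apply: (@integ_bnd_field _ (fun u => (`|(He k).[B x w]| * `|(He k).[u]| + `|s|) ^+ 2) w).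
  + by apply: measurable_funX; apply: measurable_pairA => //; exact: measurable_cst.
  + move=> u; apply: (@cvg_comp _ _ _ _ (fun u : R => u ^+ 2)); last exact: exprn_continuous.
    apply: cvgD; last exact: cvg_cst.
    apply: cvgM; first exact: cvg_cst.
    by apply: cvg_norm; exact: continuous_horner.
  + by move=> y; rewrite normrX lerXn2r ?nnegrE ?addr_ge0 ?mulr_ge0// pairA_le.
Qed.

Local Notation m := (\int[nu]_x (1 : R)).

Lemma measurable_pairg dX (X : measurableType dX) (f : X -> V) (h : X -> T) :
  measurable_fun setT f -> measurable_fun setT h ->
  measurable_fun setT (fun z => pairg (f z) (h z)).
Proof.
move=> mf mh; apply: (measurable_Rint nu (f := fun z : X * V => pairA (f z.1) z.2 (h z.1))).
by apply: measurable_pairA => //; apply: measurableT_comp.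
Qed.

Lemma L2fam_pairg : L2fam P nu (m * (m * pairM)) pairg.
Proof.
split.
- exact: measurable_pairg.
- by move=> x; exact: L2fam_int (L2fam_pairA x).
- move=> w; pose I := \int[nu]_y `|(He k).[B y w]|.
  have iI : integ nu (fun y => `|(He k).[B y w]|) by apply: integ_norm; exact: integ_poly_field.
  apply: (@integ_bnd_field _ (fun u => (`|(He k).[u]| * I + `|s| * m) ^+ 2) w).
  + by apply: measurable_funX; apply: measurable_pairg => //; exact: measurable_cst.
  + move=> u; apply: (@cvg_comp _ _ _ _ (fun u : R => u ^+ 2)); last exact: exprn_continuous.
    apply: cvgD; last exact: cvg_cst.
    apply: cvgM; last exact: cvg_cst.
    by apply: cvg_norm; exact: continuous_horner.
  + move=> x; rewrite normrX lerXn2r ?nnegrE//.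
      by rewrite addr_ge0 ?mulr_ge0//; apply: Rintegral_ge0.
    apply: le_trans (norm_Rint (integ_pairA x w)) _.
    rewrite -!RintZl//; last exact: integ_cst.
    rewrite -RintD; [|exact: integZl|by apply: integZl; exact: integ_cst].
    apply: le_Rint; [by apply: integ_norm; exact: integ_pairA| |].
      by apply: integD; [exact: integZl|apply: integZl; exact: integ_cst].
    by move=> y; rewrite mulr1; exact: pairA_le.
Qed.

End PairFamily.
End Chaos.

Section FunctionalIBP.
Context {R : realType} d (T : measurableType d) (P : probability T R) (n : nat).
Variables (B : 'rV[R]_n -> T -> R) (C : 'rV[R]_n -> R).
Hypothesis gB : centered_gaussian_field P B.
Hypothesis CB : forall x y, \int[P]_w (B x w * B y w) = C (x - y).
Hypothesis C0 : C 0 = 1.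
Hypothesis cB : forall w, continuous (fun x => B x w).
Variable nu : {finite_measure set 'rV[R]_n -> \bar R}.
Hypothesis inu : forall g : 'rV[R]_n -> R, continuous g -> integ nu g.
Local Notation He := (@hermite R).
Local Notation V := ('rV[R]_n).

Definition herY k w : R := \int[nu]_x (He k).[B x w].

Lemma measurable_herY k : measurable_fun setT (herY k).
Proof. by case: (L2fam_int (L2fam_poly gB CB C0 cB inu (He k))). Qed.

(** [inu] covers continuous integrands, and C is only known to be measurable. The argument equals
    B_y + C(x - y) (u - B_x), whose square is at most 2 (B_y^2 + (u - B_x)^2), so a continuous
    function of B_y dominates. *)
Lemma integ_shifted x (p : {poly R}) i (u : R) w :
  integ nu (fun y => C (x - y) ^+ i * p.[C (x - y) * u + resid B C x y w]).
Proof.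
have [K [m hK]] := polyb_horner p.
have mC : measurable_fun setT (fun y : V => C (x - y)).
  by apply: (measurable_covB gB CB C0 cB) => //; exact: measurable_cst.
have mp : measurable_fun setT (horner p) by exact: measurable_poly.
have mB : measurable_fun setT (fun y : V => B y w).
  by apply: (measurable_field_joint gB cB) => //; exact: measurable_cst.
have K0 : 0 <= K.
  by have := hK 0; rewrite expr0n addr0 expr1n mulr1; exact: le_trans.
apply: (@integ_bnd_field _ _ _ n B cB nu inu _
  (fun b => K * (1 + 2 * (b ^+ 2 + (u - B x w) ^+ 2)) ^+ m) w).
- apply: measurable_funM; first exact: measurable_funX.
  apply: (@measurableT_comp _ _ _ _ _ _ (horner p)) => //.
  apply: measurable_funD; first exact: measurable_funM.
  by rewrite /resid; apply: measurable_funB => //; exact: measurable_funM.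
- pose Q : {poly R} := K *: (1 + 2 *: ('X ^+ 2 + ((u - B x w) ^+ 2)%:P)) ^+ m.
  have -> : (fun b => K * (1 + 2 * (b ^+ 2 + (u - B x w) ^+ 2)) ^+ m) = horner Q.
    by apply/funext => b; rewrite /Q !hornerE.
  exact: continuous_horner.
- move=> y; rewrite normrM.
  have c1 := cov_le1 gB CB C0 (x - y).
  apply: (le_trans (y := `|p.[C (x - y) * u + resid B C x y w]|)).
    by rewrite ler_piMl// (cov_pow_le1 gB CB C0).
  apply: le_trans (hK _) _; rewrite ler_wpM2l// lerXn2r ?nnegrE//.
  + by rewrite addr_ge0// sqr_ge0.
  + by rewrite addr_ge0// mulr_ge0// addr_ge0 ?sqr_ge0.
  + have -> : C (x - y) * u + resid B C x y w = B y w + C (x - y) * (u - B x w).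
      by rewrite /resid; ring.
    have c2 : C (x - y) ^+ 2 <= 1 by rewrite -real_normK ?num_real// exprn_ile1.
    have : (C (x - y) * (u - B x w)) ^+ 2 <= (u - B x w) ^+ 2.
      by rewrite exprMn ler_piMl ?sqr_ge0.
    have := sqr_ge0 (B y w - C (x - y) * (u - B x w)).
    by rewrite sqrrB sqrrD; lra.
Qed.

Section ShiftedIntegrals.
Variables (x : V) (p : {poly R}).
Local Notation S := (g_sigma_algebraType (cylinder (resid B C x))).
Local Notation RS := (measurableTypeR R * S)%type.

(* [shiftP w] is the polynomial u |-> \int p(C(x - y) u + resid x y w) dy. *)
Definition shiftK i w : R := \int[nu]_y (C (x - y) ^+ i * p^`N(i).[resid B C x y w]).

Definition shiftP w : {poly R} := \sum_(i < size p) shiftK i w *: 'X^i.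

(** The sigma-algebra is the one generated by the residuals: this is the input that [field_ibp]
    needs. Joint measurability in y and w again comes from the grid. *)
Lemma measurable_shiftK i : measurable_fun [set: S] (shiftK i).
Proof.
apply: (measurable_Rint nu (f := fun z : S * V => C (x - z.2) ^+ i * p^`N(i).[resid B C x z.2 z.1])).
have mr : measurable_fun [set: V * S] (fun z => resid B C x z.1 z.2).
  apply: measurable_caratheodory_grid => [y w|y]; first exact: (resid_grid_cvg gB CB C0 cB).
  exact: measurable_ZS.
have mp : measurable_fun setT (horner p^`N(i)) by exact: measurable_poly.
apply: measurable_funM.
  by apply: measurable_funX; apply: (measurable_covB gB CB C0 cB).
apply: (@measurableT_comp _ _ _ _ _ _ (horner p^`N(i))) => //.
exact: (measurableT_comp mr (@measurable_swap _ _ _ _)).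
Qed.

(** [D] stands for the identity and for the derivative. *)
Lemma measurable_shiftP (D : {poly R} -> {poly R}) :
  (forall w, D (shiftP w) = \sum_(i < size p) shiftK i w *: D 'X^i) ->
  measurable_fun [set: RS] (fun z => (D (shiftP z.2)).[z.1 : R]).
Proof.
move=> hD; under eq_fun do rewrite hD horner_sum.
apply: measurable_sum => i; under eq_fun do rewrite hornerZ.
have mp : measurable_fun setT (horner (D 'X^i)) by exact: measurable_poly.
apply: measurable_funM.
  exact: (measurableT_comp (measurable_shiftK i) (@measurable_snd _ _ (measurableTypeR R) _)).
by apply: (@measurableT_comp _ _ _ _ _ _ (horner (D 'X^i))) => //; exact: measurable_fst.
Qed.

Lemma integ_shiftK i w : integ nu (fun y => C (x - y) ^+ i * p^`N(i).[resid B C x y w]).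
Proof.
have := integ_shifted x p^`N(i) i 0 w.
by congr (integ _ _); apply/funext => y; rewrite mulr0 add0r.
Qed.

Lemma horner_shiftP (u : R) w :
  (shiftP w).[u] = \int[nu]_y p.[C (x - y) * u + resid B C x y w].
Proof.
rewrite /shiftP horner_sum; under eq_bigr do rewrite hornerZ mulrC -RintZl ?integ_shiftK//.
rewrite -Rint_sum; last by move=> i; apply: integZl; exact: integ_shiftK.
apply: eq_Rint => y; rewrite horner_shiftE.
by apply: eq_bigr => i _; rewrite mulrC.
Qed.

Lemma horner_deriv_shiftP (u : R) w : (shiftP w)^`().[u] =
  \int[nu]_y (C (x - y) * p^`().[C (x - y) * u + resid B C x y w]).
Proof.
rewrite /shiftP raddf_sum horner_sum /=.
under eq_bigr do rewrite derivZ hornerZ mulrC -RintZl ?integ_shiftK//.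
rewrite -Rint_sum; last by move=> i; apply: integZl; exact: integ_shiftK.
apply: eq_Rint => y; rewrite horner_deriv_shiftE.
by apply: eq_bigr => i _; rewrite mulrC.
Qed.

End ShiftedIntegrals.
Lemma integ_mul_bnd (f g : T -> R) K : integ P f -> measurable_fun setT g ->
  (forall w, `|g w| <= K) -> integ P (fun w => f w * g w).
Proof.
move=> hf mg hK; apply: (integ_le _ _ (integZl K (integ_norm hf))).
  by apply: measurable_funM => //; exact: integ_meas hf.
by move=> w; rewrite normrM mulrC ler_wpM2r.
Qed.

Section StepIBP.
Variables (phi dphi : R -> R) (K1 K2 : R).
Hypothesis dphiE : forall u : R, is_derive u 1 phi (dphi u).
Hypothesis cdphi : continuous dphi.
Hypothesis bphi : forall u, `|phi u| <= K1.
Hypothesis bdphi : forall u, `|dphi u| <= K2.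

Let mphi : measurable_fun setT phi.
Proof. exact: continuous_measurable_fun (derive_continuous dphiE). Qed.

Let mdphi : measurable_fun setT dphi.
Proof. exact: continuous_measurable_fun. Qed.

Lemma measurable_phiY k : measurable_fun setT (fun w => phi (herY k w)).
Proof. by apply: (measurableT_comp mphi); exact: measurable_herY. Qed.

Lemma measurable_dphiY k : measurable_fun setT (fun w => dphi (herY k w)).
Proof. by apply: (measurableT_comp mdphi); exact: measurable_herY. Qed.

(** With the residuals frozen, Y is the polynomial [Q w] evaluated at B_x. The chain rule yields
    [Q'], that is the integral of C(x - y) (k+1) H_k(B_y) over y, and this times H_k(B_x) is (k+1)
    times [pairg]. *)
Lemma functional_ibp k x : \int[P]_w ((He k.+1).[B x w] * phi (herY k.+1 w)) =
  k.+1%:R * \int[P]_w (pairg B C nu k 0 x w * dphi (herY k.+1 w)).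
Proof.
pose Q w := shiftP x (He k.+1) w.
pose h (u : R) w := (He k).[u] * phi (Q w).[u].
pose h' (u : R) w := (He k)^`().[u] * phi (Q w).[u] + (He k).[u] * (dphi (Q w).[u] * (Q w)^`().[u]).
pose Y := herY k.+1.
have QY w : (Q w).[B x w] = Y w.
  by rewrite horner_shiftP; apply: eq_Rint => y; rewrite -field_resid.
have QdY w : (He k).[B x w] * (Q w)^`().[B x w] = k.+1%:R * pairg B C nu k 0 x w.
  rewrite horner_deriv_shiftP deriv_hermite -RintZl; last first.
    have := integ_shifted x (k.+1%:R *: He k) 1 (B x w) w.
    by congr (integ _ _); apply/funext => y; rewrite expr1.
  rewrite -RintZl; last exact: (integ_pairA gB CB C0 cB inu).
  by apply: eq_Rint => y; rewrite -field_resid /pairA hornerZ mul0r subr0; ring.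
have mphiY := measurable_phiY k.+1.
have mdphiY := measurable_dphiY k.+1.
have ip (p : {poly R}) : integ P (fun w => p.[B x w]).
  exact: allmom_integ (allmom_field gB CB C0 p x).
have iphi (p : {poly R}) : integ P (fun w => p.[B x w] * phi (Y w)).
  exact: integ_mul_bnd (ip p) mphiY (fun w => bphi _).
have ig : integ P (pairg B C nu k 0 x).
  by case: (L2fam_pairg gB CB C0 cB inu k 0) => _ /(_ x)[mg g2 _] _; exact: integ_sqr.
have igd : integ P (fun w => pairg B C nu k 0 x w * dphi (Y w)).
  exact: integ_mul_bnd ig mdphiY (fun w => bdphi _).
have h'E w : h' (B x w) w = (He k)^`().[B x w] * phi (Y w) +
    k.+1%:R * (pairg B C nu k 0 x w * dphi (Y w)).
  rewrite /h' QY; congr (_ + _); rewrite [k.+1%:R * _]mulrA -QdY; ring.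
have hE w : B x w * h (B x w) w = ('X * He k).[B x w] * phi (Y w).
  by rewrite /h QY hornerM hornerX mulrA.
have key : \int[P]_w (B x w * h (B x w) w) = \int[P]_w h' (B x w) w.
  have mQ := @measurable_shiftP x (He k.+1) id (fun=> erefl).
  have mQ' := @measurable_shiftP x (He k.+1) deriv.
  have mp (p : {poly R}) : measurable_fun setT (horner p) by exact: measurable_poly.
  apply: (@field_ibp _ _ _ _ _ _ _ gB CB C0 x h h').
  - apply: measurable_funM.
      by apply: (@measurableT_comp _ _ _ _ _ _ (horner (He k))) => //; exact: measurable_fst.
    by apply: (@measurableT_comp _ _ _ _ _ _ phi) => //.
  - apply: measurable_funD; apply: measurable_funM.
    + by apply: (@measurableT_comp _ _ _ _ _ _ (horner (He k)^`())) => //; exact: measurable_fst.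
    + by apply: (@measurableT_comp _ _ _ _ _ _ phi).
    + by apply: (@measurableT_comp _ _ _ _ _ _ (horner (He k))) => //; exact: measurable_fst.
    + apply: measurable_funM; first by apply: (@measurableT_comp _ _ _ _ _ _ dphi).
      apply: mQ' => w; rewrite raddf_sum /=; apply: eq_bigr => i _.
      by rewrite derivZ.
  - move=> w u.
    have d0 := is_derive_poly (He k) u.
    have d1 := @is_derive1_comp _ phi (horner (Q w)) u _ _ (dphiE _) (is_derive_poly (Q w) u).
    apply: is_derive_eq (is_deriveM d0 d1) _.
    by rewrite /GRing.scale /h' /=; ring.
  - move=> w u; apply: cvgD; apply: cvgM; try exact: continuous_horner.
    + by apply: continuous_comp; [exact: continuous_horner|exact: (derive_continuous dphiE)].
    + apply: cvgM; last exact: continuous_horner.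
      by apply: continuous_comp; [exact: continuous_horner|exact: cdphi].
  - by move=> w; apply: polybM; [exact: polyb_horner|apply: (@polyb_bnd _ _ K1) => u; exact: bphi].
  - move=> w; apply: polybD; apply: polybM; try exact: polyb_horner.
      by apply: (@polyb_bnd _ _ K1) => u; exact: bphi.
    by apply: polybM; [apply: (@polyb_bnd _ _ K2) => u; exact: bdphi|exact: polyb_horner].
  - by have := iphi ('X * He k); congr (integ _ _); apply/funext => w; rewrite hE.
  - have := integD (iphi (He k)^`()) (integZl k.+1%:R igd).
    by congr (integ _ _); apply/funext => w; rewrite h'E.
move: key; rewrite (eq_Rint _ hE) (eq_Rint _ h'E) RintD//; last exact: integZl.
rewrite RintZl// => key.
(* H_(k+1) = X H_k - H_k', so the term in which the product rule differentiates H_k cancels and only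
   the derivative of phi remains. *)
transitivity (\int[P]_w (('X * He k).[B x w] * phi (Y w) - (He k)^`().[B x w] * phi (Y w))).
  by apply: eq_Rint => w; rewrite hermiteS deriv_hermite !hornerE -mulrBl.
by rewrite RintB// key addrC addKr.
Qed.

Lemma stein_ibp k : \int[P]_w (herY k.+1 w * phi (herY k.+1 w)) =
  k.+1%:R * \int[P]_w (pairG B C nu k 0 w * dphi (herY k.+1 w)).
Proof.
have bnd2 (f : R -> R) K (g : T -> R) : measurable_fun setT (fun w => f (g w)) ->
    (forall u, `|f u| <= K) -> L2bnd P (K ^+ 2) (fun w => f (g w)).
  move=> mf hK.
  have K0 : 0 <= K by exact: le_trans (hK 0).
  have le w : `|f (g w) ^+ 2| <= K ^+ 2 by rewrite normrX lerXn2r.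
  have i2 : integ P (fun w => f (g w) ^+ 2).
    by apply: (@integ_bnd _ _ _ _ _ (K ^+ 2)) => //; exact: measurable_funX.
  split => //; rewrite -[leRHS](Rint_probability_cst P).
  by apply: le_Rint => // [|w]; [exact: integ_cst|exact: le_trans (ler_norm _) (le w)].
have [_ _ ->] := L2fam_mean (L2fam_poly gB CB C0 cB inu (He k.+1))
  (bnd2 _ _ _ (measurable_phiY k.+1) bphi).
have [i1 _ ->] := L2fam_mean (L2fam_pairg gB CB C0 cB inu k 0)
  (bnd2 _ _ _ (measurable_dphiY k.+1) bdphi).
by rewrite -RintZl//; apply: eq_Rint => x; rewrite functional_ibp.
Qed.

End StepIBP.
End FunctionalIBP.

(** * Variance bound and change of variables *)

Section PartialIntegral.
Context {R : realType} dV (V : measurableType dV) (nu : {finite_measure set V -> \bar R}).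

(** The integrands of the variance bound are built from powers of C, and |C| <= 1; on finite
    measures boundedness makes all partial integrals and exchanges legitimate. *)
Definition bmeas dX (X : measurableType dX) (f : X -> R) :=
  measurable_fun setT f /\ exists M, forall z, `|f z| <= M.

Lemma bmeas_integ dX (X : measurableType dX) (mu : {finite_measure set X -> \bar R}) (f : X -> R) :
  bmeas f -> integ mu f.
Proof. by move=> [mf [M hM]]; exact: (@integ_bnd _ _ _ _ _ M). Qed.

Lemma bmeasD dX (X : measurableType dX) (f g : X -> R) : bmeas f -> bmeas g ->
  bmeas (fun z => f z + g z).
Proof.
move=> [mf [M hM]] [mg [L hL]]; split; first exact: measurable_funD.
by exists (M + L) => z; rewrite (le_trans (ler_normD _ _))// lerD.
Qed.

Lemma bmeasM dX (X : measurableType dX) (f g : X -> R) : bmeas f -> bmeas g ->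
  bmeas (fun z => f z * g z).
Proof.
move=> [mf [M hM]] [mg [L hL]]; split; first exact: measurable_funM.
by exists (M * L) => z; rewrite normrM ler_pM.
Qed.

Lemma bmeas_cst dX (X : measurableType dX) (k : R) : bmeas (fun _ : X => k).
Proof. by split; [exact: measurable_cst|exists `|k|]. Qed.

Lemma bmeas_sum dX (X : measurableType dX) m (f : 'I_m -> X -> R) : (forall i, bmeas (f i)) ->
  bmeas (fun z => \sum_(i < m) f i z).
Proof.
move=> h; split; first by apply: measurable_sum => i; case: (h i).
have /choice[M hM] : forall i, exists M, forall z, `|f i z| <= M by move=> i; case: (h i).
exists (\sum_(i < m) M i) => z; rewrite (le_trans (ler_norm_sum _ _ _))//.
exact: ler_sum.
Qed.

Definition pint dX (X : measurableType dX) (f : X * V -> R) (x : X) : R := \int[nu]_y f (x, y).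

Section OneStep.
Context dX (X : measurableType dX).
Implicit Types f g : X * V -> R.

Lemma bmeas_section f x : bmeas f -> bmeas (fun y => f (x, y)).
Proof.
move=> [mf [M hM]]; split; last by exists M.
exact: (measurableT_comp mf (pair1_measurable x)).
Qed.

Lemma bmeas_pint f : bmeas f -> bmeas (pint f).
Proof.
move=> bf; have [mf [M hM]] := bf; split; first exact: measurable_Rint.
exists (\int[nu]_y M) => x; have i := bmeas_integ nu (bmeas_section x bf).
rewrite (le_trans (norm_Rint i))//.
by apply: le_Rint => //; [exact: integ_norm|exact: integ_cst].
Qed.

Lemma pintD f g : bmeas f -> bmeas g -> pint (fun z => f z + g z) = (fun x => pint f x + pint g x).
Proof.
move=> bf bg; apply/funext => x; rewrite /pint RintD//.
- exact: bmeas_integ (bmeas_section x bf).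
- exact: bmeas_integ (bmeas_section x bg).
Qed.

Lemma pintZ k f : bmeas f -> pint (fun z => k * f z) = (fun x => k * pint f x).
Proof.
move=> bf; apply/funext => x; rewrite /pint RintZl//.
exact: bmeas_integ (bmeas_section x bf).
Qed.

Lemma pint_sum m (f : 'I_m -> X * V -> R) : (forall i, bmeas (f i)) ->
  pint (fun z => \sum_(i < m) f i z) = (fun x => \sum_(i < m) pint (f i) x).
Proof.
move=> bf; apply/funext => x; rewrite /pint Rint_sum// => i.
exact: bmeas_integ (bmeas_section x (bf i)).
Qed.

Lemma pint_ge0 f : (forall z, 0 <= f z) -> forall x, 0 <= pint f x.
Proof. by move=> f0 x; apply: Rintegral_ge0. Qed.

Lemma EFin_pint f x : bmeas f -> (pint f x)%:E = (\int[nu]_y (f (x, y))%:E)%E.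
Proof. by move=> bf; rewrite RintE//; exact: bmeas_integ (bmeas_section x bf). Qed.

End OneStep.

Lemma pint_swap dX (X : measurableType dX) (f : X * V * V -> R) : bmeas f ->
  pint (pint (fun z => f (z.1.1, z.2, z.1.2))) = pint (pint f).
Proof.
move=> bf; apply/funext => x; rewrite /pint.
have [mf [M hM]] := bf.
have h : integ (nu \x nu)%E (fun z : V * V => f (x, z.2, z.1)).
  apply: (@integ_prod_bnd _ _ _ _ _ _ _ _ M) => //.
  apply: (measurableT_comp mf); apply: measurable_fun_pair => //.
  by apply: measurable_fun_pair => //; exact: measurable_cst.
exact: (RFubini h).
Qed.

(** The fourth point is innermost, which is the order in which the variance is opened and in which
    translations are later applied. *)
Definition int4 (f : V * V * V * V -> R) : R := \int[nu]_x pint (pint (pint f)) x.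

Lemma int4D f g : bmeas f -> bmeas g -> int4 (fun z => f z + g z) = int4 f + int4 g.
Proof.
move=> bf bg; rewrite /int4 pintD// pintD; [|exact: bmeas_pint|exact: bmeas_pint].
rewrite pintD; [|do 2!apply: bmeas_pint => //|do 2!apply: bmeas_pint => //].
by rewrite RintD//; apply: bmeas_integ; do 3!apply: bmeas_pint => //.
Qed.

Lemma int4Z k f : bmeas f -> int4 (fun z => k * f z) = k * int4 f.
Proof.
move=> bf; rewrite /int4 pintZ// pintZ; [|exact: bmeas_pint].
rewrite pintZ; [|do 2!apply: bmeas_pint => //].
by rewrite RintZl//; apply: bmeas_integ; do 3!apply: bmeas_pint => //.
Qed.

Lemma int4_sum m (f : 'I_m -> V * V * V * V -> R) : (forall i, bmeas (f i)) ->
  int4 (fun z => \sum_(i < m) f i z) = \sum_(i < m) int4 (f i).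
Proof.
move=> bf; rewrite /int4 pint_sum// pint_sum; [|by move=> i; exact: bmeas_pint].
rewrite pint_sum; [|by move=> i; do 2!apply: bmeas_pint => //].
by rewrite Rint_sum// => i; apply: bmeas_integ; do 3!apply: bmeas_pint => //.
Qed.

Lemma int4_swap f : bmeas f -> int4 (fun z => f (z.1.1, z.2, z.1.2)) = int4 f.
Proof. by move=> bf; rewrite /int4 pint_swap. Qed.

End PartialIntegral.

Section ChaosBounds.
Context {R : realType} d (T : measurableType d) (P : probability T R) (n : nat).
Variables (B : 'rV[R]_n -> T -> R) (C : 'rV[R]_n -> R).
Hypothesis gB : centered_gaussian_field P B.
Hypothesis CB : forall x y, \int[P]_w (B x w * B y w) = C (x - y).
Hypothesis C0 : C 0 = 1.
Hypothesis cB : forall w, continuous (fun x => B x w).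
Variable nu : {finite_measure set 'rV[R]_n -> \bar R}.
Hypothesis inu : forall g : 'rV[R]_n -> R, continuous g -> integ nu g.
Local Notation He := (@hermite R).
Local Notation V := ('rV[R]_n).

Lemma L2bnd_cst (k : R) : L2bnd P (k ^+ 2) (fun=> k).
Proof.
split; [exact: measurable_cst|exact: integ_cst|].
by rewrite Rint_probability_cst.
Qed.

Lemma herY_mean k : \int[P]_w herY B nu k.+1 w = 0.
Proof.
transitivity (\int[P]_w (herY B nu k.+1 w * 1)); first by apply: eq_Rint => w; rewrite mulr1.
have [_ _ ->] := L2fam_mean (L2fam_poly gB CB C0 cB inu (He k.+1)) (L2bnd_cst 1).
rewrite -[RHS](Rint_zero nu); apply: eq_Rint => x.
by under eq_Rint do rewrite mulr1; rewrite (hermite_mean gB CB C0).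
Qed.

Definition covint k : R := \int[nu]_x \int[nu]_y C (x - y) ^+ k.

Lemma bmeas_covB dX (X : measurableType dX) (f g : X -> V) m : measurable_fun setT f ->
  measurable_fun setT g -> bmeas (fun z => C (f z - g z) ^+ m).
Proof.
move=> mf mg; split; first by apply: measurable_funX; exact: (measurable_covB gB CB C0 cB).
by exists 1 => z; exact: (cov_pow_le1 gB CB C0).
Qed.

Lemma bmeas_norm_covB dX (X : measurableType dX) (f g : X -> V) m : measurable_fun setT f ->
  measurable_fun setT g -> bmeas (fun z => `|C (f z - g z)| ^+ m).
Proof.
move=> mf mg; split.
  apply: measurable_funX; apply: measurableT_comp => //.
  exact: (measurable_covB gB CB C0 cB).
by exists 1 => z; rewrite normrX normr_id -normrX; exact: (cov_pow_le1 gB CB C0).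
Qed.

Lemma integ_covint k x : integ nu (fun y => C (x - y) ^+ k).
Proof. by apply: bmeas_integ; apply: bmeas_covB => //; exact: measurable_cst. Qed.

Lemma integ_covint2 k : integ nu (fun x => \int[nu]_y C (x - y) ^+ k).
Proof.
apply: bmeas_integ; apply: (bmeas_pint nu (f := fun z : V * V => C (z.1 - z.2) ^+ k)).
exact: bmeas_covB.
Qed.

Lemma herY_var k : \int[P]_w herY B nu k w ^+ 2 = k`!%:R * covint k.
Proof.
have hF := L2fam_poly gB CB C0 cB inu (He k).
have hY := L2fam_int hF.
transitivity (\int[P]_w (herY B nu k w * herY B nu k w)).
  by apply: eq_Rint => w; rewrite expr2.
have [_ _ ->] := L2fam_mean hF hY.
rewrite /covint -RintZl; last exact: integ_covint2.
apply: eq_Rint => x; rewrite -RintZl; last exact: integ_covint.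
transitivity (\int[P]_w (herY B nu k w * (He k).[B x w])).
  by apply: eq_Rint => w; rewrite mulrC.
have hx : L2bnd P (\int[normal_prob 0 1]_u (He k).[u] ^+ 2) (fun w => (He k).[B x w]).
  by case: hF => _ /(_ x).
have [_ _ ->] := L2fam_mean hF hx.
apply: eq_Rint => y; rewrite -(hermite_cov gB CB C0).
by apply: eq_Rint => w; rewrite mulrC.
Qed.

Lemma herY_L2 k : exists M, L2bnd P M (herY B nu k).
Proof. by eexists; exact: L2fam_int (L2fam_poly gB CB C0 cB inu (He k)). Qed.

Lemma pairG_shift k s w : pairG B C nu k s w = pairG B C nu k 0 w - s * covint k.+1.
Proof.
have iA t x := integ_pairA gB CB C0 cB inu k t x w.
have ig t : integ nu (fun x => pairg B C nu k t x w).
  case: (L2fam_pairg gB CB C0 cB inu k t) => mg _ /(_ w); apply: integ_sqr.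
  exact: (measurableT_comp mg (pair2_measurable w)).
rewrite /pairG /covint -RintZl; last exact: integ_covint2.
rewrite -RintB; [|exact: ig|by apply: integZl; exact: integ_covint2].
apply: eq_Rint => x; rewrite /pairg -RintZl; last exact: integ_covint.
rewrite -RintB; [|exact: iA|by apply: integZl; exact: integ_covint].
by apply: eq_Rint => y; rewrite /pairA mul0r subr0.
Qed.

Section PairVariance.
Variables (k : nat) (K : R).
Hypothesis hK : forall x1 x2 x3 x4,
  `|mom P B k k k k x1 x2 x3 x4 - k`!%:R ^+ 2 * (C (x1 - x2) * C (x3 - x4)) ^+ k| <=
  K * \sum_(r < k) `|C (x1 - x2) * C (x3 - x4)| ^+ r *
    (`|C (x1 - x3) * C (x2 - x4)| ^+ (k - r) + `|C (x1 - x4) * C (x2 - x3)| ^+ (k - r)).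
Local Notation A := (pairA B C k k`!%:R).
Local Notation g := (pairg B C nu k k`!%:R).
Local Notation G := (pairG B C nu k k`!%:R).

(** The choice s = k! centres the integrands, by [hermite_cov]. The factor C12 C34 pulled out here
    shifts the exponents of [mom_bound] from 0, ..., k - 1 to 1, ..., k. *)
Lemma pairA_cov x1 x2 x3 x4 : \int[P]_w (A x1 x2 w * A x3 x4 w) = C (x1 - x2) * C (x3 - x4) *
  (mom P B k k k k x1 x2 x3 x4 - k`!%:R ^+ 2 * (C (x1 - x2) * C (x3 - x4)) ^+ k).
Proof.
set s : R := k`!%:R; set c12 := C (x1 - x2); set c34 := C (x3 - x4).
pose h x w := (He k).[B x w].
have am x : allmom P (h x) by exact: (allmom_field gB CB C0).
have i2 x y : integ P (fun w => h x w * h y w) := allmom_integ (allmomM (am x) (am y)).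
have i4 : integ P (fun w => h x1 w * (h x2 w * (h x3 w * h x4 w))).
  exact: allmom_integ (allmomM (am _) (allmomM (am _) (allmomM (am _) (am _)))).
transitivity (\int[P]_w (((c12 * c34) * (h x1 w * (h x2 w * (h x3 w * h x4 w))) +
    (- c12 * (s * c34 ^+ k.+1)) * (h x1 w * h x2 w)) +
    (- c34 * (s * c12 ^+ k.+1)) * (h x3 w * h x4 w) +
    s ^+ 2 * c12 ^+ k.+1 * c34 ^+ k.+1)).
  by apply: eq_Rint => w; rewrite /pairA -/c12 -/c34 -/s /h; ring.
rewrite RintD; [|by do 2![apply: integD; last exact: integZl]; exact: integZl|exact: integ_cst].
rewrite RintD; [|by apply: integD; exact: integZl|exact: integZl].
rewrite RintD; [|exact: integZl|exact: integZl].
rewrite (RintZl _ i4) (RintZl _ (i2 x1 x2)) (RintZl _ (i2 x3 x4)) Rint_probability_cst.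
rewrite !(hermite_cov gB CB C0) -/c12 -/c34 -/s /mom exprMn !exprS.
by rewrite /h; ring.
Qed.

(** The cycle 1-2-3-4: exponent a on the opposite edges 12 and 34, exponent b on 23 and 14. The
    other pairing, 13 with 24, is reached by exchanging the points 3 and 4. *)
Definition cycprod (a b : nat) (z : V * V * V * V) : R :=
  `|C (z.1.1.1 - z.1.1.2)| ^+ a * `|C (z.1.2 - z.2)| ^+ a *
  (`|C (z.1.1.1 - z.2)| ^+ b * `|C (z.1.1.2 - z.1.2)| ^+ b).

Lemma bmeas_cycprod a b : bmeas (cycprod a b).
Proof.
have m1 : measurable_fun [set: V * V * V * V] (fun z => z.1.1.1) by do 2?apply: measurableT_comp.
have m2 : measurable_fun [set: V * V * V * V] (fun z => z.1.1.2) by do 2?apply: measurableT_comp.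
have m3 : measurable_fun [set: V * V * V * V] (fun z => z.1.2) by do 2?apply: measurableT_comp.
have m4 : measurable_fun [set: V * V * V * V] (fun z => z.2) by exact: measurable_snd.
by apply: bmeasM; apply: bmeasM; exact: bmeas_norm_covB.
Qed.

Let swap (z : V * V * V * V) := (z.1.1, z.2, z.1.2).

Let bmeas_cycprod_swap a b : bmeas (fun z => cycprod a b (swap z)).
Proof.
have [m [M hM]] := bmeas_cycprod a b; split; last by exists M.
apply: (measurableT_comp m); apply: measurable_fun_pair; last exact: measurableT_comp.
by apply: measurable_fun_pair => //; exact: measurableT_comp.
Qed.

Let bnd (z : V * V * V * V) : R := \sum_(r < k)
  K * (cycprod r.+1 (k - r) z + cycprod r.+1 (k - r) (swap z)).

Let bmeas_sym a b : bmeas (fun z => cycprod a b z + cycprod a b (swap z)).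
Proof. by apply: bmeasD; [exact: bmeas_cycprod|exact: bmeas_cycprod_swap]. Qed.

Let bmeas_bnd : bmeas bnd.
Proof. by apply: bmeas_sum => r; apply: bmeasM; [exact: bmeas_cst|exact: bmeas_sym]. Qed.

Let pairA_cov_le x1 x2 x3 x4 : \int[P]_w (A x1 x2 w * A x3 x4 w) <= bnd (x1, x2, x3, x4).
Proof.
rewrite pairA_cov (le_trans (ler_norm _))// normrM.
apply: (le_trans (ler_wpM2l (normr_ge0 _) (hK _ _ _ _))).
rewrite /bnd /cycprod /= mulrCA !mulr_sumr le_eqVlt; apply/orP; left; apply/eqP.
apply: eq_bigr => r _; rewrite -[C (x4 - x3)](cov_sym CB) opprB !normrM !exprMn !exprS; ring.
Qed.

Let hfamg := L2fam_pairg gB CB C0 cB inu k k`!%:R.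
Let hfamA x := L2fam_pairA gB CB C0 cB inu k k`!%:R x.
Let hG := L2fam_int hfamg.
Let hA x y := pairA_L2 gB CB C0 cB k k`!%:R x y.

(** One factor G of the square is opened in x1 and x2 while the other acts as the L2 weight, then
    the roles are exchanged for x3 and x4. The constant 2 counts the two pairings, which have equal
    integrals by [int4_swap]. *)
Lemma pairG_var_le : \int[P]_w G w ^+ 2 <=
  (2 * K) * \sum_(r < k) int4 nu (cycprod r.+1 (k - r)).
Proof.
have b1 := bmeas_pint nu bmeas_bnd; have b2 := bmeas_pint nu b1; have b3 := bmeas_pint nu b2.
have -> : (2 * K) * \sum_(r < k) int4 nu (cycprod r.+1 (k - r)) = int4 nu bnd.
  rewrite /bnd int4_sum; last first.
    by move=> r; apply: bmeasM; [exact: bmeas_cst|exact: bmeas_sym].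
  rewrite mulr_sumr; apply: eq_bigr => r _; rewrite int4Z; last exact: bmeas_sym.
  rewrite int4D; [|exact: bmeas_cycprod|exact: bmeas_cycprod_swap].
  by rewrite int4_swap; [ring|exact: bmeas_cycprod].
rewrite (eq_Rint _ (fun w => expr2 _)).
have [i1 _ ->] := L2fam_mean hfamg hG.
apply: le_Rint => //; first exact: bmeas_integ.
move=> x1; have [i2 _ ->] := L2fam_mean (hfamA x1) hG.
apply: le_Rint => //; first exact: bmeas_integ (bmeas_section x1 b2).
move=> x2; rewrite (eq_Rint _ (fun w => mulrC _ _)).
have [i3 _ ->] := L2fam_mean hfamg (hA x1 x2).
apply: le_Rint => //; first exact: bmeas_integ (bmeas_section (x1, x2) b1).
move=> x3; have [i4 _ ->] := L2fam_mean (hfamA x3) (hA x1 x2).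
apply: le_Rint => //; first exact: bmeas_integ (bmeas_section (x1, x2, x3) bmeas_bnd).
by move=> x4; rewrite (eq_Rint _ (fun w => mulrC _ _)); exact: pairA_cov_le.
Qed.

End PairVariance.

(** phi is rescaled so as to act on Y rather than Y/s. The mean of G cancels the leading term of
    Stein's equation, leaving -(k+1)/s E[G phis'(Y)] with the centred G, and the square of an
    expectation is at most the second moment. *)
Lemma stein_bound k (f phi dphi : R -> R) (K1 K2 : R) (c : R) :
  (forall u : R, is_derive u 1 phi (dphi u)) -> continuous dphi ->
  (forall u, `|phi u| <= K1) -> (forall u, `|dphi u| <= K2) ->
  (forall u, dphi u - u * phi u = f u - c) ->
  let s2 := k.+1`!%:R * covint k.+1 in 0 < s2 ->
  (\int[P]_w f (herY B nu k.+1 w / Num.sqrt s2) - c) ^+ 2 <=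
  (K2 * k.+1%:R / s2) ^+ 2 * \int[P]_w pairG B C nu k k`!%:R w ^+ 2.
Proof.
move=> dphiE cdphi bphi bdphi fE s2 s0.
pose s := Num.sqrt s2; have s_gt0 : 0 < s by rewrite sqrtr_gt0.
have ss : s ^+ 2 = s2 by rewrite sqr_sqrtr// ltW.
have s_neq0 : s != 0 by rewrite gt_eqF.
pose Y := herY B nu k.+1; pose G := pairG B C nu k k`!%:R.
have [MY hY] := herY_L2 k.+1; have [mY iY2 _] := hY.
have iY : integ P Y by exact: integ_sqr.
have [mG iG2 _] : L2bnd P _ G := L2fam_int (L2fam_pairg gB CB C0 cB inu k k`!%:R).
have iG : integ P G by exact: integ_sqr.
pose phis u := phi (u / s); pose dphis u := dphi (u / s) / s.
have dphisE (u : R) : is_derive u 1 phis (dphis u).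
  have dl : is_derive u (1 : R) (fun v : R => v / s) s^-1.
    rewrite (_ : (fun v : R => v / s) = (fun v => s^-1 * v)); first exact: is_derive_linear.
    by apply/funext => v; rewrite mulrC.
  have h := @is_derive1_comp _ phi (fun v => v / s) u _ _ (dphiE _) dl.
  exact: h.
have cd : continuous (fun u : R => u / s).
  by move=> u; apply: cvgM; [exact: cvg_id|exact: cvg_cst].
have cdphis : continuous dphis.
  move=> u; apply: cvgM; last exact: cvg_cst.
  by apply: continuous_comp; [exact: cd|exact: cdphi].
have bphis u : `|phis u| <= K1 by exact: bphi.
have bdphis u : `|dphis u| <= K2 / s.
  by rewrite normrM normfV (gtr0_norm s_gt0) ler_pM2r ?invr_gt0.
have := stein_ibp gB CB C0 cB inu dphisE cdphis bphis bdphis k.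
rewrite -/Y => ibp.
have mphis : measurable_fun setT (fun w => phis (Y w)) by exact: (measurable_phiY gB CB C0 cB inu dphisE k.+1).
have mdphis : measurable_fun setT (fun w => dphis (Y w)) by exact: (measurable_dphiY gB CB C0 cB inu cdphis k.+1).
have idphi : integ P (fun w => s * dphis (Y w)).
  by apply: integZl; apply: (@integ_bnd _ _ _ _ _ (K2 / s)).
have iYphi : integ P (fun w => s^-1 * (Y w * phis (Y w))).
  by apply: integZl; exact: integ_mul_bnd iY mphis (fun w => bphis _).
have iGd : integ P (fun w => G w * dphis (Y w)).
  exact: integ_mul_bnd iG mdphis (fun w => bdphis _).
have e1 : \int[P]_w f (Y w / s) - c = \int[P]_w (s * dphis (Y w) - s^-1 * (Y w * phis (Y w))).
  have -> : \int[P]_w f (Y w / s) = \int[P]_w ((s * dphis (Y w) - s^-1 * (Y w * phis (Y w))) + c).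
    apply: eq_Rint => w; have := fE (Y w / s); rewrite -/(phis (Y w)).
    have -> : dphi (Y w / s) = s * dphis (Y w) by rewrite /dphis; field.
    by move=> h; apply/eqP; rewrite -subr_eq -h; apply/eqP; ring.
  rewrite RintD; [|exact: integB|exact: integ_cst].
  by rewrite Rint_probability_cst addrK.
have e2 : \int[P]_w f (Y w / s) - c = \int[P]_w (- (k.+1%:R / s) * (G w * dphis (Y w))).
  rewrite e1 RintB// (RintZl s^-1); last exact: integ_mul_bnd iY mphis (fun w => bphis _).
  rewrite ibp.
  have G0E w : pairG B C nu k 0 w = G w + k`!%:R * covint k.+1.
    by rewrite /G (pairG_shift k k`!%:R) subrK.
  have -> : \int[P]_w (pairG B C nu k 0 w * dphis (Y w)) =
      \int[P]_w (G w * dphis (Y w) + (k`!%:R * covint k.+1 / s) * (s * dphis (Y w))).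
    by apply: eq_Rint => w; rewrite G0E; field.
  rewrite RintD//; last exact: integZl.
  rewrite (RintZl _ idphi) (RintZl _ iGd).
  (* The mean split off from [pairG] is, after multiplication by k + 1, the variance of Y; this
     identity makes the two terms in [D] cancel. *)
  have hs : k.+1%:R * (k`!%:R * covint k.+1) = s ^+ 2.
    by rewrite ss /s2 factS natrM mulrA.
  set D := \int[P]_w (s * _); set GD := \int[P]_w (G w * _).
  have -> : D - s^-1 * (k.+1%:R * (GD + k`!%:R * covint k.+1 / s * D)) =
    D - s^-1 * k.+1%:R * GD - (k.+1%:R * (k`!%:R * covint k.+1)) / s ^+ 2 * D by field.
  by rewrite hs; field.
rewrite e2.
have K20 : 0 <= K2 by exact: le_trans (bdphi 0).
have bnd w : (- (k.+1%:R / s) * (G w * dphis (Y w))) ^+ 2 <= (K2 * k.+1%:R / s2) ^+ 2 * G w ^+ 2.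
  rewrite -exprMn -[leLHS]real_normK ?num_real// -[leRHS]real_normK ?num_real//.
  rewrite lerXn2r ?nnegrE// !normrM normrN normrM normfV (gtr0_norm s_gt0).
  rewrite (ger0_norm K20) !normr_nat normfV (gtr0_norm s0).
  have -> : K2 * k.+1%:R / s2 * `|G w| = k.+1%:R / s * (`|G w| * (K2 / s)).
    by rewrite -ss; field.
  apply: ler_wpM2l; first by rewrite divr_ge0// ltW.
  by apply: ler_wpM2l => //; rewrite ler_pM2r ?invr_gt0.
have mJ : measurable_fun setT (fun w => - (k.+1%:R / s) * (G w * dphis (Y w))).
  by apply: measurable_funM => //; exact: measurable_funM.
have iJ : integ P (fun w => (- (k.+1%:R / s) * (G w * dphis (Y w))) ^+ 2).
  apply: (integ_le _ _ (integZl ((K2 * k.+1%:R / s2) ^+ 2) iG2)); first exact: measurable_funX.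
  by move=> w; rewrite ger0_norm ?sqr_ge0.
apply: le_trans (Rint_jensen mJ iJ) _.
rewrite Rint_probability_cst mul1r -RintZl//.
by apply: le_Rint => //; exact: integZl.
Qed.

End ChaosBounds.

(** * From four points to the cycle integral of the hypothesis *)

Section CycleIntegral.
Context {R : realType} (n : nat).
Local Notation V := ('rV[R]_n).
Variables (C : V -> R) (Bt : set V).
Hypothesis mC : measurable_fun setT C.
Hypothesis C_sym : forall x, C (- x) = C x.
Hypothesis mBt : measurable Bt.
Variables a b : nat.

Definition cycint (x y z : V) : R := \1_Bt x * \1_Bt y * \1_Bt z *
  (`|C x| ^+ a * `|C y| ^+ a * `|C z| ^+ b * `|C (x + y + z)| ^+ b).

Lemma cycint_ge0 x y z : 0 <= cycint x y z.
Proof. by rewrite /cycint !mulr_ge0. Qed.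

Lemma measurable_cycint dX (X : measurableType dX) (f g h : X -> V) : measurable_fun setT f ->
  measurable_fun setT g -> measurable_fun setT h ->
  measurable_fun setT (fun z => (cycint (f z) (g z) (h z))%:E).
Proof.
have mD (k l : X -> V) : measurable_fun setT k -> measurable_fun setT l ->
    measurable_fun setT (fun z => k z + l z).
  move=> mk ml; apply: measurable_fun_rV => i; under eq_fun do rewrite !mxE.
  by apply: measurable_funD; [apply: (measurableT_comp (measurable_coord i) mk)|
    apply: (measurableT_comp (measurable_coord i) ml)].
have mI (k : X -> V) : measurable_fun setT k -> measurable_fun setT (fun z => \1_Bt (k z) : R).
  by move=> mk; apply: measurableT_comp mk; exact: measurable_indic.
have mL m (k : X -> V) : measurable_fun setT k -> measurable_fun setT (fun z => `|C (k z)| ^+ m).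
  move=> mk; apply: measurable_funX; apply: measurableT_comp => //.
  exact: (measurableT_comp mC).
move=> mf mg mh; apply/measurable_EFinP; apply: measurable_funM.
  by apply: measurable_funM; [apply: measurable_funM|]; exact: mI.
apply: measurable_funM; last by apply: mL; exact: (mD _ _ (mD _ _ mf mg) mh).
by apply: measurable_funM; [apply: measurable_funM|]; exact: mL.
Qed.

(** [lebRd] has z innermost, but here y comes first. Along x1, x2, x3, x4 the increments x2 - x1 and
    x4 - x3 carry exponent a, as x and y do, while the middle increment carries b, as z does; the
    innermost increment x4 - x3 is therefore y. *)
Definition cycint1 (x z : V) : \bar R := (\int[lebV n]_y (cycint x y z)%:E)%E.
Definition cycint2 (x : V) : \bar R := (\int[lebV n]_z cycint1 x z)%E.

Lemma cycint1_ge0 x z : (0 <= cycint1 x z)%E.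
Proof. by apply: integral_ge0 => y _; rewrite lee_fin cycint_ge0. Qed.

Lemma cycint2_ge0 x : (0 <= cycint2 x)%E.
Proof. by apply: integral_ge0 => y _; exact: cycint1_ge0. Qed.

Lemma measurable_cycint1 : measurable_fun [set: V * V] (fun p => cycint1 p.1 p.2).
Proof.
apply: (measurable_fun_fubini_tonelli_F (m2 := lebV n)
  (fun p : V * V * V => (cycint p.1.1 p.2 p.1.2)%:E)) => [|p].
  by apply: measurable_cycint => //; exact: measurableT_comp.
by rewrite lee_fin cycint_ge0.
Qed.

Lemma measurable_cycint2 : measurable_fun setT cycint2.
Proof.
apply: (measurable_fun_fubini_tonelli_F (m2 := lebV n) (fun p : V * V => cycint1 p.1 p.2)) => [|p].
  exact: measurable_cycint1.
exact: cycint1_ge0.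
Qed.

Lemma lebRd_cycint :
  lebRd (fun x => lebRd (fun y => lebRd (fun z => (cycint x y z)%:E))) =
  (\int[lebV n]_x cycint2 x)%E.
Proof.
have m2 dX (X : measurableType dX) (c : X) : measurable_fun [set: V] (fun=> c) by [].
have e1 x y : lebRd (fun z => (cycint x y z)%:E) = (\int[lebV n]_z (cycint x y z)%:E)%E.
  rewrite ge0_lebRdE//; first by apply: measurable_cycint => //; exact: measurable_cst.
  by move=> z; rewrite lee_fin cycint_ge0.
have e2 x : lebRd (fun y => lebRd (fun z => (cycint x y z)%:E)) = cycint2 x.
  rewrite (_ : (fun y => _) = (fun y => \int[lebV n]_z (cycint x y z)%:E)%E); last first.
    by apply/funext => y; exact: e1.
  rewrite ge0_lebRdE.
  - apply: (fubini_tonelli (m1 := lebV n) (m2 := lebV n) (fun p : V * V => (cycint x p.1 p.2)%:E)) => [|p].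
      by apply: measurable_cycint => //; exact: measurable_cst.
    by rewrite lee_fin cycint_ge0.
  - apply: (measurable_fun_fubini_tonelli_F (m2 := lebV n) (fun p : V * V => (cycint x p.1 p.2)%:E)) => [|p].
      by apply: measurable_cycint => //; exact: measurable_cst.
    by rewrite lee_fin cycint_ge0.
  - by move=> y; apply: integral_ge0 => z _; rewrite lee_fin cycint_ge0.
rewrite (_ : (fun x => _) = cycint2); last by apply/funext => x; exact: e2.
by rewrite ge0_lebRdE//; [exact: measurable_cycint2|exact: cycint2_ge0].
Qed.

Section Restricted.
Variable S : set V.
Hypothesis mS : measurable S.
Hypothesis finS : (lebV n S < +oo)%E.
Hypothesis SB : forall x y, S x -> S y -> Bt (x - y).
Local Notation nuS := (mfrestr mS finS).

Lemma restr_density A : measurable A -> nuS A = (\int[lebV n]_(x in A) (\1_S x)%:E)%E.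
Proof. by move=> mA; rewrite integral_indic// /mfrestr /mrestr setIC. Qed.

Lemma EFin_pint_restr dX (X : measurableType dX) (f : X * V -> R) x : bmeas f ->
  (forall z, 0 <= f z) -> (pint nuS f x)%:E = (\int[lebV n]_y (f (x, y) * \1_S y)%:E)%E.
Proof.
move=> bf f0; rewrite EFin_pint//.
have [mf _] := bmeas_section x bf.
have mI : measurable_fun setT (\1_S : V -> R) by exact: measurable_indic.
have I0 y : 0 <= \1_S y :> R by [].
have mf' : measurable_fun setT (fun y => (f (x, y))%:E) by exact/measurable_EFinP.
have f0' y : (0 <= (f (x, y))%:E)%E by rewrite lee_fin.
exact: (ge0_integral_density mI I0 restr_density mf' f0').
Qed.

Local Notation f := (cycprod C a b).
Hypothesis bf : bmeas f.

Let f_ge0 z : 0 <= f z. Proof. by rewrite /cycprod !mulr_ge0. Qed.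

Let b1 := bmeas_pint nuS bf.
Let b2 := bmeas_pint nuS b1.
Let b3 := bmeas_pint nuS b2.
Let p1_ge0 := pint_ge0 nuS f_ge0.
Let p2_ge0 := pint_ge0 nuS p1_ge0.
Let p3_ge0 := pint_ge0 nuS p2_ge0.

Let indS (x : V) (k : R) (e : \bar R) : 0 <= k -> (0 <= e)%E -> (S x -> (k%:E <= e)%E) ->
  ((k * \1_S x)%:E <= e)%E.
Proof.
move=> k0 e0 h; rewrite indicE; have [/set_mem xS|xS] := boolP (x \in S).
  by rewrite mulr1; exact: h.
by rewrite mulr0.
Qed.

Let shiftS (g : V -> R) (c : V) : bmeas g -> (forall x, 0 <= g x) ->
  (\int[lebV n]_y (g y * \1_S y)%:E = integral (lebV n) setT
    (fun y : V => (g (y + c)%R * \1_S (y + c)%R)%:E))%E /\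
  measurable_fun setT (fun y : V => (g (y + c)%R * \1_S (y + c)%R)%:E).
Proof.
move=> [mg _] g0.
have m : measurable_fun setT (fun y : V => (g y * \1_S y)%:E).
  by apply/measurable_EFinP; apply: measurable_funM => //; exact: measurable_indic.
split; last exact: (measurableT_comp m (measurable_addrV c)).
rewrite (ge0_integral_shiftV c (f := fun y => (g y * \1_S y)%:E))// => y.
by rewrite lee_fin mulr_ge0.
Qed.

(* Successive substitutions x4 = x3 + y, x3 = x2 + z, x2 = x1 + x, innermost first. *)
Let step3 x1 x2 x3 : S x1 -> S x2 -> S x3 ->
  ((pint nuS f (x1, x2, x3))%:E <= cycint1 (x2 - x1) (x3 - x2))%E.
Proof.
move=> S1 S2 S3; rewrite (EFin_pint_restr (x1, x2, x3) bf f_ge0).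
have [-> m] := shiftS x3 (bmeas_section (x1, x2, x3) bf) (fun y => f_ge0 _).
apply: ge0_le_integral => //.
- by move=> y _; rewrite lee_fin mulr_ge0.
- by apply: measurable_cycint => //; exact: measurable_cst.
- move=> y _; apply: indS => // [|S4]; first by rewrite lee_fin cycint_ge0.
  have By : Bt y by have := SB S4 S3; rewrite addrK.
  rewrite lee_fin /cycint !indicE !mem_set//; [|exact: SB|exact: SB].
  rewrite !mul1r /cycprod /= le_eqVlt; apply/orP; left; apply/eqP.
  rewrite -[C (x1 - x2)]C_sym -[C (x3 - _)]C_sym -[C (x1 - _)]C_sym -[C (x2 - x3)]C_sym !opprB.
  rewrite addrK.
  have -> : y + x3 - x1 = x2 - x1 + y + (x3 - x2).
    by apply/rowP => i; rewrite !mxE; ring.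
  by ring.
Qed.

Let step2 x1 x2 : S x1 -> S x2 -> ((pint nuS (pint nuS f) (x1, x2))%:E <= cycint2 (x2 - x1))%E.
Proof.
move=> S1 S2; rewrite (EFin_pint_restr (x1, x2) b1 p1_ge0).
have [-> m] := shiftS x2 (bmeas_section (x1, x2) b1) (fun y => p1_ge0 _).
apply: ge0_le_integral => //.
- by move=> y _; rewrite lee_fin mulr_ge0.
- exact: (measurableT_comp measurable_cycint1 (pair1_measurable _)).
- move=> z _; apply: indS => // [|S3]; first exact: cycint1_ge0.
  by have := step3 S1 S2 S3; rewrite addrK.
Qed.

Let step1 x1 : S x1 -> ((pint nuS (pint nuS (pint nuS f)) x1)%:E <= \int[lebV n]_x cycint2 x)%E.
Proof.
move=> S1; rewrite (EFin_pint_restr x1 b2 p2_ge0).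
have [-> m] := shiftS x1 (bmeas_section x1 b2) (fun y => p2_ge0 _).
apply: ge0_le_integral => //.
- by move=> y _; rewrite lee_fin mulr_ge0.
- exact: measurable_cycint2.
- move=> z _; apply: indS => // [|S2]; first exact: cycint2_ge0.
  by have := step2 S1 S2; rewrite addrK.
Qed.

(** After the three translations the bound no longer depends on x1, whose integration over S costs
    the volume. Positivity of [v] makes the right-hand side infinite when the cycle integral is. *)
Lemma int4_cycprod_le (v : R) : (lebV n S <= v%:E)%E -> 0 < v ->
  ((int4 nuS f)%:E <= v%:E *
    lebRd (fun x => lebRd (fun y => lebRd (fun z => (cycint x y z)%:E))))%E.
Proof.
move=> hv v0; rewrite lebRd_cycint.
have I0 : (0 <= \int[lebV n]_x cycint2 x)%E by apply: integral_ge0 => x _; exact: cycint2_ge0.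
rewrite /int4 -RintE; last exact: bmeas_integ.
have mI : measurable_fun setT (\1_S : V -> R) by exact: measurable_indic.
have iS y : 0 <= \1_S y :> R by [].
have mf' : measurable_fun setT (fun x => (pint nuS (pint nuS (pint nuS f)) x)%:E).
  by apply/measurable_EFinP; case: b3.
have f0' x : (0 <= (pint nuS (pint nuS (pint nuS f)) x)%:E)%E by rewrite lee_fin.
rewrite (ge0_integral_density mI iS restr_density mf' f0').
have : (forall x1, S x1 -> ((pint nuS (pint nuS (pint nuS f)) x1)%:E <= \int[lebV n]_x cycint2 x)%E).
  exact: step1.
case: (\int[lebV n]_x cycint2 x)%E I0 => [J|_ _|//]; last by rewrite gt0_muley ?lte_fin// leey.
rewrite lee_fin => J0 hJ.
apply: (@le_trans _ _ (\int[lebV n]_x (J%:E * (\1_S x)%:E))%E).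
  apply: ge0_le_integral => //.
  - by move=> x _; rewrite -EFinM lee_fin mulr_ge0.
  - apply: emeasurable_funM; apply/measurable_EFinP; first by case: b3.
    exact: measurable_indic.
  - by apply/measurable_EFinP; apply: measurable_funM => //; exact: measurable_indic.
  - by move=> x _; rewrite -!EFinM; apply: indS => // [|Sx]; [rewrite lee_fin mulr_ge0|
      rewrite lee_fin indicE mem_set// mulr1 -lee_fin; exact: hJ].
rewrite ge0_integralZl//; last by apply/measurable_EFinP; exact: measurable_indic.
by rewrite integral_indic// setIT muleC lee_wpmul2r// lee_fin.
Qed.

End Restricted.
End CycleIntegral.

(** * Reduction to continuous paths, and the limit *)

Section NullSets.
Context {R : realType} d (T : measurableType d) (mu : {measure set T -> \bar R}).
Variable N : set T.
Hypothesis mN : measurable N.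
Hypothesis N0 : mu N = 0%E.

Import HBNNSimple.

(** A simple minorant of f, set to 0 on N, is a minorant of g with the same integral. *)
Let ge0_integral_le (f g : T -> \bar R) : (forall x, 0 <= f x)%E -> (forall x, 0 <= g x)%E ->
  (forall x, ~ N x -> f x = g x) -> (\int[mu]_x f x <= \int[mu]_x g x)%E.
Proof.
move=> f0 g0 fg; rewrite !ge0_integralTE//; apply: ge_ereal_sup => _ [h hf <-].
have mNc := measurableC mN.
apply: (@le_trans _ _ (sintegral mu (proj_nnsfun h mNc))); last first.
  apply: ereal_sup_ubound; exists (proj_nnsfun h mNc) => // x.
  rewrite /proj_nnsfun /= mindicE; have [/set_mem Nx|_] := boolP (x \in ~` N).
    by rewrite mulr1 -fg.
  by rewrite mulr0.
rewrite -!integralT_nnsfun le_eqVlt; apply/orP; left; apply/eqP.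
apply: ae_eq_integral => //; [exact/measurable_EFinP|exact/measurable_EFinP|].
exists N; split => // x /=; apply: contra_notP => Nx _.
by rewrite /proj_nnsfun /= mindicE mem_set// mulr1.
Qed.

(* No measurability of [f] is assumed: [integral] is defined through simple minorants. *)
Lemma integral_eq_off_null (f g : T -> \bar R) : (forall x, ~ N x -> f x = g x) ->
  (\int[mu]_x f x = \int[mu]_x g x)%E.
Proof.
move=> fg.
have key (h k : T -> \bar R) : (forall x, 0 <= h x)%E -> (forall x, 0 <= k x)%E ->
    (forall x, ~ N x -> h x = k x) -> (\int[mu]_x h x = \int[mu]_x k x)%E.
  move=> h0 k0 hk; apply/eqP; rewrite eq_le !ge0_integral_le//.
  by move=> x Nx; rewrite hk.
rewrite integralE [RHS]integralE; congr (_ - _)%E; apply: key => // x Nx.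
  by rewrite !funeposE fg.
by rewrite !funenegE fg.
Qed.

End NullSets.

Lemma ae_null_set {R : realType} d (T : measurableType d) (P : probability T R) (Q : T -> Prop) :
  {ae P, forall w, Q w} -> exists N, [/\ measurable N, P N = 0%E & forall w, ~ N w -> Q w].
Proof.
move=> [N [mN PN h]]; exists N; split => // w Nw.
by apply: contra_notP Nw => nq; exact: h.
Qed.

Section ContinuousVersion.
Context {R : realType} d (T : measurableType d) (P : probability T R) (n : nat).
Variables (B : 'rV[R]_n -> T -> R) (N : set T).
Hypothesis mN : measurable N.
Hypothesis N0 : P N = 0%E.

Definition zeroed (x : 'rV[R]_n) (w : T) : R := \1_(~` N) w * B x w.

Lemma zeroedE x w : ~ N w -> zeroed x w = B x w.
Proof. by move=> Nw; rewrite /zeroed indicE mem_set// mul1r. Qed.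

Lemma zeroed_continuous : (forall w, ~ N w -> continuous (fun x => B x w)) ->
  forall w, continuous (fun x => zeroed x w).
Proof.
move=> cB w; have [Nw|Nw] := pselect (N w).
  rewrite (_ : (fun x => _) = (fun=> 0)); first by move=> x; exact: cst_continuous.
  by apply/funext => x; rewrite /zeroed indicE memNset ?mul0r//= => /(_ Nw).
rewrite (_ : (fun x => _) = (fun x => B x w)); first exact: cB.
by apply/funext => x; rewrite zeroedE.
Qed.

Lemma zeroed_field : centered_gaussian_field P B -> centered_gaussian_field P zeroed.
Proof.
move=> [mB gB]; have mB' x : measurable_fun setT (zeroed x).
  by apply: measurable_funM => //; apply: measurable_indic; exact: measurableC.
split=> // m xs a; have [s h] := gB m xs a; exists s => A mA; rewrite -h//.
have meas (F : 'I_m -> T -> R) : (forall i, measurable_fun setT (F i)) ->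
    measurable ((fun w => \sum_(i < m) a i * F i w) @^-1` A).
  move=> mF; rewrite -[X in measurable X]setTI.
  have : measurable_fun setT (fun w => \sum_(i < m) a i * F i w).
    by apply: measurable_sum => i; exact: measurable_funM.
  exact.
have PE (F : set T) : measurable F -> P F = (\int[P]_w (\1_F w)%:E)%E.
  by move=> mF; rewrite integral_indic// setIT.
rewrite !PE; [|exact: meas|exact: meas].
apply: (integral_eq_off_null mN N0) => w Nw; congr (_%:E).
rewrite !indicE; congr (_%:R); congr (nat_of_bool _).
have e : \sum_(i < m) a i * zeroed (xs i) w = \sum_(i < m) a i * B (xs i) w.
  by apply: eq_bigr => i _; rewrite zeroedE.
by apply/idP/idP => /set_mem /= h'; apply/mem_set => /=; [rewrite -e|rewrite e].
Qed.

End ContinuousVersion.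

Section CompactRestriction.
Context {R : realType} (n : nat) (S : set 'rV[R]_n) (N : R).
Local Notation V := ('rV[R]_n).
Hypothesis cS : compact S.
Hypothesis N0 : 0 <= N.
Hypothesis SN : S `<=` box n N.

Lemma lebV_compact_le : (lebV n S <= ((2 * N) ^+ n)%:E)%E.
Proof.
rewrite -lebV_box//; apply: le_measure => //; rewrite inE.
  exact: compact_measurable_rV.
exact: measurable_box.
Qed.

Lemma lebV_compact_fin : (lebV n S < +oo)%E.
Proof. by apply: le_lt_trans lebV_compact_le _; rewrite ltry. Qed.

(** A continuous function is bounded on a compact set. The first half provides the hypothesis [inu]
    of the sections above, the second turns the iterated integral in [Yqt] into [herY] for the
    restricted measure. *)
Lemma restr_continuous (g : V -> R) : continuous g ->
  integ (mfrestr (compact_measurable_rV cS) lebV_compact_fin) g /\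
  fine (lebRd (fun x => (\1_S x * g x)%:E)) =
  \int[mfrestr (compact_measurable_rV cS) lebV_compact_fin]_x g x.
Proof.
move=> cg; have mS := compact_measurable_rV cS.
have mg := continuous_measurable_rV cg.
have [M hM] : exists M, forall x, S x -> `|g x| <= M.
  have cgS : compact (g @` S).
    by apply: continuous_compact => //; exact: continuous_subspaceT.
  have [M [_ hM]] := compact_bounded cgS.
  exists (M + 1) => x Sx; apply: hM; first by rewrite ltrDl.
  by exists x.
have mI : measurable_fun setT (\1_S : V -> R) by exact: measurable_indic.
have bnd x : `|\1_S x * g x| <= `|M| * \1_(box n N) x.
  rewrite !indicE; have [/set_mem Sx|_] := boolP (x \in S).
    rewrite mul1r mem_set ?mulr1; last exact: SN.
    exact: le_trans (hM x Sx) (ler_norm M).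
  by rewrite mul0r normr0 mulr_ge0.
have [i e] := lebRd_bndE (measurable_funM mI mg) N0 bnd.
rewrite (_ : lebRd _ = (\int[lebV n]_x (\1_S x * g x)%:E)%E); last exact: e.
have i' : integ (lebV n) (fun x => g x * \1_S x).
  by move: i; congr (integ _ _); apply/funext => x; rewrite mulrC.
have I0 y : 0 <= \1_S y :> R by [].
have [r1 r2] := integ_density mI I0 (restr_density mS lebV_compact_fin) mg i'.
split; first exact: r1.
transitivity (\int[lebV n]_x (g x * \1_S x)); last exact: (esym r2).
by congr fine; apply: eq_integral => x _; rewrite mulrC.
Qed.

End CompactRestriction.

Section Dilation.
Context {R : realType} (n : nat).
Local Notation V := ('rV[R]_n).
Variable D : set V.
Hypothesis cD : compact D.

Lemma dilate_compact t : compact (dilate t D).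
Proof.
apply: continuous_compact => //; apply: continuous_subspaceT.
exact: scaler_continuous.
Qed.

Lemma dilate_box t N : 0 <= t -> D `<=` box n N -> dilate t D `<=` box n (t * N).
Proof.
by move=> t0 DN _ [x Dx <-] i; rewrite mxE normrM ger0_norm// ler_wpM2l// DN.
Qed.

Lemma measurable_calB t : measurable (calB D t).
Proof.
have me : measurable_fun setT (@enorm R n).
  have ms : measurable_fun setT (@Num.sqrt R).
    exact: continuous_measurable_fun (@sqrt_continuous R).
  have mq : measurable_fun setT (fun x : V => \sum_(i < n) x ord0 i ^+ 2).
    by apply: measurable_sum => i; apply: measurable_funX; exact: measurable_coord.
  exact: (measurableT_comp ms mq).
rewrite (_ : calB D t = setT `&` @enorm R n @^-1` `]-oo, ediam D * t]).
  exact: me.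
apply/seteqP; split => x /=; rewrite in_itv/=; first by [].
by case.
Qed.

Lemma enormZ (t : R) (x : V) : 0 <= t -> enorm (t *: x) = t * enorm x.
Proof.
move=> t0; rewrite /enorm -[X in X * _](ger0_norm t0) -sqrtr_sqr -sqrtrM ?sqr_ge0//.
by congr Num.sqrt; rewrite mulr_sumr; apply: eq_bigr => i _; rewrite mxE exprMn.
Qed.

Lemma dilate_calB t x y : 0 <= t -> dilate t D x -> dilate t D y -> calB D t (x - y).
Proof.
move=> t0 [u Du <-] [v Dv <-]; rewrite /calB /= -scalerBr enormZ// mulrC ler_wpM2r//.
apply: sup_upper_bound; last by exists u => //; exists v.
(* The supremum in [ediam] is an upper bound only for a nonempty set bounded above; boundedness
   comes from a box around D. *)
split; first by exists (enorm (u - v)); exists u => //; exists v.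
have [N N0 DN] := compact_box cD.
exists (Num.sqrt (\sum_(i < n) (2 * N) ^+ 2)) => _ [a Da] [b Db <-].
rewrite /enorm ler_wsqrtr//; apply: ler_sum => i _.
rewrite -real_normK ?num_real// lerXn2r ?nnegrE ?mulr_ge0//.
rewrite !mxE (le_trans (ler_normB _ _))//.
by have := DN _ Da i; have := DN _ Db i; lra.
Qed.

End Dilation.

Section FixedTime.
Context {R : realType} d (T : measurableType d) (P : probability T R) (n : nat).
Variables (B : 'rV[R]_n -> T -> R) (C : 'rV[R]_n -> R).
Hypothesis gB : centered_gaussian_field P B.
Hypothesis CB : forall x y, \int[P]_w (B x w * B y w) = C (x - y).
Hypothesis C0 : C 0 = 1.
Hypothesis cB : forall w, continuous (fun x => B x w).
Variables (D : set 'rV[R]_n) (N t : R).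
Hypothesis cD : compact D.
Hypothesis N0 : 0 < N.
Hypothesis DN : D `<=` box n N.
Hypothesis t0 : 0 < t.

Let cS : compact (dilate t D). Proof. exact: dilate_compact. Qed.
Let tN : 0 <= t * N. Proof. by rewrite mulr_ge0// ltW. Qed.
Let SN : dilate t D `<=` box n (t * N). Proof. exact: dilate_box (ltW t0) DN. Qed.
Local Notation nu := (mfrestr (compact_measurable_rV cS) (lebV_compact_fin cS tN SN)).

Let inu (g : 'rV[R]_n -> R) : continuous g -> integ nu g.
Proof. by move=> cg; exact: (restr_continuous cS tN SN cg).1. Qed.

Lemma Yqt_herY q w : Yqt B D q t w = herY B nu q w.
Proof.
have cg : continuous (fun x => (hermite R q).[B x w]).
  by apply: (continuous_field (g := horner (hermite R q)) cB); exact: continuous_horner.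
exact: (restr_continuous cS tN SN cg).2.
Qed.

Definition Yvar q : R := q`!%:R * covint C nu q.

Lemma measurable_Yqt q : measurable_fun setT (Yqt B D q t).
Proof.
rewrite (_ : Yqt B D q t = herY B nu q); last by apply/funext => w; exact: Yqt_herY.
exact: (measurable_herY gB CB C0 cB inu).
Qed.

Lemma Yqt_moments k : [/\ integ P (Yqt B D k.+1 t), \int[P]_w Yqt B D k.+1 t w = 0,
  integ P (fun w => Yqt B D k.+1 t w ^+ 2) &
  \int[P]_w Yqt B D k.+1 t w ^+ 2 = Yvar k.+1].
Proof.
have -> : Yqt B D k.+1 t = herY B nu k.+1 by apply/funext => w; exact: Yqt_herY.
have [M [mY Y2 _]] := herY_L2 gB CB C0 cB inu k.+1.
split => //; first exact: integ_sqr.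
- exact: (herY_mean gB CB C0 cB inu).
- exact: (herY_var gB CB C0 cB inu).
Qed.

(** The volume of tD is at most (2 t N)^n, which supplies the factor t^n of the hypothesis and the
    constant (2 N)^n. The bound is in extended reals, since the cycle integrals may be infinite at a
    given t. *)
Lemma stein_bound_cycint k (K : R) (f phi dphi : R -> R) (K1 K2 c : R) : 0 <= K ->
  (forall x1 x2 x3 x4,
  `|mom P B k k k k x1 x2 x3 x4 - k`!%:R ^+ 2 * (C (x1 - x2) * C (x3 - x4)) ^+ k| <=
  K * \sum_(r < k) `|C (x1 - x2) * C (x3 - x4)| ^+ r *
    (`|C (x1 - x3) * C (x2 - x4)| ^+ (k - r) + `|C (x1 - x4) * C (x2 - x3)| ^+ (k - r))) ->
  (forall u : R, is_derive u 1 phi (dphi u)) -> continuous dphi ->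
  (forall u, `|phi u| <= K1) -> (forall u, `|dphi u| <= K2) ->
  (forall u, dphi u - u * phi u = f u - c) -> 0 < Yvar k.+1 ->
  (((\int[P]_w f (Yqt B D k.+1 t w / Num.sqrt (Yvar k.+1)) - c) ^+ 2)%:E <=
   \sum_(r < k) ((K2 * k.+1%:R) ^+ 2 * (2 * K) * (2 * N) ^+ n)%:E *
     ((t ^+ n / Yvar k.+1 ^+ 2)%:E * lebRd (fun x => lebRd (fun y => lebRd (fun z =>
       (cycint C (calB D t) r.+1 (k - r) x y z)%:E)))))%E.
Proof.
move=> K0 hK dphiE cdphi bphi bdphi fE s0.
have hs := stein_bound gB CB C0 cB inu dphiE cdphi bphi bdphi fE s0.
have hv := pairG_var_le gB CB C0 cB inu hK.
have -> : \int[P]_w f (Yqt B D k.+1 t w / Num.sqrt (Yvar k.+1)) =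
    \int[P]_w f (herY B nu k.+1 w / Num.sqrt (k.+1`!%:R * covint C nu k.+1)).
  by apply: eq_Rint => w; rewrite Yqt_herY.
apply: (@le_trans _ _ (((K2 * k.+1%:R / Yvar k.+1) ^+ 2 *
    ((2 * K) * \sum_(r < k) int4 nu (cycprod C r.+1 (k - r))))%:E)).
  by rewrite lee_fin; apply: (le_trans hs); rewrite ler_wpM2l ?sqr_ge0.
rewrite mulrA mulr_sumr -sumEFin; apply: lee_sum => r _.
have v0 : 0 < (2 * (t * N)) ^+ n by rewrite exprn_gt0// !mulr_gt0.
have SB (x y : 'rV[R]_n) : dilate t D x -> dilate t D y -> calB D t (x - y).
  by apply: dilate_calB => //; exact: ltW.
have h := int4_cycprod_le (measurable_cov gB CB C0 cB) (cov_sym CB) (measurable_calB D t)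
  (compact_measurable_rV cS) (lebV_compact_fin cS tN SN) SB (bmeas_cycprod gB CB C0 cB r.+1 (k - r))
  (lebV_compact_le cS tN SN) v0.
set I := lebRd _ in h *.
have k0 : 0 <= (K2 * k.+1%:R / Yvar k.+1) ^+ 2 * (2 * K) by rewrite mulr_ge0 ?sqr_ge0// mulr_ge0.
rewrite EFinM; apply: (@le_trans _ _ (((K2 * k.+1%:R / Yvar k.+1) ^+ 2 * (2 * K))%:E *
    (((2 * (t * N)) ^+ n)%:E * I))%E).
  by apply: lee_wpmul2l; [rewrite lee_fin|exact: h].
rewrite !muleA -!EFinM le_eqVlt; apply/orP; left; apply/eqP; congr (_%:E * _)%E.
have e (a b x y z v : R) : a * v * b * (x * (y * z)) = a * b * (x * z) * (y * v) by ring.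
by move: (Yvar k.+1) => v; rewrite !exprMn exprVn e.
Qed.

End FixedTime.

Lemma varianceE_Rint {R : realType} d (T : measurableType d) (P : probability T R)
  (X Y : T -> R) (N : set T) : measurable N -> P N = 0%E -> (forall w, ~ N w -> X w = Y w) ->
  integ P Y -> \int[P]_w Y w = 0 -> integ P (fun w => Y w ^+ 2) ->
  ('V_P[X])%E = (\int[P]_w Y w ^+ 2)%:E.
Proof.
move=> mN N0 XY iY EY iY2; rewrite /variance unlock unlock.
have -> : (\int[P]_w (X w)%:E)%E = 0%:E.
  rewrite (integral_eq_off_null mN N0 (g := EFin \o Y)); last by move=> w Nw; rewrite /= XY.
  by rewrite -EY; exact: RintE.
rewrite -(RintE iY2); apply: (integral_eq_off_null mN N0) => w Nw.
by rewrite mulrfctE /= subr0 XY// expr2.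
Qed.

Lemma cvg_of_sqr_le {R : realType} (e : R -> R) (c : R) (b : R -> \bar R) :
  (\forall t \near +oo, (((e t - c) ^+ 2)%:E <= b t)%E) -> b t @[t --> +oo] --> 0%E ->
  (e t)%:E @[t --> +oo] --> c%:E.
Proof.
move=> hb b0; apply: cvg_EFin; first by near=> t.
apply/cvgrPdist_lt => eps eps0.
have lt0 : (0 < (eps ^+ 2)%:E :> \bar R)%E by rewrite lte_fin exprn_gt0.
have hlt := b0 _ (open_ereal_lt' lt0).
near=> t.
have h1 : (((e t - c) ^+ 2)%:E <= b t)%E by near: t.
have h2 : (b t < (eps ^+ 2)%:E)%E by near: t; exact: hlt.
have := le_lt_trans h1 h2; rewrite lte_fin distrC => h.
have -> : `|e t - c| < eps = (`|e t - c| ^+ 2 < eps ^+ 2).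
  by rewrite ltr_pXn2r// nnegrE ltW.
by rewrite real_normK ?num_real.
Unshelve. all: by end_near. Qed.

Lemma cvge_sum0 {R : realType} k (F : 'I_k -> R -> \bar R) :
  (forall r, F r t @[t --> +oo] --> 0%E) -> (\sum_(r < k) F r t)%E @[t --> +oo] --> 0%E.
Proof.
elim: k F => [|k ih] F h.
  by under eq_fun do rewrite big_ord0; exact: cvg_cst.
under eq_fun do rewrite big_ord_recr /=.
have h1 := ih (fun r => F (widen_ord (leqnSn k) r)) (fun r => h _).
have := @cvgeD _ _ _ _ _ _ _ _ _ h1 (h ord_max).
by rewrite adde0; exact.
Qed.

Theorem theorem2p4 (R : realType) (dT : measure_display) (T : measurableType dT)
  (P : probability T R) (d : nat) (B : 'rV[R]_d -> T -> R) (C : 'rV[R]_d -> R)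
  (D : set 'rV[R]_d) (q : nat) :
  centered_gaussian_field P B ->
  {ae P, forall w, continuous (fun x => B x w)} ->
  (forall x y, ('E_P[B x \* B y])%E = (C (x - y))%:E) ->
  C 0 = 1 ->
  compact D ->
  (0 < volRd D)%E ->
  (2 <= q)%N ->
  (\forall t \near +oo, (0 < ('V_P[Yqt B D q t])%E)%E) ->
  (forall r : nat, (1 <= r <= q - 1)%N ->
    ((t ^+ d / fine ('V_P[Yqt B D q t])%E ^+ 2)%:E *
      lebRd (fun x => lebRd (fun y => lebRd (fun z =>
        (\1_(calB D t) x * \1_(calB D t) y * \1_(calB D t) z *
         (`|C x| ^+ r * `|C y| ^+ r * `|C z| ^+ (q - r) *
          `|C (x + y + z)| ^+ (q - r)))%:E))))%E
      @[t --> +oo] --> 0%E) ->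
  cvg_law_std_normal P
    (fun t w => Yqt B D q t w / Num.sqrt (fine ('V_P[Yqt B D q t])%E)).
Proof.
move=> gB aecB CB C0 cD _ q2 Vpos hlim f cf [Mf hMf].
have [E0 [mE0 PE0 hE0]] := ae_null_set aecB.
case: q q2 Vpos hlim => [//|k] _ Vpos hlim.
pose B' := zeroed B E0.
have gB' : centered_gaussian_field P B' := zeroed_field mE0 PE0 gB.
have cB' : forall w, continuous (fun x => B' x w) := zeroed_continuous hE0.
have CB' x y : \int[P]_w (B' x w * B' y w) = C (x - y).
  apply: EFin_inj; rewrite -CB unlock.
  rewrite -RintE; last exact: field_mul_integ.
  by apply: (integral_eq_off_null mE0 PE0) => w Ew; rewrite /= /B' !zeroedE.
have YE t w : ~ E0 w -> Yqt B D k.+1 t w = Yqt B' D k.+1 t w.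
  by move=> Ew; congr (fine (lebRd _)); apply/funext => x; rewrite /B' zeroedE.
have [N0 N00 DN0] := compact_box cD.
(* A strictly positive half-side makes the volume bound (2 t N)^d positive, as [int4_cycprod_le]
   requires. *)
pose N := N0 + 1; have N_gt0 : 0 < N by rewrite ltr_wpDl.
have DN : D `<=` box d N.
  by move=> x Dx i; rewrite (le_trans (DN0 x Dx i))// lerDl.
have [K K0 hK] := mom_bound gB' CB' C0 k.
have [phi [dphi [cdphi dphiE fE [K1 hK1] [K2 hK2]]]] := stein_solution cf hMf.
pose c : R := \int[normal_prob 0 1]_u f u.
pose v t := \int[P]_w Yqt B' D k.+1 t w ^+ 2.
have VE t : 0 < t -> ('V_P[Yqt B D k.+1 t])%E = (v t)%:E.
  move=> t0; have [i1 e1 i2 e2] := Yqt_moments gB' CB' C0 cB' cD N_gt0 DN t0 k.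
  exact: varianceE_Rint mE0 PE0 (YE t) i1 e1 i2.
pose e t := \int[P]_w f (Yqt B' D k.+1 t w / Num.sqrt (v t)).
have mf : measurable_fun setT f by exact: continuous_measurable_fun.
have cE : (\int[normal_prob 0 1]_u (f u)%:E)%E = c%:E.
  by apply: RintE; exact: (@integ_bnd _ _ _ _ _ Mf).
have eE t : 0 < t -> ('E_P[f \o (fun w => (Yqt B D k.+1 t w /
    Num.sqrt (fine ('V_P[Yqt B D k.+1 t])%E))%R)])%E = (e t)%:E.
  move=> t0; rewrite VE//= unlock -RintE.
    by apply: (integral_eq_off_null mE0 PE0) => w Ew; rewrite /= YE.
  apply: (@integ_bnd _ _ _ _ _ Mf) => //.
  apply: (measurableT_comp mf); apply: measurable_funM => //.
  exact: (measurable_Yqt gB' CB' C0 cB' cD N_gt0 DN t0).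
rewrite cE.
(* The expectation for the original field equals [e t] for t > 0 only, which suffices for a limit at
   infinity. *)
apply: cvg_trans (_ : (e t)%:E @[t --> +oo] --> c%:E).
  by apply: near_eq_cvg; near=> t; rewrite eE.
pose M := (K2 * k.+1%:R) ^+ 2 * (2 * K) * (2 * N) ^+ d.
apply: (@cvg_of_sqr_le _ _ _ (fun t => \sum_(r < k) M%:E *
  ((t ^+ d / fine ('V_P[Yqt B D k.+1 t])%E ^+ 2)%:E * lebRd (fun x => lebRd (fun y => lebRd (fun z =>
       (cycint C (calB D t) r.+1 (k - r) x y z)%:E)))))%E).
  near=> t; have t0 : 0 < t by near: t; exact: nbhs_pinfty_gt.
  have v0 : 0 < v t by rewrite -lte_fin -VE//; near: t.
  have [_ _ _ e2] := Yqt_moments gB' CB' C0 cB' cD N_gt0 DN t0 k.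
  have := @stein_bound_cycint _ _ _ _ _ _ _ gB' CB' C0 cB' _ _ _ cD N_gt0 DN t0 k K f phi dphi
    K1 K2 c K0 hK dphiE cdphi hK1 hK2 fE.
  by rewrite -e2 -/(v t) VE//; exact.
(* The index r < k stands for the exponent r + 1 of the hypothesis, which ranges over 1, ..., q - 1
   as q = k + 1; its complement q - (r + 1) is k - r. *)
apply: cvge_sum0 => r; have := hlim r.+1; rewrite !subSS subn0 /= ltn_ord => /(_ isT) h.
have fM : M%:E \is a fin_num by [].
have := cvgeZl fM h.
by rewrite mule0; exact.
Unshelve. all: by end_near.
Qed.
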